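(* Let $d\ge1$ be an integer. The sets $$X_1:=\{(A,p)\in\mathbf{F}_U(\mathbb{R}^d)\times[0,d] : \dim_{\mathrm F}(A)>p\},\qquad X_2:=\{(A,p)\in\mathbf{F}_U(\mathbb{R}^d)\times[0,d] : \dim_{\mathrm F}(A)\ge p\}$$ are $\boldsymbol\Sigma^0_2$ and $\boldsymbol\Pi^0_3$ respectively. In particular, for every $p\in[0,d)$ and $q\in(0,d]$, the sets $$\{A\in\mathbf{F}(\mathbb{R}^d) : \dim_{\mathrm F}(A)>p\},\qquad \{A\in\mathbf{F}(\mathbb{R}^d) : \dim_{\mathrm F}(A)\ge q\}$$ are $\boldsymbol\Sigma^0_2$-complete and $\boldsymbol\Pi^0_3$-complete respectively.
   Context: $\mathbf{F}(\mathbb{R}^d)$ is the set of closed subsets of $\mathbb{R}^d$ (including $\emptyset$) with the Fell topology, generated by the sets $\{F:F\cap K=\emptyset\}$ ($K\subset\mathbb{R}^d$ compact) and $\{F:F\cap U\ne\emptyset\}$ ($U\subset\mathbb{R}^d$ open); it is Polish. $\mathbf{F}_U(\mathbb{R}^d)$ is the same set with the upper Fell topology, generated only by the sets $\{F:F\cap K=\emptyset\}$, $K$ compact. Products carry the product topology. For $A\subset\mathbb{R}^d$, $\mathbb{P}(A)$ denotes the set of Borel probability measures on $\mathbb{R}^d$ with support included in $A$; $\widehat\mu(\xi)=\int_{\mathbb{R}^d} e^{-i\,\xi\cdot x}\,d\mu(x)$. The Fourier dimension is $\dim_{\mathrm F}(A)=\sup\{s\in[0,d] : (\exists\mu\in\mathbb{P}(A))(\exists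 c>0)(\forall x\in\mathbb{R}^d, x\ne 0)\ |\widehat\mu(x)|\le c|x|^{-s/2}\}$, with $\sup\emptyset=0$. Borel hierarchy (used verbatim in any topological space): $\boldsymbol\Sigma^0_1$ are the open sets, $\boldsymbol\Pi^0_1$ the closed sets; $\boldsymbol\Sigma^0_\xi$ sets ($\xi>1$) are countable unions of sets each in some $\boldsymbol\Pi^0_{\eta}$ with $\eta<\xi$; $\boldsymbol\Pi^0_\xi$ sets are complements of $\boldsymbol\Sigma^0_\xi$ sets. For $A\subset X$, $B\subset Y$ write $A\le_W B$ if there is a continuous $f:X\to Y$ with $x\in A\iff f(x)\in B$. For $Y$ Polish, $B\subset Y$ is $\boldsymbol\Gamma$-hard if $A\le_W B$ for every $A\in\boldsymbol\Gamma(X)$ and every Polish $X$ having a basis of clopen sets; it is $\boldsymbol\Gamma$-complete if it is $\boldsymbol\Gamma$-hard and $B\in\boldsymbol\Gamma(Y)$. *)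

(* Defs.v *)
From HB Require Import structures.
From mathcomp Require Import all_boot all_order all_algebra.
From mathcomp Require Import all_classical all_reals all_analysis.
From mathcomp Require Import complex.

Set Implicit Arguments.
Unset Strict Implicit.
Unset Printing Implicit Defensive.

Import Order.TTheory GRing.Theory Num.Theory.
Import numFieldNormedType.Exports.

Local Open Scope classical_set_scope.
Local Open Scope ring_scope.

Record closed_set (R : realType) (d : nat) := ClosedSet {
  carrier_of :> set 'rV[R]_d ;
  closed_carrier : closed carrier_of }.

HB.instance Definition _ (R : realType) (d : nat) :=
  gen_eqMixin (closed_set R d).
HB.instance Definition _ (R : realType) (d : nat) :=
  gen_choiceMixin (closed_set R d).

Definition miss (R : realType) (d : nat) (K : set 'rV[R]_d) :
  set (closed_set R d) := [set F | F `&` K = set0].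

Definition hit (R : realType) (d : nat) (U : set 'rV[R]_d) :
  set (closed_set R d) := [set F | F `&` U !=set0].

Definition upper_fell_subbase (R : realType) (d : nat) :
  set (set (closed_set R d)) := [set miss K | K in compact].

Definition fell_subbase (R : realType) (d : nat) :
  set (set (closed_set R d)) :=
  [set miss K | K in compact] `|` [set hit U | U in open].

Definition fell (R : realType) (d : nat) : Type := closed_set R d.
Definition upper_fell (R : realType) (d : nat) : Type := closed_set R d.

Definition fell_set (R : realType) (d : nat) (F : fell R d) : set 'rV[R]_d :=
  carrier_of F.
Coercion fell_set : fell >-> set.
Definition upper_fell_set (R : realType) (d : nat) (F : upper_fell R d) :
  set 'rV[R]_d := carrier_of F.
Coercion upper_fell_set : upper_fell >-> set.

HB.instance Definition _ (R : realType) (d : nat) :=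
  Choice.copy (fell R d) (closed_set R d).
HB.instance Definition _ (R : realType) (d : nat) :=
  isSubBaseTopological.Build (fell R d) (@fell_subbase R d) id.

HB.instance Definition _ (R : realType) (d : nat) :=
  Choice.copy (upper_fell R d) (closed_set R d).
HB.instance Definition _ (R : realType) (d : nat) :=
  isSubBaseTopological.Build (upper_fell R d) (@upper_fell_subbase R d) id.

(* The library norm on 'rV[R]_d is the sup norm; it induces the same topology
   as the Euclidean norm used below. *)
Definition dotp (R : realType) (d : nat) (x y : 'rV[R]_d) : R :=
  \sum_(i < d) x 0 i * y 0 i.

Definition enorm (R : realType) (d : nat) (x : 'rV[R]_d) : R :=
  Num.sqrt (dotp x x).

Definition borel_space (R : realType) (d : nat) :=
  g_sigma_algebraType (@open 'rV[R]_d).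

Definition msupport (R : realType) (d : nat)
    (mu : probability (borel_space R d) R) : set 'rV[R]_d :=
  [set x | forall U : set 'rV[R]_d, open U -> U x -> (0 < mu U)%E].

(* exp(-it) = cos t - i sin t, integrated componentwise. *)
Definition fourier (R : realType) (d : nat)
    (mu : probability (borel_space R d) R) (xi : 'rV[R]_d) : R[i] :=
  Complex (\int[mu]_x cos (dotp xi x)) (- \int[mu]_x sin (dotp xi x)).

(* sup is 0 on the empty set, and the set below is bounded by d. *)
Definition fourier_dim (R : realType) (d : nat) (A : set 'rV[R]_d) : R :=
  sup [set s : R | 0 <= s <= d%:R /\
    exists mu : probability (borel_space R d) R, msupport mu `<=` A /\
    exists c : R, 0 < c /\
    forall x : 'rV[R]_d, x != 0 ->
      ComplexField.Normc.normc (fourier mu x) <= c * enorm x `^ (- (s / 2))].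

(* The finite levels n >= 1 of the Borel hierarchy; level 0 is empty. *)
Inductive Sigma0 (n : nat) (T : topologicalType) : set T -> Prop :=
| Sigma0_open (A : set T) : n = 1%N -> open A -> Sigma0 n A
| Sigma0_bigcup (m : nat -> nat) (F : nat -> set T) : (1 < n)%N ->
    (forall i, (m i < n)%N) -> (forall i, Sigma0 (m i) (~` F i)) ->
    Sigma0 n (\bigcup_i F i).

Definition Pi0 (n : nat) (T : topologicalType) (A : set T) : Prop :=
  Sigma0 n (~` A).

Record is_complete_metric (R : realType) (X : topologicalType)
    (dist : X -> X -> R) : Prop := IsCompleteMetric {
  dist_xx : forall x, dist x x = 0 ;
  dist_eq0 : forall x y, dist x y = 0 -> x = y ;
  dist_sym : forall x y, dist x y = dist y x ;
  dist_triangle : forall y x z, dist x z <= dist x y + dist y z ;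
  dist_nbhs : forall (x : X) (A : set X),
    nbhs x A <-> exists2 e : R, 0 < e & [set y | dist x y < e] `<=` A ;
  dist_complete : forall u : nat -> X,
    (forall e : R, 0 < e -> exists N : nat, forall m n : nat,
      (N <= m)%N -> (N <= n)%N -> dist (u m) (u n) < e) ->
    exists l : X, u @ \oo --> l }.

Definition polish (R : realType) (X : topologicalType) : Prop :=
  (exists dist : X -> X -> R, is_complete_metric dist) /\
  (exists2 D : set X, countable D & dense D).

(* The library predicate zero_dimensional only asks that clopen sets separate
   points, which is weaker than having a basis of clopen sets. *)
Definition has_clopen_basis (X : topologicalType) : Prop :=
  exists2 B : set (set X), B `<=` clopen & basis B.

Definition wadge_le (X Y : topologicalType) (A : set X) (B : set Y) : Prop :=
  exists2 f : X -> Y, continuous f & forall x, A x <-> B (f x).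

Definition pointclass := forall T : topologicalType, set (set T).

Definition hard (R : realType) (Gamma : pointclass) (Y : topologicalType)
    (B : set Y) : Prop :=
  forall X : topologicalType, polish R X -> has_clopen_basis X ->
  forall A : set X, Gamma X A -> wadge_le A B.

Definition complete_for (R : realType) (Gamma : pointclass)
    (Y : topologicalType) (B : set Y) : Prop :=
  hard R Gamma B /\ Gamma Y B.

(* set_type (dim_range R d) carries the subspace topology of [0, d]. *)
Definition dim_range (R : realType) (d : nat) : set R :=
  [set x | 0 <= x <= d%:R].
Arguments dim_range : clear implicits.

(* Main.v *)
(* A measure of Fourier decay [s] gives mass 0 to a set covered, at
   arbitrarily small scales r, by r^-b balls of radius r with b < s: average
   cos(v . (x - y)) over a grid of frequencies v to get a nonnegative kernel
   concentrated near the diagonal, of energy bounded by the decay, and apply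
   Chebyshev.  Conversely, for 0 < s < b a probability of decay [s] lives on a
   compact set with such coverings: at each scale one replaces the previous
   finite set by its sumset with few points picked greedily from a finite set
   whose uniform measure has a product of cosines as characteristic function.

   Upper bounds: in the upper Fell topology, the sets carrying a probability of
   decay [q] with constant [c], half of whose mass lies in the ball of radius
   [N], have all their closure points [A] in {dim >= q}.  Indeed the
   neighbourhoods of [A] that avoid compact pieces of its complement yield
   measures which, multiplied by slowly varying trigonometric weights, form a
   tight sequence; its limit points live on [A].  Hence {dim > p} is a countable
   union of closed sets.

   Hardness: over a zero-dimensional Polish space let [F i] be closed and [T i]
   be compact sets escaping to infinity.  Put in the [i]-th block [T i] when x
   is in [F i], and otherwise a finite subset of [T i], larger and larger as x
   approaches [F i].  The union of the blocks depends continuously on x, and its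
   dimension is governed by the [T i] for which x is in [F i], since countable
   sets are negligible. *)
Require Import Defs.
From HB Require Import structures.
From mathcomp Require Import all_boot all_order all_algebra.
From mathcomp Require Import all_classical all_reals all_analysis.
From mathcomp Require Import measurable_realfun.
From mathcomp Require Import zify ring lra.
From mathcomp Require complex.

Set Implicit Arguments.
Unset Strict Implicit.
Unset Printing Implicit Defensive.

Import Order.TTheory GRing.Theory Num.Theory.
Import numFieldNormedType.Exports.

Local Open Scope classical_set_scope.
Local Open Scope ring_scope.

(** * Means and their decay *)

(** Decay is stated for the real waves cos (xi . x + t) with all phases t. Translating a measure
    then only changes t, so a bound at a frequency survives convolution with any other measure.
    Ultrafilter limits replace the extraction of subsequences.

    The obstacle in the upper bounds is loss of mass: a fixed ball retains half of it, but the rest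
    may escape to infinity, and a weak limit need not be a probability. A generic cutoff could spoil
    the decay. A product of cosines whose frequencies have bounded total length only replaces xi by
    frequencies at bounded distance from it, so decay is lost only up to a constant.

    The construction of compact sets follows random constructions of Salem sets, with the random
    choice replaced by the method of conditional expectations. It needs s < b strictly: the sampling
    error carries a factor linear in the scale index, and the points chosen earlier multiply the
    cardinality. Each cost is absorbed by its own positive gap between exponents. *)

Section bounded_measurable.
Context {R : realType} {disp : measure_display} {T : measurableType disp}.
Implicit Types f g : T -> R.

Definition bmeas f := measurable_fun setT f /\ exists M, forall x, `|f x| <= M.

Lemma bmeas_cst (a : R) : bmeas (fun=> a).
Proof. by split; [exact: measurable_cst|exists `|a|]. Qed.

Lemma bmeasD f g : bmeas f -> bmeas g -> bmeas (fun x => f x + g x).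
Proof.
move=> [mf [M fM]] [mg [N gN]]; split; first exact: measurable_funD.
exists (M + N) => x; exact: le_trans (ler_normD _ _) (lerD (fM x) (gN x)).
Qed.

Lemma bmeasM f g : bmeas f -> bmeas g -> bmeas (fun x => f x * g x).
Proof.
move=> [mf [M fM]] [mg [N gN]]; split; first exact: measurable_funM.
by exists (M * N) => x; rewrite normrM ler_pM.
Qed.

Lemma bmeasZ (a : R) f : bmeas f -> bmeas (fun x => a * f x).
Proof. exact/bmeasM/bmeas_cst. Qed.

Lemma bmeasN f : bmeas f -> bmeas (fun x => - f x).
Proof.
by move=> bf; under eq_fun do rewrite -mulN1r; apply: bmeasZ.
Qed.

Lemma bmeasB f g : bmeas f -> bmeas g -> bmeas (fun x => f x - g x).
Proof. by move=> bf bg; apply: bmeasD => //; exact: bmeasN. Qed.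

Lemma bmeas_sum (I : Type) (r : seq I) (F : I -> T -> R) :
  (forall i, bmeas (F i)) -> bmeas (fun x => \sum_(i <- r) F i x).
Proof.
move=> bF; elim: r => [|i r IH].
  by under eq_fun do rewrite big_nil; exact: bmeas_cst.
by under eq_fun do rewrite big_cons; exact: bmeasD.
Qed.

Lemma bmeas_prod (I : Type) (r : seq I) (F : I -> T -> R) :
  (forall i, bmeas (F i)) -> bmeas (fun x => \prod_(i <- r) F i x).
Proof.
move=> bF; elim: r => [|i r IH].
  by under eq_fun do rewrite big_nil; exact: bmeas_cst.
by under eq_fun do rewrite big_cons; exact: bmeasM.
Qed.

Lemma bmeas_indic (A : set T) : measurable A -> bmeas (\1_A : T -> R).
Proof.
move=> mA; split; first exact: measurable_indic.
by exists 1 => x; rewrite indicE ger0_norm// lern1 leq_b1.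
Qed.

Record is_mean (E : (T -> R) -> R) : Prop := IsMean {
  meanD : forall f g, bmeas f -> bmeas g ->
    E (fun x => f x + g x) = E f + E g ;
  meanZ : forall a f, bmeas f -> E (fun x => a * f x) = a * E f ;
  mean_le : forall f g, bmeas f -> bmeas g ->
    (forall x, f x <= g x) -> E f <= E g ;
  mean1 : E (fun=> 1) = 1 }.

Section mean_theory.
Variables (E : (T -> R) -> R) (mE : is_mean E).

Lemma mean_cst a : E (fun=> a) = a.
Proof.
rewrite -[RHS]mulr1 -(mean1 mE) -(meanZ mE); last exact: bmeas_cst.
by congr E; apply/funext => x; rewrite mulr1.
Qed.

Lemma meanB f g : bmeas f -> bmeas g -> E (fun x => f x - g x) = E f - E g.
Proof.
move=> bf bg; rewrite (meanD mE)//; last exact: bmeasN.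
congr (_ + _); rewrite -mulN1r -(meanZ mE)//.
by congr E; apply/funext => x; rewrite mulN1r.
Qed.

Lemma mean_sum (I : Type) (r : seq I) (F : I -> T -> R) :
  (forall i, bmeas (F i)) ->
  E (fun x => \sum_(i <- r) F i x) = \sum_(i <- r) E (F i).
Proof.
move=> bF; elim: r => [|i r IH].
  by under eq_fun do rewrite big_nil; rewrite mean_cst big_nil.
under eq_fun do rewrite big_cons.
by rewrite big_cons -IH (meanD mE)//; exact: bmeas_sum.
Qed.

Lemma mean_ge0 f : bmeas f -> (forall x, 0 <= f x) -> 0 <= E f.
Proof.
by move=> bf f0; rewrite -(mean_cst 0); apply: (mean_le mE) => //; exact: bmeas_cst.
Qed.

Lemma mean_le_cst f a : bmeas f -> (forall x, f x <= a) -> E f <= a.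
Proof.
by move=> bf f0; rewrite -(mean_cst a); apply: (mean_le mE) => //; exact: bmeas_cst.
Qed.

Lemma mean_norm_le f g : bmeas f -> bmeas g -> (forall x, `|f x| <= g x) ->
  `|E f| <= E g.
Proof.
move=> bf bg fg; rewrite ler_norml; apply/andP; split; last first.
  by apply: (mean_le mE) => // x; exact: le_trans (ler_norm _) (fg x).
rewrite -[- E g]mulN1r -(meanZ mE)//; apply: (mean_le mE) => // [|x].
  exact: bmeasZ.
by rewrite mulN1r; have := fg x; rewrite ler_norml => /andP[].
Qed.

End mean_theory.

Section prob_mean.
Variable P : probability T R.

Lemma bmeas_integrable f : bmeas f -> P.-integrable setT (EFin \o f).
Proof.
move=> [mf [M fM]]; apply: measurable_bounded_integrable => //.
  by apply: le_lt_trans (probability_le1 _ _) _ => //; exact: ltry.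
exists M; split; first exact: num_real.
by move=> N MN x _ /=; exact: le_trans (fM x) (ltW MN).
Qed.

Lemma prob_mean : is_mean (fun f => \int[P]_x f x).
Proof.
split=> [f g bf bg|a f bf|f g bf bg fg|].
- by rewrite RintegralD//; exact: bmeas_integrable.
- by rewrite RintegralZl//; exact: bmeas_integrable.
- by apply: le_Rintegral => //; exact: bmeas_integrable.
- by rewrite Rintegral_cst//= probability_setT mulr1.
Qed.

Lemma Rintegral_indic (A : set T) : measurable A ->
  \int[P]_x (\1_A x : R) = fine (P A).
Proof.
by move=> mA; rewrite /Rintegral integral_indic// setIT.
Qed.

End prob_mean.

End bounded_measurable.

Section average.
Context {R : realType} {T : Type}.

Definition avg (l : seq T) (f : T -> R) := (\sum_(x <- l) f x) / (size l)%:R.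

Lemma avgD l f g : avg l (fun x => f x + g x) = avg l f + avg l g.
Proof. by rewrite /avg big_split/= mulrDl. Qed.

Lemma avgZ l a f : avg l (fun x => a * f x) = a * avg l f.
Proof. by rewrite /avg -mulr_sumr mulrA. Qed.

Lemma avg_le l f g : (forall x, f x <= g x) -> avg l f <= avg l g.
Proof.
by move=> fg; rewrite /avg ler_wpM2r ?invr_ge0// ler_sum.
Qed.

Lemma avg_cst l a : (0 < size l)%N -> avg l (fun=> a) = a.
Proof.
move=> l0; rewrite /avg big_const_seq count_predT iter_addr_0 -[a *+ _]mulr_natr mulfK//.
by rewrite pnatr_eq0 -lt0n.
Qed.

End average.

Lemma avg_mean {R : realType} {disp : measure_display}
    {T : measurableType disp} (l : seq T) : (0 < size l)%N ->
  is_mean (avg l : (T -> R) -> R).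
Proof.
move=> l0; split=> *; [exact: avgD|exact: avgZ|exact: avg_le|exact: avg_cst].
Qed.

Lemma mean_pushforward {R : realType} {d1 d2 : measure_display}
    {T1 : measurableType d1} {T2 : measurableType d2} (P : probability T1 R)
    (g : T1 -> T2) : measurable_fun setT g ->
  exists Q : probability T2 R, (forall A, Q A = P (g @^-1` A)) /\
    forall f, bmeas f -> \int[Q]_x f x = \int[P]_x f (g x).
Proof.
move=> mg.
pose X : {mfun T1 >-> T2} :=
  HB.pack g (isMeasurableFun.Build _ _ T1 T2 g mg).
exists (distribution P X : probability T2 R); split => // f bf.
rewrite /Rintegral integral_distribution//.
- by case: bf => mf _; exact/measurable_EFinP.
- apply: bmeas_integrable; case: bf => mf [M fM]; split; last by exists M => x /=.
  exact: measurableT_comp.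
Qed.

(** * Norm, Borel sets and supports on row vectors *)

Section row_vectors.
Context {R : realType} {d : nat}.
Implicit Types (x y z : 'rV[R]_d) (U : set 'rV[R]_d).

Lemma coord_le_norm x i : `|x 0 i| <= `|x|.
Proof.
rewrite [leRHS]/Num.norm/= mx_normrE.
exact: (le_bigmax _ (fun ij : 'I_1 * 'I_d => `|x ij.1 ij.2|) (0, i)).
Qed.

Lemma norm_le_coord x (r : R) : 0 <= r -> (forall i, `|x 0 i| <= r) -> `|x| <= r.
Proof.
move=> r0 xr; rewrite [leLHS]/Num.norm/= mx_normrE; apply/bigmax_leP.
by split => // -[i j] _ /=; rewrite ord1.
Qed.

Lemma norm_lt_coord x (r : R) : 0 < r -> (forall i, `|x 0 i| < r) -> `|x| < r.
Proof.
move=> r0 xr; rewrite [ltLHS]/Num.norm/= mx_normrE; apply/bigmax_ltP.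
by split => // -[i j] _ /=; rewrite ord1.
Qed.

Lemma norm_eq_coord x : (0 < d)%N -> exists i, `|x 0 i| = `|x|.
Proof.
move=> d0; have [x0|x0] := eqVneq `|x| 0.
  exists (Ordinal d0); apply/eqP; rewrite x0 eq_le normr_ge0 andbT -x0.
  exact: coord_le_norm.
have [[i j] /= H] := mx_norm_neq0 x0.
by exists j; rewrite [RHS]H ord1.
Qed.

Lemma ball_normE (r : R) x y : ball x r y = (`|x - y| < r).
Proof. by rewrite -ball_normE. Qed.

(** A countable basis indexed by all of [nat]: indices that code nothing give the empty set. *)
Definition rat_ball (i : nat) : set 'rV[R]_d :=
  if (unpickle i : option ('rV[rat]_d * nat)) is Some (q, n) then
    ball (map_mx ratr q : 'rV[R]_d) (n.+1%:R^-1 : R) else set0.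

Lemma rat_ball_open i : open (rat_ball i).
Proof.
rewrite /rat_ball; case: unpickle => [[q n]|]; last exact: open0.
exact: ball_open.
Qed.

Lemma rat_ball_basis U x : open U -> U x ->
  exists i, rat_ball i x /\ rat_ball i `<=` U.
Proof.
move=> oU Ux.
have /nbhs_ballP[e /= e0 eU] : nbhs x U by exact: open_nbhs_nbhs.
have [n ne] : exists n, n.+1%:R^-1 < e / 2 :> R.
  have := near_infty_natSinv_lt (PosNum (divr_gt0 e0 (ltr0Sn R 1))).
  by move=> [N _ /(_ N)/(_ (leqnn N))] ?; exists N.
have rq i : {q : rat | `|x 0 i - ratr q| < n.+1%:R^-1}.
  apply: cid; have /rat_in_itvoo[q] : x 0 i - n.+1%:R^-1 < x 0 i + n.+1%:R^-1.
    by rewrite ltrD2l gtrN// ?invr_gt0.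
  by rewrite in_itv/= => xq; exists q; rewrite ltr_distlC.
exists (pickle ((\row_i sval (rq i), n) : 'rV[rat]_d * nat)); rewrite /rat_ball pickleK.
have xb : ball (map_mx ratr (\row_i sval (rq i)) : 'rV[R]_d) (n.+1%:R^-1 : R) x.
  rewrite ball_normE norm_lt_coord ?invr_gt0// => i; rewrite !mxE distrC.
  by case: (rq i).
split => // y yb; apply: eU; rewrite ball_normE.
apply: lt_trans (_ : n.+1%:R^-1 + n.+1%:R^-1 < e); last first.
  by rewrite [ltRHS]splitr ltrD.
move: xb yb; rewrite !ball_normE => xb yb.
rewrite (le_lt_trans (ler_distD (map_mx ratr (\row_i sval (rq i)) : 'rV[R]_d) _ _))//.
by rewrite ltrD// distrC.
Qed.

Lemma open_bigcup_rat_ball U : open U ->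
  U = \bigcup_(i in [set i | rat_ball i `<=` U]) rat_ball i.
Proof.
move=> oU; apply/seteqP; split => [x Ux|x [i iU]]; last exact: iU.
by have [i [ix iU]] := rat_ball_basis oU Ux; exists i.
Qed.

Lemma borel_setC (A : set (borel_space R d)) :
  measurable A -> measurable (~` A).
Proof. exact: measurableC. Qed.

Lemma measurable_open U : open U -> measurable (U : set (borel_space R d)).
Proof. by move=> oU; apply: sub_sigma_algebra. Qed.

Lemma measurable_closed U : closed U -> measurable (U : set (borel_space R d)).
Proof.
move=> cU; rewrite -(setCK U); apply: borel_setC.
by apply: measurable_open; exact: closed_openC.
Qed.

Lemma continuous_borel_fun (f : 'rV[R]_d -> R) : continuous f ->
  measurable_fun (setT : set (borel_space R d)) f.
Proof.
move=> /continuousP cf; apply: (@measurability _ _ (borel_space R d) _ _ _ _ (RGenOpens.measurableE R)).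
move=> _ [_ [a [b ->] <-]]; rewrite setTI; apply: measurable_open.
exact/cf/interval_open.
Qed.

Lemma measurable_norm_gt (r : R) :
  measurable ([set x | r < `|x|] : set (borel_space R d)).
Proof.
have mn : measurable_fun setT (fun x : borel_space R d => `|(x : 'rV[R]_d)|).
  by apply: continuous_borel_fun => x; exact: norm_continuous.
rewrite [X in measurable X](_ : _ = setT `&`
    (fun x : borel_space R d => `|(x : 'rV[R]_d)|) @^-1` `]r, +oo[%classic).
  exact: mn.
by rewrite setTI; apply/seteqP; split => x /=; rewrite in_itv/= andbT.
Qed.

(** An open set is a countable union of rational balls, and a ball of the sup norm is a cube, whose
    preimage is a finite intersection of coordinate preimages. *)
Lemma measurable_fun_rV disp (T : measurableType disp)
    (f : T -> 'rV[R]_d) : (forall i, measurable_fun setT (fun t => f t 0 i)) ->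
  measurable_fun setT (f : T -> borel_space R d).
Proof.
move=> mf; apply: (@measurability _ _ T (borel_space R d) setT f (@open 'rV[R]_d)) => //.
move=> _ [U oU <-]; rewrite setTI (open_bigcup_rat_ball oU) preimage_bigcup.
apply: bigcup_measurable => i _; rewrite /rat_ball.
case: unpickle => [[q n]|]; last by rewrite preimage_set0.
rewrite (_ : _ @^-1` _ =
  \bigcap_(i in setT) ((fun t => f t 0 i) @^-1`
     (ball (ratr (q 0 i) : R) (n.+1%:R^-1 : R)))); last first.
  apply/seteqP; split => [t /=|t /= H].
    move=> [_ tb] i0 _ /=; have := tb 0 i0; by rewrite mxE.
  split; first by rewrite invr_gt0.
  by move=> i0 j; rewrite ord1 mxE; exact: H.
apply: fin_bigcap_measurable => // j _.
rewrite -[X in measurable X]setTI; apply: mf => //.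
by apply: open_measurable; exact: ball_open.
Qed.

(** A point outside the support lies in a null rational ball, and there are only countably many of
    these. *)
Lemma measure_msupportC (mu : probability (borel_space R d) R) :
  mu (~` msupport mu) = 0%E.
Proof.
pose I := [set i | mu (rat_ball i) = 0%E].
have -> : ~` msupport mu = \bigcup_(i in I) rat_ball i.
  apply/seteqP; split => [x|x [i Ii ix]].
    move=> /existsNP[U] /not_implyP[oU] /not_implyP[Ux] /negP.
    rewrite lt0e measure_ge0 andbT negbK => /eqP U0.
    have [i [ix iU]] := rat_ball_basis oU Ux; exists i => //.
    apply/eqP; rewrite -measure_le0; rewrite -U0 le_measure// inE.
      by apply: measurable_open; exact: rat_ball_open.
    exact: measurable_open.
  move=> /(_ _ (@rat_ball_open i) ix); by rewrite Ii ltxx.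
rewrite bigcup_mkcond.
have mB i : measurable ((if i \in I then rat_ball i else set0)
    : set (borel_space R d)).
  by case: ifPn => // _; apply: measurable_open; exact: rat_ball_open.
apply: measure_negligible; first exact: bigcupT_measurable.
apply: negligible_bigcup => i; apply/negligibleP => //.
by case: ifPn => [/set_mem//|_]; rewrite measure0.
Qed.

Lemma msupport_sub (mu : probability (borel_space R d) R) (A : set 'rV[R]_d) :
  closed A -> msupport mu `<=` A -> mu (~` A) = 0%E.
Proof.
move=> cA sA; apply/eqP; rewrite -measure_le0 -(measure_msupportC mu).
have mS : measurable (~` msupport mu : set (borel_space R d)).
  have -> : ~` msupport mu = \bigcup_(U in [set U | open U /\ mu U = 0%E]) U.
    apply/seteqP; split => [x|x [U [oU U0] Ux] /(_ _ oU Ux)].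
      move=> /existsNP[U] /not_implyP[oU] /not_implyP[Ux] /negP.
      rewrite lt0e measure_ge0 andbT negbK => /eqP U0.
      by exists U.
    by rewrite U0 ltxx.
  by apply: measurable_open; apply: bigcup_open => U [].
rewrite le_measure ?inE//; last exact: subsetC.
by apply: measurable_open; exact: closed_openC.
Qed.

End row_vectors.

Lemma continuous_sum {R : realType} {T : topologicalType} (I : Type)
    (r : seq I) (F : I -> T -> R) : (forall i, continuous (F i)) ->
  continuous (fun x => \sum_(i <- r) F i x).
Proof.
move=> cF; elim: r => [|i r IH] x.
  by under eq_fun do rewrite big_nil; exact: cvg_cst.
under eq_fun do rewrite big_cons.
by apply: cvgD; [exact: cF|exact: IH].
Qed.

Section continuous_real_functions.
Context {R : realType} {T : topologicalType}.
Implicit Types f g : T -> R.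

Lemma continuous_add f g : continuous f -> continuous g ->
  continuous (fun x => f x + g x).
Proof. by move=> cf cg x; apply: cvgD; [exact: cf|exact: cg]. Qed.

Lemma continuous_mul f g : continuous f -> continuous g ->
  continuous (fun x => f x * g x).
Proof. by move=> cf cg x; apply: cvgM; [exact: cf|exact: cg]. Qed.

Lemma continuous_const (a : R) : continuous (fun _ : T => a).
Proof. by move=> x; exact: cvg_cst. Qed.

Lemma continuous_after f (h : R -> R) : continuous h -> continuous f ->
  continuous (fun x => h (f x)).
Proof. by move=> ch cf x; apply: continuous_comp; [exact: cf|exact: ch]. Qed.

End continuous_real_functions.

(** * Fourier decay expressed by real waves *)

Section fourier_decay.
Context {R : realType} {d : nat}.
Implicit Types (x y xi : 'rV[R]_d) (t B s c : R).

Definition wave xi t : borel_space R d -> R := fun x => cos (dotp xi x + t).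

Lemma dotpDl x y z : dotp (x + y) z = dotp x z + dotp y z :> R.
Proof. by rewrite /dotp -big_split; apply: eq_bigr => i _; rewrite mxE mulrDl. Qed.

Lemma dotpDr x y z : dotp z (x + y) = dotp z x + dotp z y :> R.
Proof. by rewrite /dotp -big_split; apply: eq_bigr => i _; rewrite mxE mulrDr. Qed.

Lemma dotpNl x y : dotp (- x) y = - dotp x y :> R.
Proof. by rewrite /dotp -sumrN; apply: eq_bigr => i _; rewrite mxE mulNr. Qed.

Lemma dotpNr x y : dotp y (- x) = - dotp y x :> R.
Proof. by rewrite /dotp -sumrN; apply: eq_bigr => i _; rewrite mxE mulrN. Qed.

Lemma dotp_norm_le x y : `|dotp x y| <= d%:R * (`|x| * `|y|).
Proof.
rewrite (le_trans (ler_norm_sum _ _ _))//.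
have -> : d%:R * (`|x| * `|y|) = \sum_(i < d) (`|x| * `|y|).
  by rewrite big_const card_ord iter_addr_0 mulr_natl.
by apply: ler_sum => i _; rewrite normrM ler_pM// coord_le_norm.
Qed.

Lemma coord_rV_continuous i : continuous (fun x => x 0 i).
Proof. by move=> x; exact: coord_continuous. Qed.

Lemma dotp_continuous xi : continuous (fun x => dotp xi x).
Proof.
apply: continuous_sum => i; apply: continuous_mul; first exact: continuous_const.
exact: coord_rV_continuous.
Qed.

Lemma wave_continuous xi t : continuous (wave xi t : 'rV[R]_d -> R).
Proof.
apply: continuous_after; first exact: continuous_cos.
by apply: continuous_add; [exact: dotp_continuous|exact: continuous_const].
Qed.

Lemma bmeas_continuous (f : 'rV[R]_d -> R) M : continuous f ->
  (forall x, `|f x| <= M) -> bmeas (f : borel_space R d -> R).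
Proof. by move=> cf fM; split; [exact: continuous_borel_fun|exists M]. Qed.

Lemma bmeas_wave xi t : bmeas (wave xi t).
Proof. by apply: (@bmeas_continuous _ 1) => [|x]; [exact: wave_continuous|exact: cos_max]. Qed.

Lemma wave_shift xi t x y : wave xi t (x + y) = wave xi (dotp xi y + t) x.
Proof. by rewrite /wave dotpDr addrA. Qed.

(** Quantifying over the phase t replaces the modulus of the transform ([fourier_norm_le]). The sup
    norm of xi instead of the Euclidean one changes only the constant ([decay_fourier]). *)
Definition decay (E : (borel_space R d -> R) -> R) s c :=
  forall xi t, xi != 0 -> E (wave xi t) <= c * `|xi| `^ (- (s / 2)).

Lemma mean_wave (E : (borel_space R d -> R) -> R) xi t : is_mean E ->
  E (wave xi t) = E (fun x => cos (dotp xi x)) * cos t -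
                  E (fun x => sin (dotp xi x)) * sin t.
Proof.
move=> mE.
have bc : bmeas (fun x : borel_space R d => cos (dotp xi x)).
  have := bmeas_wave xi 0; congr bmeas; apply/funext => x.
  by rewrite /wave addr0.
have bs : bmeas (fun x : borel_space R d => sin (dotp xi x)).
  have := bmeas_wave xi (- (pi / 2)); congr bmeas; apply/funext => x.
  by rewrite /wave cosBpihalf.
rewrite mulrC -(meanZ mE)// [_ * sin t]mulrC -(meanZ mE)// -(meanB mE)//; last 2 first.
- exact: bmeasZ.
- exact: bmeasZ.
by congr E; apply/funext => x; rewrite /wave cosD; lra.
Qed.

(** Take for t minus the argument of a + i b, the left side being the real part of (a + i b) exp (i
    t). *)
Lemma polar_angle (a b : R) : exists t,
  a * cos t - b * sin t = Num.sqrt (a ^+ 2 + b ^+ 2).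
Proof.
set r := Num.sqrt _; have [r0|r0] := eqVneq r 0.
  exists 0; rewrite r0 cos0 sin0.
  have ab : a ^+ 2 + b ^+ 2 <= 0 by rewrite -sqrtr_eq0; apply/eqP.
  suff -> : a = 0 by rewrite mul0r mulr0 subr0.
  apply/eqP; rewrite -sqrf_eq0 eq_le sqr_ge0 andbT.
  by apply: le_trans ab; rewrite lerDl sqr_ge0.
have rgt0 : 0 < r by rewrite lt_def r0 sqrtr_ge0.
have r2 : r ^+ 2 = a ^+ 2 + b ^+ 2 by rewrite sqr_sqrtr// addr_ge0// sqr_ge0.
have ar : -1 <= a / r <= 1.
  by rewrite ler_pdivlMr// ler_pdivrMr//; apply/andP; split; nra.
have sq : Num.sqrt (1 - (a / r) ^+ 2) = `|b| / r.
  have -> : 1 - (a / r) ^+ 2 = (`|b| / r) ^+ 2.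
    rewrite !expr_div_n real_normK ?num_real// r2; field.
    by rewrite -r2 expf_neq0.
  by rewrite sqrtr_sqr ger0_norm// divr_ge0// ltW.
have rE : a * (a / r) + b * b / r = r.
  by rewrite mulrA -mulrDl -!expr2 -r2 expr2 mulfK.
have [b0|b0] := leP 0 b.
  exists (- acos (a / r)).
  rewrite cosN sinN acosK ?in_itv//= sin_acos// sq ger0_norm//.
  by rewrite -[RHS]rE; ring.
exists (acos (a / r)).
rewrite acosK ?in_itv//= sin_acos// sq ltr0_norm//.
by rewrite -[RHS]rE; ring.
Qed.

(** The modulus is the maximum over t of the real part after a rotation by t, and [polar_angle]
    shows that it is attained. *)
Lemma fourier_norm_le (mu : probability (borel_space R d) R) xi B :
  complex.ComplexField.Normc.normc (fourier mu xi) <= B <->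
  forall t, \int[mu]_x wave xi t x <= B.
Proof.
rewrite /fourier /complex.ComplexField.Normc.normc sqrrN.
set a := Rintegral _ _ _; set b := Rintegral _ _ _.
have E t : \int[mu]_x wave xi t x = a * cos t - b * sin t.
  exact: (mean_wave xi t (prob_mean mu)).
split => [abB t|H].
  rewrite E; apply: le_trans abB; apply: le_trans (ler_norm _) _.
  rewrite -sqrtr_sqr ler_sqrt; last by rewrite addr_ge0// sqr_ge0.
  have -> : a ^+ 2 + b ^+ 2 =
      (a * cos t - b * sin t) ^+ 2 + (a * sin t + b * cos t) ^+ 2.
    by rewrite -[LHS]mulr1 -(cos2Dsin2 t); ring.
  by rewrite lerDl sqr_ge0.
by have [t <-] := polar_angle a b; rewrite -E.
Qed.

Lemma norm_le_enorm x : `|x| <= enorm x.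
Proof.
apply: norm_le_coord => [|i]; first exact: sqrtr_ge0.
rewrite -sqrtr_sqr /enorm ler_sqrt; last by apply: sumr_ge0 => j _; exact: sqr_ge0.
rewrite /dotp (bigD1 i)//= -expr2 lerDl.
by apply: sumr_ge0 => j _; exact: sqr_ge0.
Qed.

Lemma enorm_le_norm x : enorm x <= d%:R * `|x|.
Proof.
rewrite -[leRHS]ger0_norm ?mulr_ge0// -sqrtr_sqr /enorm ler_sqrt ?sqr_ge0//.
apply: le_trans (ler_norm _) _; apply: le_trans (dotp_norm_le x x) _.
rewrite exprMn -expr2 ler_wpM2r ?sqr_ge0// expr2.
case: (d) => [|n]; first by rewrite mul0r.
by rewrite ler_peMl// ler1n.
Qed.

Lemma powRN_le (x y e : R) : 0 <= e -> 0 < x -> x <= y -> y `^ (- e) <= x `^ (- e).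
Proof.
move=> e0 x0 xy; have y0 : 0 < y by exact: lt_le_trans xy.
rewrite !powRN lef_pV2 ?posrE ?powR_gt0//.
by rewrite ge0_ler_powR ?nnegrE// ltW.
Qed.

Lemma decay_fourier (mu : probability (borel_space R d) R) s : 0 <= s ->
  (exists c, 0 < c /\ forall x, x != 0 ->
      complex.ComplexField.Normc.normc (fourier mu x) <= c * enorm x `^ (- (s / 2))) <->
  (exists c, 0 < c /\ decay (fun f => \int[mu]_x f x) s c).
Proof.
move=> s0; have s20 : 0 <= s / 2 by rewrite divr_ge0.
split => -[c [c0 H]].
  exists c; split => // xi t xi0.
  have /fourier_norm_le/(_ t) := H xi xi0; move/le_trans; apply.
  by rewrite ler_pM2l// powRN_le// ?normr_gt0// norm_le_enorm.
(* In dimension 0 there is no nonzero frequency. Otherwise the two norms differ by a factor at most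
   d, which goes into the constant. *)
have [d0|d0] := posnP d.
  exists 1; split; first exact: ltr01.
  move=> x /negP x0; exfalso; apply: x0; apply/eqP; apply/rowP => i; exfalso.
  by move: (ltn_ord i); rewrite [X in (_ < X)%N]d0 ltn0.
exists (c * d%:R `^ (s / 2)); split; first by rewrite mulr_gt0 ?powR_gt0 ?ltr0n.
move=> x x0; apply/fourier_norm_le => t; apply: le_trans (H _ _ x0) _.
rewrite -mulrA ler_pM2l//.
have x0' : 0 < `|x| by rewrite normr_gt0.
have e0 : 0 < enorm x by apply: lt_le_trans (norm_le_enorm x).
have d0' : 0 < d%:R :> R by rewrite ltr0n.
have := powRN_le s20 e0 (enorm_le_norm x).
rewrite powRM// => /(ler_wpM2l (powR_ge0 d%:R (s / 2))); apply: le_trans.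
by rewrite mulrA (powRN d%:R) mulfV ?mul1r// gt_eqF// powR_gt0.
Qed.

Lemma mean_wave_le1 (E : (borel_space R d -> R) -> R) xi t : is_mean E ->
  E (wave xi t) <= 1.
Proof.
by move=> mE; apply: (mean_le_cst mE) => [|x]; [exact: bmeas_wave|exact: cos_le1].
Qed.

(** A smaller exponent gives a weaker bound only for |xi| >= 1. Below that the trivial bound 1 is
    used, hence the maximum with 1. *)
Lemma decay_weaken (E : (borel_space R d -> R) -> R) s s' c : is_mean E ->
  0 <= s' <= s -> decay E s c -> decay E s' (Num.max c 1).
Proof.
move=> mE /andP[s0 ss] H xi t xi0.
have xi0' : 0 < `|xi| by rewrite normr_gt0.
have [x1|x1] := leP `|xi| 1.
  apply: le_trans (mean_wave_le1 _ _ mE) _.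
  have P1 : 1 <= `|xi| `^ (- (s' / 2)).
    have {1}<- : (1 : R) `^ (- (s' / 2)) = 1 by rewrite powR1.
    by rewrite powRN_le// divr_ge0.
  by apply: le_trans P1 _; rewrite ler_peMl ?powR_ge0// le_max lexx orbT.
apply: le_trans (H _ _ xi0) _.
have [c0|c0] := leP 0 c; last first.
  apply: (@le_trans _ _ 0); first by rewrite mulr_le0_ge0 ?powR_ge0// ltW.
  by rewrite mulr_ge0 ?powR_ge0// le_max ler01 orbT.
rewrite ler_pM ?powR_ge0// ?le_max ?lexx//.
by apply: ler_powR; [exact: ltW|rewrite lerN2 ler_pM2r ?invr_gt0].
Qed.

Definition decay_measure (A : set 'rV[R]_d) s (mu : probability (borel_space R d) R) :=
  msupport mu `<=` A /\
  exists c, 0 < c /\ decay (fun f => \int[mu]_x f x) s c.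

Lemma fourier_dimE (A : set 'rV[R]_d) : fourier_dim A =
  sup [set s | 0 <= s <= d%:R /\ exists mu, decay_measure A s mu].
Proof.
congr sup; apply/seteqP; split=> s /= [sd [mu [sA H]]]; split => //; exists mu.
  by split => //; apply/decay_fourier => //; case/andP: sd.
by split => //; apply/decay_fourier => //; case/andP: sd.
Qed.

Lemma fourier_dim_ge (A : set 'rV[R]_d) s mu :
  0 <= s <= d%:R -> decay_measure A s mu -> s <= fourier_dim A.
Proof.
move=> sd H; rewrite fourier_dimE; apply: ub_le_sup; last by split => //; exists mu.
by exists d%:R => x [/andP[]].
Qed.

Lemma fourier_dim_le (A : set 'rV[R]_d) b : 0 <= b ->
  (forall s mu, b < s <= d%:R -> ~ decay_measure A s mu) -> fourier_dim A <= b.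
Proof.
move=> b0 H; rewrite fourier_dimE; set S := [set s | _].
have [[s Ss]|/set0P/negP/negPn/eqP->] := pselect (S !=set0); last by rewrite sup0.
apply: ge_sup; first by exists s.
move=> x [/andP[x0 xd] [mu Hmu]]; rewrite leNgt; apply/negP => bx.
by apply: (H x mu) => //; rewrite bx.
Qed.

Lemma fourier_dim_gt (A : set 'rV[R]_d) b : 0 <= b -> b < fourier_dim A ->
  exists s mu, b < s <= d%:R /\ decay_measure A s mu.
Proof.
move=> b0; rewrite ltNge => /negP H; apply: contrapT => /forallNP N; apply: H.
apply: fourier_dim_le => // s mu bs dm; apply: (N s); exists mu; split => //.
Qed.

Lemma fourier_dim_ge0 (A : set 'rV[R]_d) : 0 <= fourier_dim A.
Proof.
rewrite fourier_dimE; set S := [set s | _].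
have [[s Ss]|/set0P/negP/negPn/eqP->] := pselect (S !=set0); last by rewrite sup0.
have s0 : 0 <= s by case: Ss => /andP[].
by apply: le_trans s0 (ub_le_sup _ Ss); exists d%:R => x [/andP[]].
Qed.

End fourier_decay.

(** * Limits of tight sequences of means *)

(** The image ultrafilter contains a compact interval. *)
Lemma ultra_cvg {R : realType} (U : set_system nat) (u : nat -> R) (M : R) :
  UltraFilter U -> (forall n, `|u n| <= M) -> cvg (u @ U).
Proof.
move=> UU uM.
have FU : UltraFilter (u @ U).
  split=> [|G GF sFG]; first exact: fmap_proper_filter.
  rewrite predeqE => A; split; last exact: sFG.
  move=> GA; have [//|nA] := in_ultra_setVsetC (u @^-1` A) UU.
  have : G (~` A) by exact: sFG.
  by move=> /(filterI GA); rewrite setICr => /filter_ex[].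
have := @segment_compact R (- M) M; rewrite compact_ultra.
move=> /(_ (u @ U) FU) [|l [_ ul]]; last by apply/cvg_ex; exists l.
by apply: (@filterE _ U) => n /=; rewrite in_itv/= -ler_norml.
Qed.

Section binary_quantile.
Context {R : realType} (m : seq bool -> R).
Hypothesis m_ge0 : forall w, 0 <= m w.
Hypothesis m_nil : m [::] = 1.
Hypothesis m_split : forall w, m w = m (rcons w false) + m (rcons w true).

(* The words of length n cut [0, 1[ into consecutive intervals
   [left w, left w + m w[ in lexicographic order. *)
Definition left_step (s : seq bool * R) (b : bool) :=
  (rcons s.1 b, s.2 + (if b then m (rcons s.1 false) else 0)).

Definition left_end (w : seq bool) : R := (foldl left_step ([::], 0) w).2.

Lemma left_end_nil : left_end [::] = 0. Proof. by []. Qed.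

Lemma left_end_rcons w b : left_end (rcons w b) =
  left_end w + (if b then m (rcons w false) else 0).
Proof.
rewrite /left_end foldl_rcons /left_step /=.
suff -> : (foldl left_step ([::], 0) w).1 = w by [].
by elim/last_ind: w => // w c IH; rewrite foldl_rcons /= IH.
Qed.

(** Quantile transform: walk down the binary tree towards the interval that contains t. For t
    uniform on the unit interval the word of length n then has law [m] ([qword_prob]). *)
Definition qword (n : nat) (t : R) : seq bool :=
  iter n (fun w => rcons w (left_end w + m (rcons w false) <= t)) [::].

Lemma size_qword n t : size (qword n t) = n.
Proof. by elim: n => //= n IH; rewrite size_rcons IH. Qed.

Lemma take_qword n k t : (n <= k)%N -> take n (qword k t) = qword n t.
Proof.
elim: k => [|k IH]; first by rewrite leqn0 => /eqP->.
rewrite leq_eqVlt => /predU1P[->|]; first by rewrite take_oversize// size_qword.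
by rewrite ltnS => nk /=; rewrite -cats1 takel_cat ?size_qword// IH.
Qed.

Lemma qword_bounds n t : 0 <= t < 1 ->
  left_end (qword n t) <= t < left_end (qword n t) + m (qword n t).
Proof.
move=> t01; elim: n => [|n IH] /=; first by rewrite left_end_nil m_nil add0r.
rewrite left_end_rcons; have := m_split (qword n t); case/andP: IH => IH1 IH2.
by have [tc|tc] := leP (left_end (qword n t) + m (rcons (qword n t) false)) t => ms;
  rewrite ?addr0; apply/andP; split; lra.
Qed.

Lemma left_end_word w t :
  left_end w <= t < left_end w + m w -> qword (size w) t = w.
Proof.
elim/last_ind: w => // w b IH; rewrite size_rcons /= left_end_rcons => /andP[H1 H2].
have E : qword (size w) t = w.
  apply: IH; have := m_split w; have := m_ge0 (rcons w true).
  have := m_ge0 (rcons w false); move: H1 H2.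
  by case: b => *; apply/andP; split; lra.
rewrite {}E {IH}; congr rcons; have := m_split w; move: H1 H2.
by case: b; have [|] := leP (left_end w + m (rcons w false)) t; rewrite ?addr0 => // *; exfalso; lra.
Qed.

Lemma qword_preimage w : [set t | 0 <= t < 1 /\ qword (size w) t = w] =
  [set t | 0 <= t < 1 /\ left_end w <= t < left_end w + m w].
Proof.
apply/seteqP; split=> t [t01 H]; split => //; last exact: left_end_word.
by have := qword_bounds (size w) t01; rewrite H.
Qed.

Lemma left_end_ge0 w : 0 <= left_end w.
Proof.
elim/last_ind: w => // w b IH; rewrite left_end_rcons addr_ge0//.
by case: b.
Qed.

Lemma left_end_le1 w : left_end w + m w <= 1.
Proof.
elim/last_ind: w => [|w b IH]; first by rewrite left_end_nil m_nil add0r.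
rewrite left_end_rcons; apply: le_trans IH; have := m_split w.
by have := m_ge0 (rcons w true); case: b; lra.
Qed.

Definition unit_prob : probability (measurableTypeR R) R :=
  @uniform_prob R 0 1 ltr01.

Lemma unit_probE (A : set R) : measurable A ->
  unit_prob A = lebesgue_measure (A `&` `[0, 1]%classic).
Proof.
move=> mA.
rewrite -[LHS]/(\int[lebesgue_measure]_(x in A) (uniform_pdf 0 1 x)%:E)%E.
rewrite integral_uniform_pdf.
rewrite (eq_integral (fun=> 1%:E)) => [|x /[!inE] -[_ /=]].
  by rewrite integral_cst ?mul1e//; exact: measurableI.
by rewrite in_itv/= /uniform_pdf subr0 invr1 => ->.
Qed.

Lemma unit_prob_itv (a b : R) : 0 <= a -> a <= b -> b <= 1 ->
  unit_prob `[a, b[%classic = (b - a)%:E.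
Proof.
move=> a0 ab b1; rewrite unit_probE// setIidl; last first.
  move=> x /=; rewrite !in_itv/= => /andP[ax xb].
  by rewrite (le_trans a0 ax)/= (le_trans (ltW xb) b1).
rewrite lebesgue_measure_itv/= lte_fin; move: ab; rewrite le_eqVlt => /predU1P[->|ab].
  by rewrite ltxx subrr.
by rewrite ab EFinB.
Qed.

Lemma measurable_qword w : measurable [set t : R | qword (size w) t = w].
Proof.
elim/last_ind: w => [|w b IH] /=; first by rewrite [X in measurable X](_ : _ = setT) //; apply/seteqP.
rewrite size_rcons /=.
set c := left_end w + m (rcons w false).
rewrite [X in measurable X](_ : _ = [set t | qword (size w) t = w] `&`
   [set t | (c <= t) = b]); last first.
  apply/seteqP; split => t /=.
    by move=> /eqP; rewrite eqseq_rcons => /andP[/eqP -> /eqP].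
  by move=> [-> <-].
apply: measurableI => //; case: b {IH}.
  rewrite [X in measurable X](_ : _ = `[c, +oo[%classic)//.
  by apply/seteqP; split => t /=; rewrite in_itv/= andbT.
rewrite [X in measurable X](_ : _ = `]-oo, c[%classic)//.
apply/seteqP; split => t /=; rewrite in_itv/= ltNge; first by move=> ->.
by move/negbTE.
Qed.

Lemma qword_prob w : unit_prob [set t | qword (size w) t = w] = (m w)%:E.
Proof.
have <- : unit_prob `[left_end w, left_end w + m w[%classic = (m w)%:E.
  rewrite unit_prob_itv ?left_end_ge0 ?left_end_le1 ?lerDl//.
  by congr EFin; lra.
have u01 : unit_prob `[0, 1[%classic = 1%E.
  by rewrite unit_prob_itv// subr0.
(* The uniform law lives on the closed unit interval, whereas [qword_bounds] needs t < 1; the end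
   point is discarded as a null set. *)
have uI A : measurable A -> unit_prob A = unit_prob (A `&` `[0, 1[%classic).
  move=> mA; rewrite -[in LHS](setIT A) -(setUCr `[0, 1[%classic) setIUr measureU//.
  - rewrite [X in (_ + X)%E](_ : _ = 0%E) ?adde0//.
    apply/eqP; rewrite -measure_le0.
    apply: (@le_trans _ _ (unit_prob (~` `[0, 1[%classic))).
      by rewrite le_measure// inE; [apply: measurableI => //|]; exact: measurableC.
    by rewrite probability_setC// u01 subee.
  - exact: measurableI.
  - by apply: measurableI => //; exact: measurableC.
  - by rewrite setIACA setICr setI0.
rewrite uI; last apply: measurable_qword.
rewrite [RHS]uI//; congr (unit_prob _).
have := qword_preimage w; move/seteqP => [H1 H2].
apply/seteqP; split => t [/= a]; rewrite in_itv/= => t01.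
  by have [//|_ ?] := H1 t; rewrite /= in_itv.
move: a; rewrite in_itv/= => a.
by have [//|_ ?] := H2 t; split.
Qed.

Let bmeas_word w : bmeas (\1_[set t : R | qword (size w) t = w] : R -> R).
Proof. by apply: bmeas_indic; exact: measurable_qword. Qed.

Lemma qword_indic (G : seq bool -> R) n :
  (fun t => G (qword n t)) = (fun t => \sum_(w : n.-tuple bool)
    G w * \1_[set t : R | qword (size w) t = w] t).
Proof.
apply/funext => t; have sz : size (qword n t) == n by rewrite size_qword.
rewrite (bigD1 (Tuple sz))//= indicE mem_set ?mulr1 ?size_qword//=.
rewrite big1 ?addr0// => w /negP wq; rewrite indicE memNset ?mulr0//.
by rewrite /= size_tuple => H; apply: wq; apply/eqP/val_inj.
Qed.

Lemma bmeas_qword (G : seq bool -> R) n : bmeas (fun t => G (qword n t)).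
Proof. by rewrite qword_indic; apply: bmeas_sum => w; apply: bmeasZ. Qed.

Lemma qword_mean (G : seq bool -> R) n :
  \int[unit_prob]_t G (qword n t) = \sum_(w : n.-tuple bool) G w * m w.
Proof.
rewrite qword_indic (mean_sum (prob_mean unit_prob)); last first.
  by move=> w; apply: bmeasZ; apply: bmeas_word.
apply: eq_bigr => w _; rewrite (meanZ (prob_mean unit_prob)); last first.
  by apply: bmeas_word.
by rewrite Rintegral_indic ?qword_prob//; exact: measurable_qword.
Qed.

End binary_quantile.

(** * Binary coding of points through the logistic map *)

Section logistic.
Context {R : realType}.
Implicit Types x z : R.

Definition logis x : R := (1 + expR (- x))^-1.
Definition logit z : R := ln z - ln (1 - z).

Let den_gt0 x : 0 < 1 + expR (- x). Proof. by rewrite addr_gt0// expR_gt0. Qed.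

Lemma logis_gt0 x : 0 < logis x. Proof. by rewrite invr_gt0. Qed.

Lemma logisC x : 1 - logis x = expR (- x) * logis x.
Proof.
have d0 := den_gt0 x; rewrite /logis -[X in X - _](mulfV (lt0r_neq0 d0)).
by rewrite mulrDl mul1r addrAC subrr add0r.
Qed.

Lemma logisN x : logis (- x) = 1 - logis x.
Proof.
rewrite logisC /logis opprK expRN; have a0 := expR_gt0 x.
by field; rewrite ?lt0r_neq0// addr_gt0.
Qed.

Lemma logis_lt1 x : logis x < 1.
Proof. by rewrite -subr_gt0 logisC mulr_gt0 ?expR_gt0 ?logis_gt0. Qed.

Lemma logisK : cancel logis logit.
Proof.
move=> x; rewrite /logit logisC lnM ?posrE ?expR_gt0 ?logis_gt0// expRK.
by lra.
Qed.

Lemma logis_homo : {homo logis : x y / x <= y}.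
Proof.
move=> x y xy; rewrite lef_pV2 ?posrE// lerD2l ler_expR; lra.
Qed.

Lemma logis_continuous : continuous logis.
Proof.
move=> x; apply: cvgV; first by rewrite gt_eqF.
apply: cvgD; first exact: cvg_cst.
apply: continuous_comp; last exact: continuous_expR.
exact: opp_continuous.
Qed.

Lemma logit_continuous z : 0 < z < 1 -> {for z, continuous logit}.
Proof.
move=> /andP[z0 z1]; apply: cvgB; first exact: continuous_ln.
apply: continuous_comp; last by apply: continuous_ln; rewrite subr_gt0.
by apply: cvgB; [exact: cvg_cst|exact: cvg_id].
Qed.

Lemma measurable_logit : measurable_fun setT logit.
Proof.
apply: measurable_funB; first exact: measurable_ln.
apply: measurableT_comp; first exact: measurable_ln.
by apply: measurable_funB.
Qed.

(** The doubling map, whose orbit reads off binary digits. It fixes 1, so [digit_sum] holds on the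
    closed interval. *)
Definition dbl z : R := 2 * z - ((2^-1 : R) <= z)%R%:R.
Definition digit z (a : nat) : bool := (2^-1 : R) <= iter a dbl z.

Definition bin_sum (b : nat -> bool) n : R := \sum_(a < n) 2^-1 ^+ a.+1 * (b a)%:R.

Lemma bin_sumS b n : bin_sum b n.+1 = bin_sum b n + 2^-1 ^+ n.+1 * (b n)%:R.
Proof. by rewrite /bin_sum big_ord_recr. Qed.

Lemma digit_sum z n : 0 <= z <= 1 ->
  bin_sum (digit z) n <= z <= bin_sum (digit z) n + 2^-1 ^+ n.
Proof.
move=> z01.
have D k : 0 <= iter k dbl z <= 1.
  elim: k => //= k; set y := iter k dbl z; rewrite /dbl => /andP[y0 y1].
  by have [h|h] := leP (2^-1 : R) y; rewrite ?subr0 /=; apply/andP; split; lra.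
have E : z = bin_sum (digit z) n + 2^-1 ^+ n * iter n dbl z.
  elim: n => [|n IH]; first by rewrite /bin_sum big_ord0 add0r mul1r.
  have E' : iter n.+1 dbl z = 2 * iter n dbl z - (digit z n)%:R by [].
  by rewrite {1}IH bin_sumS E' exprS; field.
have p0 : 0 <= 2^-1 ^+ n :> R by rewrite exprn_ge0// invr_ge0.
have /andP[i0 i1] := D n.
by rewrite [X in _ <= X <= _]E lerDl mulr_ge0//= lerD2l ler_piMr.
Qed.

Lemma bin_sum_nd b n k : (n <= k)%N -> bin_sum b n <= bin_sum b k.
Proof.
move=> /subnK <-; elim: (k - n)%N => // j IH; apply: le_trans IH _.
by rewrite addSn bin_sumS lerDl mulr_ge0// exprn_ge0// invr_ge0.
Qed.

Lemma bin_sum_le b n k : bin_sum b (n + k) <= bin_sum b n + 2^-1 ^+ n - 2^-1 ^+ (n + k).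
Proof.
elim: k => [|k IH]; first by rewrite addn0 addrK.
rewrite addnS bin_sumS.
have : 2^-1 ^+ (n + k).+1 * (b (n + k)%N)%:R <= 2^-1 ^+ (n + k).+1 :> R.
  by rewrite ler_piMr ?exprn_ge0 ?invr_ge0// lern1 leq_b1.
by move: IH; rewrite exprS; lra.
Qed.

Lemma bin_sum_cvg b : cvg (bin_sum b @ \oo).
Proof.
apply: nondecreasing_is_cvgn; first by move=> n k; exact: bin_sum_nd.
exists 1 => _ [n _ <-]; have := bin_sum_le b 0 n.
rewrite add0n /bin_sum big_ord0 add0r => /le_trans; apply.
by rewrite gerBl exprn_ge0// invr_ge0.
Qed.

Lemma bin_sum_lim b n :
  bin_sum b n <= limn (bin_sum b) <= bin_sum b n + 2^-1 ^+ n.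
Proof.
apply/andP; split.
  apply: limr_ge; first exact: bin_sum_cvg.
  by exists n => // k /= nk; exact: bin_sum_nd.
apply: limr_le; first exact: bin_sum_cvg.
exists n => // k /= /subnKC <-; apply: le_trans (bin_sum_le _ _ _) _.
by rewrite gerBl exprn_ge0// invr_ge0.
Qed.

Lemma half_expn_small (e : R) : 0 < e -> exists n, 2^-1 ^+ n < e.
Proof.
move=> e0; have : (fun n => 2^-1 ^+ n : R) @ \oo --> (0 : R).
  by apply: cvg_expr; rewrite ger0_norm ?invr_ge0// invf_lt1// ltr1n.
move=> /cvgrPdist_lt/(_ _ e0)[N _ /(_ N)/=]; rewrite leqnn => /(_ isT).
rewrite sub0r normrN ger0_norm ?exprn_ge0 ?invr_ge0// => ?; by exists N.
Qed.

End logistic.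

Section cells.
Context {R : realType} {d : nat}.
Hypothesis d0 : (0 < d)%N.
Implicit Types x : 'rV[R]_d.

(* Bit number a * d + i of a point is the a-th binary digit of the i-th
   coordinate of its image under the logistic homeomorphism onto ]0, 1[^d. *)
Definition xbit x (j : nat) : bool :=
  digit (logis (x 0 (Ordinal (ltn_pmod j d0)))) (j %/ d).

Definition xword x n := mkseq (xbit x) n.

(** Lower corner of the dyadic cube of side 2^-n coded by a word of length n d. *)
Definition corner n (w : seq bool) : 'rV[R]_d :=
  \row_i bin_sum (fun a => nth false w (a * d + i)) n.

Lemma cell_index (a : nat) (i : 'I_d) :
  ((a * d + i) %/ d = a)%N /\ Ordinal (ltn_pmod (a * d + i) d0) = i.
Proof.
split; first by rewrite divnMDl// divn_small// addn0.
by apply/val_inj; rewrite /= modnMDl modn_small.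
Qed.

Lemma cell_index_lt (a n : nat) (i : 'I_d) : (a < n)%N -> (a * d + i < n * d)%N.
Proof.
move=> an; apply: (@leq_trans (a.+1 * d)); last by rewrite leq_mul2r an orbT.
by rewrite mulSn addnC ltn_add2r.
Qed.

Lemma corner_xword n x (i : 'I_d) :
  corner n (xword x (n * d)) 0 i = bin_sum (digit (logis (x 0 i))) n.
Proof.
rewrite mxE /bin_sum; apply: eq_bigr => -[a an] _ /=.
rewrite nth_mkseq; last exact: cell_index_lt.
by rewrite /xbit; have [-> ->] := cell_index a i.
Qed.

Lemma corner_xword_bounds n x (i : 'I_d) :
  corner n (xword x (n * d)) 0 i <= logis (x 0 i)
    <= corner n (xword x (n * d)) 0 i + 2^-1 ^+ n.
Proof. by rewrite corner_xword; apply: digit_sum; rewrite !ltW ?logis_gt0 ?logis_lt1. Qed.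

Lemma measurable_xword w : measurable
  ([set x | xword x (size w) = w] : set (borel_space R d)).
Proof.
elim/last_ind: w => [|w b IH].
  by rewrite [X in measurable X](_ : _ = setT) //; apply/seteqP.
rewrite size_rcons [X in measurable X](_ : _ = [set x | xword x (size w) = w] `&`
   [set x | xbit x (size w) = b]); last first.
  apply/seteqP; split => x /=; rewrite /xword mkseqS.
    by move=> /eqP; rewrite eqseq_rcons => /andP[/eqP -> /eqP].
  by move=> [-> ->].
apply: measurableI => //.
rewrite /xbit /digit; set i := Ordinal _; set a := (_ %/ _)%N.
have mf : measurable_fun setT
    (fun x : borel_space R d => iter a (@dbl R) (logis (x 0 i))).
  elim: a => [|a IHa] /=.
    apply: continuous_borel_fun; apply: continuous_after.
      exact: logis_continuous.
    exact: coord_rV_continuous.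
  have -> : (fun x : borel_space R d => dbl (iter a (@dbl R) (logis (x 0 i)))) =
      (fun x : borel_space R d => 2 * (iter a (@dbl R) (logis (x 0 i))) -
       \1_[set y | (2^-1 : R) <= y] (iter a (@dbl R) (logis (x 0 i)))).
    apply/funext => x; rewrite /dbl indicE; congr (_ - _%:R).
    by congr nat_of_bool; apply/idP/idP; rewrite inE.
  apply: measurable_funB; first exact: measurable_funM.
  apply: measurableT_comp => //; apply: measurable_indic.
  rewrite [X in measurable X](_ : _ = `[2^-1, +oo[%classic)//.
  by apply/seteqP; split => y /=; rewrite in_itv/= andbT.
pose A : set R := if b then `[2^-1, +oo[%classic else `]-oo, 2^-1[%classic.
rewrite [X in measurable X](_ : _ = setT `&`
    (fun x : borel_space R d => iter a (@dbl R) (logis (x 0 i))) @^-1` A).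
  by apply: mf => //; rewrite /A; case: (b).
rewrite setTI /A; apply/seteqP; split => x /=; case: (b) => /=;
  rewrite in_itv/= ?andbT ?ltNge //; last by move/negbTE.
by move=> ->.
Qed.

Definition cell w : set (borel_space R d) := [set x | xword x (size w) = w].

Lemma bmeas_cell w : bmeas (\1_(cell w) : borel_space R d -> R).
Proof. by apply: bmeas_indic; exact: measurable_xword. Qed.

Lemma xword_indic (G : seq bool -> R) n :
  (fun x : borel_space R d => G (xword x n)) = (fun x =>
    \sum_(w : n.-tuple bool) G w * \1_(cell w) x).
Proof.
apply/funext => x; have sz : size (xword x n) == n by rewrite size_mkseq.
rewrite (bigD1 (Tuple sz))//= indicE mem_set ?mulr1; last first.
  by rewrite /cell/= size_mkseq.
rewrite big1 ?addr0// => w /negP wq; rewrite indicE memNset ?mulr0//.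
by rewrite /cell/= size_tuple => H; apply: wq; apply/eqP/val_inj.
Qed.

Lemma bmeas_xword (G : seq bool -> R) n :
  bmeas (fun x : borel_space R d => G (xword x n)).
Proof.
by rewrite xword_indic; apply: bmeas_sum => w; apply: bmeasZ; exact: bmeas_cell.
Qed.

Lemma xword_mean (E : (borel_space R d -> R) -> R) (G : seq bool -> R) n :
  is_mean E ->
  E (fun x => G (xword x n)) = \sum_(w : n.-tuple bool) G w * E (\1_(cell w)).
Proof.
move=> mE; rewrite xword_indic (mean_sum mE); last first.
  by move=> w; apply: bmeasZ; exact: bmeas_cell.
by apply: eq_bigr => w _; rewrite (meanZ mE)//; exact: bmeas_cell.
Qed.

Lemma cell_nil : cell [::] = setT.
Proof. by apply/seteqP. Qed.

Lemma cell_split w (x : borel_space R d) :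
  \1_(cell w) x = \1_(cell (rcons w false)) x + \1_(cell (rcons w true)) x :> R.
Proof.
rewrite !indicE -natrD; congr (_%:R).
have C b : x \in cell (rcons w b) = (xword x (size w) == w) && (xbit x (size w) == b).
  by rewrite -eqseq_rcons -mkseqS; apply/idP/eqP; rewrite inE /cell/= size_rcons.
have -> : x \in cell w = (xword x (size w) == w).
  by apply/idP/eqP; rewrite inE.
by rewrite !C; case: (_ == w) => //=; case: xbit.
Qed.

End cells.

(** Only the first point has to lie in [K]. This is how it is applied: the corner of a cell is in
    [K], the point of the cell compared with it need not be. *)
Lemma uniform_continuity_near_compact {R : realType} {d : nat}
    (K : set 'rV[R]_d) (F : 'rV[R]_d -> R) (e : R) : compact K -> 0 < e ->
  (forall z, K z -> {for z, continuous F}) ->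
  exists2 dl : R, 0 < dl &
    forall z z', K z -> `|z - z'| < dl -> `|F z - F z'| < e.
Proof.
move=> /compact_near_coveringP cK e0 cF.
pose P (dl : R) (z : 'rV[R]_d) := forall z', `|z - z'| < dl -> `|F z - F z'| < e.
have : \forall dl \near 0^'+, K `<=` P dl.
  apply: (cK R (0^'+) P) => z Kz.
  have /cvgrPdist_lt/(_ (e / 2)) := cF z Kz; rewrite divr_gt0// => /(_ isT).
  move=> /nbhs_ballP[r /= r0 rF].
  exists (ball z (r / 2), [set dl : R | dl < r / 2]) => /=.
    split; first by apply: nbhsx_ballx; rewrite divr_gt0.
    by apply: nbhs_right_lt; rewrite divr_gt0.
  move=> [z1 dl] /= [zz1 dlr] z' z1z'.
  have F1 : `|F z - F z1| < e / 2.
    apply: rF; rewrite ball_normE; move: zz1; rewrite ball_normE => /lt_trans; apply.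
    lra.
  have F2 : `|F z - F z'| < e / 2.
    apply: rF; rewrite ball_normE; move: zz1; rewrite ball_normE => zz1.
    apply: le_lt_trans (ler_distD z1 _ _) _; lra.
  apply: le_lt_trans (ler_distD (F z) _ _) _; rewrite distrC; lra.
move=> H; have [dl [dl0 Kd]] : exists dl : R, 0 < dl /\ K `<=` P dl.
  have : \forall dl \near 0^'+, 0 < dl /\ K `<=` P dl.
    by apply: filterI => //; exact: nbhs_right_gt.
  by move=> /filter_ex.
by exists dl => // z z' Kz; exact: Kd.
Qed.

Lemma cvg_sum_seq {R : realType} {T : Type} (F : set_system T) {FF : Filter F}
    (I : Type) (r : seq I) (f : I -> T -> R) (l : I -> R) :
  (forall i, f i @ F --> l i) ->
  (fun x => \sum_(i <- r) f i x) @ F --> \sum_(i <- r) l i.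
Proof.
move=> fl; elim: r => [|i r IH].
  by under eq_fun do rewrite big_nil; rewrite big_nil; exact: cvg_cst.
by under eq_fun do rewrite big_cons; rewrite big_cons; exact: cvgD.
Qed.

Lemma cvg_row {R : realType} {n : nat} {T : Type} (F : set_system T)
    {FF : Filter F} (f : T -> 'rV[R]_n) (l : 'rV[R]_n) :
  (forall i, f x 0 i @[x --> F] --> l 0 i) -> f @ F --> l.
Proof.
move=> fl; apply/cvgrPdist_lt => e e0.
have : \forall x \near F, forall i, `|l 0 i - f x 0 i| < e.
  by apply: filter_forall => i; have /cvgrPdist_lt/(_ e e0) := fl i.
by apply: filterS => x H; apply: norm_lt_coord => // i; rewrite !mxE.
Qed.

Section tight_limit.
Context {R : realType} {d : nat}.
Hypothesis d0 : (0 < d)%N.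
Variables (E : nat -> (borel_space R d -> R) -> R) (U : set_system nat).
Hypotheses (UU : UltraFilter U) (mE : forall k, is_mean (E k)).

(** Limit masses of the cells. They are additive along the tree of words, which is all that [qword]
    needs to realize them by a random point, and so by a genuine measure. *)
Let m w : R := lim ((fun k => E k (\1_(cell d0 w))) @ U).

Let bcell w : bmeas (\1_(cell d0 w) : borel_space R d -> R).
Proof. exact: bmeas_cell. Qed.

Let m_cvg w : (fun k => E k (\1_(cell d0 w))) @ U --> m w.
Proof.
apply: (@ultra_cvg _ U _ 1) => // k; rewrite -[leRHS](mean_cst (mE k)).
apply: (mean_norm_le (mE k)) => //; first exact: bmeas_cst.
by move=> x; rewrite indicE ger0_norm// lern1 leq_b1.
Qed.

Let m_ge0 w : 0 <= m w.
Proof.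
apply: limr_ge; first by apply/cvg_ex; exists (m w); exact: m_cvg.
by apply: (@filterE _ U) => k; exact: (mean_ge0 (mE k)).
Qed.

Let m_nil : m [::] = 1.
Proof.
apply/cvg_lim => //; apply: cvg_near_cst; apply: (@filterE _ U) => k.
rewrite (_ : \1__ = fun=> 1) ?(mean_cst (mE k))//.
by apply/funext => x; rewrite indicE cell_nil in_setT.
Qed.

Let m_split w : m w = m (rcons w false) + m (rcons w true).
Proof.
apply/cvg_lim => //.
rewrite (_ : (fun _ => _) = fun k => E k (\1_(cell d0 (rcons w false))) +
    E k (\1_(cell d0 (rcons w true)))); first by apply: cvgD; exact: m_cvg.
apply/funext => k; rewrite -(meanD (mE k))//; congr (E k).
by apply/funext => x; exact: cell_split.
Qed.

Let qbit t (i : 'I_d) (a : nat) : bool := nth false (qword m (a * d + i).+1 t) (a * d + i).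

Let qcoord t : 'rV[R]_d := \row_i limn (bin_sum (qbit t i)).

Let corner_qword n t i : @corner R d n (qword m (n * d) t) 0 i = bin_sum (qbit t i) n.
Proof.
rewrite mxE /bin_sum; apply: eq_bigr => -[a an] _ /=; congr (_ * (_ : bool)%:R).
rewrite /qbit -(@take_qword _ _ (a * d + i).+1 (n * d)); last exact: cell_index_lt.
by rewrite nth_take.
Qed.

Let corner_qword_bounds n t i :
  @corner R d n (qword m (n * d) t) 0 i <= qcoord t 0 i <=
  @corner R d n (qword m (n * d) t) 0 i + 2^-1 ^+ n.
Proof. by rewrite corner_qword mxE; exact: bin_sum_lim. Qed.

Definition logit_rV (z : 'rV[R]_d) : 'rV[R]_d := \row_i logit (z 0 i).

Let g t := logit_rV (qcoord t).

Let measurable_g : measurable_fun setT (g : measurableTypeR R -> borel_space R d).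
Proof.
apply: measurable_fun_rV => i; rewrite /g /logit_rV.
under eq_fun do rewrite !mxE.
apply: measurableT_comp; first exact: measurable_logit.
apply: (@measurable_fun_cvg _ _ _ setT
  (fun n t => @corner R d n (qword m (n * d) t) 0 i)) => [n|t _].
  by case: (bmeas_qword m (fun w => @corner R d n w 0 i) (n * d)).
have -> : (fun n => @corner R d n (qword m (n * d) t) 0 i) = bin_sum (qbit t i).
  by apply/funext => n; rewrite corner_qword.
exact: bin_sum_cvg.
Qed.

Let word_limit (G : seq bool -> R) N :
  (fun k => E k (fun x => G (xword d0 x N))) @ U -->
  \int[unit_prob]_t G (qword m N t).
Proof.
rewrite (qword_mean m_ge0 m_nil m_split).
under eq_fun do rewrite xword_mean//.
apply: cvg_sum_seq => w.
by apply: cvgM; [exact: cvg_cst|exact: m_cvg].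
Qed.

Let logit_rV_continuous (z : 'rV[R]_d) : (forall i, 0 < z 0 i < 1) ->
  {for z, continuous logit_rV}.
Proof.
move=> z01; apply: (@cvg_row _ _ _ (nbhs z) (nbhs_filter z)) => i.
rewrite mxE; under eq_fun do rewrite mxE.
apply: (@continuous_comp _ _ _ (fun z' : 'rV[R]_d => z' 0 i) logit).
  exact: coord_rV_continuous.
exact: logit_continuous.
Qed.

Hypothesis tight : forall e : R, 0 < e ->
  exists2 r : R, 0 < r & U [set k | E k (\1_[set x | r < `|x|]) <= e].

(** The means of a function of finitely many bits converge by the definition of [m]. A continuous f
    is compared with its values at corners of small cells; the cells near the boundary of the cube,
    where this fails, have small mass by tightness. *)
Lemma tight_limit : exists mu : probability (borel_space R d) R,
  forall (f : 'rV[R]_d -> R) M, continuous f -> (forall x, `|f x| <= M) ->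
    E k f @[k --> U] --> \int[mu]_x f x.
Proof.
have [mu [_ muE]] := mean_pushforward (unit_prob : probability _ R) measurable_g.
exists mu => f M cf fM.
have bf : bmeas (f : borel_space R d -> R) by exact: bmeas_continuous fM.
have M0 : 0 <= M by apply: le_trans (fM 0).
rewrite muE//; apply/cvgrPdist_le => e e0.
(* The final error is e1 + 2 M e1 on each of the two sides, plus e1 for the convergence on words. *)
pose e1 := e / (3 + 4 * M).
have e10 : 0 < e1 by rewrite divr_gt0//; lra.
have [r r0 Ur] := tight e10.
(* The ball of radius r is mapped into the cube [rho, 1 - rho]^d. The larger compact [K] leaves a
   margin rho / 2 for the corners. *)
pose rho := logis (- r).
have rho0 : 0 < rho := logis_gt0 _.
have rho1 : rho < 1 := logis_lt1 _.
have rhoE : logis r = 1 - rho by rewrite /rho logisN; lra.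
pose K := [set z : 'rV[R]_d | forall i, `[rho / 2, 1 - rho / 2]%classic (z 0 i)].
have cK : compact K.
  by apply: (@rV_compact _ _ (fun=> `[rho / 2, 1 - rho / 2]%classic)) => i;
  exact: segment_compact.
pose F (z : 'rV[R]_d) := f (logit_rV z).
have cF z : K z -> {for z, continuous F}.
  move=> Kz; apply: continuous_comp; last exact: cf.
  apply: logit_rV_continuous => i; have := Kz i; rewrite /= in_itv/= => /andP[h1 h2].
  by apply/andP; split; lra.
have [dl dl0 Fdl] := uniform_continuity_near_compact cK e10 cF.
have [n nlt] : exists n, 2^-1 ^+ n < Num.min dl (rho / 2).
  by apply: half_expn_small; rewrite lt_min dl0 divr_gt0.
move: nlt; rewrite lt_min => /andP[ndl nrho].
have n0 : 0 <= 2^-1 ^+ n :> R by rewrite exprn_ge0// invr_ge0.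
pose kap (w : seq bool) : 'rV[R]_d := corner n w.
(* Satisfied by every cell that meets the image of the ball, a corner being below its point by at
   most 2^-n in each coordinate. *)
pose inK w := [forall i, rho - 2^-1 ^+ n <= kap w 0 i <= 1 - rho].
have inKK w : inK w -> K (kap w).
  move=> /forallP H i; have /andP[h1 h2] := H i.
  by rewrite /= in_itv/=; apply/andP; split; lra.
pose G w := if inK w then F (kap w) else 0.
pose B w : R := (~~ inK w)%:R.
have GM w : `|G w| <= M by rewrite /G; case: ifP => _; [exact: fM|rewrite normr0].
have xK (x : 'rV[R]_d) : `|x| <= r -> inK (xword d0 x (n * d)).
  move=> xr; apply/forallP => i.
  have /andP[h1 h2] := corner_xword_bounds d0 n x i.
  have : `|x 0 i| <= r by exact: le_trans (coord_le_norm _ _) xr.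
  rewrite ler_norml => /andP[/logis_homo x1 /logis_homo x2].
  by apply/andP; rewrite /kap; split; move: x1 x2; rewrite rhoE -/rho; lra.
have norm_kap (z : 'rV[R]_d) w : (forall i, kap w 0 i <= z 0 i <= kap w 0 i + 2^-1 ^+ n) ->
    `|kap w - z| < dl.
  move=> H; apply: le_lt_trans ndl; apply: norm_le_coord => // i.
  have /andP[h1 h2] := H i; rewrite !mxE ler_norml; apply/andP.
  by move: h1 h2; rewrite /kap mxE; split; lra.
have fG x : `|f x - G (xword d0 x (n * d))| <=
    e1 + 2 * M * \1_[set x | r < `|x|] x.
  have [xr|xr] := leP `|x| r.
    rewrite indicE memNset ?mulr0 ?addr0; last by rewrite /= ltNge xr.
    rewrite /G xK// distrC.
    have -> : f x = F (\row_i logis (x 0 i)).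
      by rewrite /F; congr f; apply/rowP => i; rewrite !mxE logisK.
    apply/ltW/Fdl; first exact/inKK/xK.
    by apply: norm_kap => i; rewrite [X in _ <= X <= _]mxE; exact: corner_xword_bounds.
  rewrite indicE mem_set//= mulr1.
  have := ler_normB (f x) (G (xword d0 x (n * d))); have := fM x.
  have := GM (xword d0 x (n * d)); lra.
(* If a coordinate of [qcoord t] is 0 or 1, the value of [logit] is meaningless, but then the word
   is not in [inK] and only the bound M on f is used. *)
have gG t : `|f (g t) - G (qword m (n * d) t)| <=
    e1 + 2 * M * B (qword m (n * d) t).
  rewrite /B; have [qK|qK] := boolP (inK (qword m (n * d) t)).
    rewrite mulr0 addr0 /G qK distrC -/(F (qcoord t)).
    apply/ltW/Fdl; first exact: inKK.
    by apply: norm_kap => i; exact: corner_qword_bounds.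
  rewrite mulr1.
  have := ler_normB (f (g t)) (G (qword m (n * d) t)); have := fM (g t).
  have := GM (qword m (n * d) t); lra.
have mI : measurable ([set x | r < `|x|] : set (borel_space R d)).
  exact: measurable_norm_gt.
have bI := bmeas_indic mI : bmeas (\1_[set x | r < `|x|] : borel_space R d -> R).
have bxG (H : seq bool -> R) : bmeas (fun x : borel_space R d => H (xword d0 x (n * d))).
  exact: bmeas_xword.
have B1 : \int[unit_prob]_t B (qword m (n * d) t) <= e1.
  rewrite -(cvg_lim _ (@word_limit B (n * d)))//.
  apply: limr_le; first by apply/cvg_ex; eexists; exact: word_limit.
  apply: filterS Ur => k; apply: le_trans.
  apply: (mean_le (mE k)) => // x.
  rewrite indicE /B; have [xr|xr] := leP `|x| r; first by rewrite xK.
  by rewrite mem_set//= lern1 leq_b1.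
have bq (H : seq bool -> R) : bmeas (fun t : measurableTypeR R => H (qword m (n * d) t)) by apply: bmeas_qword.
have bqG := bq G.
have bqB := bq B.
have bfg : bmeas (fun t : measurableTypeR R => f (g t)).
  split; last by exists M => t; exact: fM.
  by apply: (measurableT_comp (continuous_borel_fun cf)); exact: measurable_g.
have A1 : `|\int[unit_prob]_t f (g t) - \int[unit_prob]_t G (qword m (n * d) t)|
    <= e1 + 2 * M * e1.
  have mP := prob_mean (unit_prob : probability (measurableTypeR R) R).
  rewrite -(meanB mP)//.
  apply: (@le_trans _ _ (e1 + 2 * M * \int[unit_prob]_t B (qword m (n * d) t))).
    rewrite -(meanZ mP)//.
    rewrite -{1}(mean_cst mP e1) -(meanD mP); last 2 first.
    - exact: bmeas_cst.
    - exact: bmeasZ.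
    apply: (mean_norm_le mP) => //.
    - exact: bmeasB.
    - by apply: bmeasD; [exact: bmeas_cst|exact: bmeasZ].
  by rewrite lerD2l ler_wpM2l// mulr_ge0.
have := @word_limit G (n * d).
move=> /cvgrPdist_le/(_ _ e10); apply: filterS2 Ur => k /= Ek H.
have A2 : `|E k f - E k (fun x => G (xword d0 x (n * d)))| <= e1 + 2 * M * e1.
  rewrite -(meanB (mE k))//.
  apply: (@le_trans _ _ (e1 + 2 * M * E k (\1_[set x | r < `|x|]))).
    rewrite -(meanZ (mE k))//.
    rewrite -{1}(mean_cst (mE k) e1) -(meanD (mE k)); last 2 first.
    - exact: bmeas_cst.
    - exact: bmeasZ.
    apply: (mean_norm_le (mE k)) => //.
    - by apply: bmeasB.
    - by apply: bmeasD; [exact: bmeas_cst|exact: bmeasZ].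
  by rewrite lerD2l ler_wpM2l// mulr_ge0.
have -> : e = (e1 + 2 * M * e1) + e1 + (e1 + 2 * M * e1).
  rewrite -[LHS](@divfK _ (3 + 4 * M)); first by rewrite -/e1; ring.
  by rewrite gt_eqF//; lra.
apply: le_trans (ler_distD (E k (fun x => G (xword d0 x (n * d)))) _ _) _.
apply: lerD; last by rewrite distrC.
apply: le_trans (ler_distD (\int[unit_prob]_t G (qword m (n * d) t)) _ _) _.
exact: lerD.
Qed.

End tight_limit.

Section limit_of_decaying_means.
Context {R : realType} {d : nat}.
Hypothesis d0 : (0 < d)%N.
Variables (E : nat -> (borel_space R d -> R) -> R) (U : set_system nat).
Hypotheses (UU : UltraFilter U) (mE : forall k, is_mean (E k)).
Hypothesis tight : forall e : R, 0 < e ->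
  exists2 r : R, 0 < r & U [set k | E k (\1_[set x | r < `|x|]) <= e].

Lemma measurable_ball (x : 'rV[R]_d) r :
  measurable (ball x r : set (borel_space R d)).
Proof. by apply: measurable_open; exact: ball_open. Qed.

(** Both properties are tested on bounded continuous functions and so pass to the limit: waves for
    the decay; for a point x outside A, the tent function f, which vanishes off the ball of radius r
    and is at least r / 2 on the ball of radius r / 2. *)
Lemma limit_decay (A : set 'rV[R]_d) s c : 0 < c ->
  (forall x, ~ A x -> exists2 r : R, 0 < r & U [set k | E k (\1_(ball x r)) = 0]) ->
  (forall xi t, xi != 0 -> U [set k | E k (wave xi t) <= c * `|xi| `^ (- (s / 2))]) ->
  exists mu, decay_measure A s mu.
Proof.
move=> c0 UA Udec; have [mu muE] := tight_limit d0 UU mE tight.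
exists mu; split; last first.
  exists c; split => // xi t xi0.
  have H := muE _ 1 (@wave_continuous R d xi t) (fun x => cos_max _).
  rewrite -(cvg_lim _ H)//; apply: limr_le; first by apply/cvg_ex; eexists; exact: H.
  exact: Udec.
move=> x mx; apply: contrapT => /UA[r r0 Ur].
pose f (y : 'rV[R]_d) : R := Num.max 0 (r - `|x - y|).
have cf : continuous f.
  have cn : continuous (fun y : 'rV[R]_d => r - `|x - y|).
    apply: continuous_add; first exact: continuous_const.
    apply: continuous_after; first exact: opp_continuous.
    move=> y; apply: continuous_comp; last exact: norm_continuous.
    by apply: continuousB => //; exact: cst_continuous.
  have -> : f = fun y => 2^-1 * (r - `|x - y| + `|r - `|x - y| |).
    apply/funext => y; rewrite /f; set t := r - _.
    by have [t0|t0] := leP 0 t; [rewrite ger0_norm|rewrite ltr0_norm]; lra.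
  apply: continuous_mul; first exact: continuous_const.
  apply: continuous_add => //; apply: continuous_after cn.
  exact: (@norm_continuous _ R).
have f0 y : 0 <= f y by rewrite le_max lexx.
have fr y : f y <= r by rewrite ge_max (ltW r0)/= gerBl.
have fM y : `|f y| <= r by rewrite ger0_norm.
have bf : bmeas (f : borel_space R d -> R) by exact: bmeas_continuous fM.
have I0 : \int[mu]_y f y = 0.
  have H := muE _ _ cf fM; rewrite -(cvg_lim _ H)//; apply/cvg_lim => //.
  apply: cvg_near_cst; apply: filterS Ur => k /= Ek.
  have bb : bmeas (\1_(ball x r) : borel_space R d -> R).
    by apply: bmeas_indic; exact: measurable_ball.
  apply/eqP; rewrite eq_le (mean_ge0 (mE k))// andbT.
  rewrite -(mulr0 r) -Ek -(meanZ (mE k))//; apply: (mean_le (mE k)) => //.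
    exact: bmeasZ.
  move=> y; have [yb|yb] := pselect (ball x r y).
    by rewrite indicE mem_set// mulr1.
  rewrite indicE memNset// mulr0 /f ge_max lexx/= subr_le0 leNgt.
  by apply/negP => h; apply: yb; rewrite ball_normE.
have r20 : 0 < r / 2 by rewrite divr_gt0.
have mb := measurable_ball x (r / 2).
have : 0 < fine (mu (ball x (r / 2))).
  rewrite fine_gt0//; apply/andP; split.
    by apply: mx; [exact: ball_open|exact: ballxx].
  by rewrite (le_lt_trans (probability_le1 _ _))// ltry.
suff : r / 2 * fine (mu (ball x (r / 2))) <= 0.
  by rewrite pmulr_rle0// leNgt => /negP.
have mP := prob_mean mu.
rewrite -Rintegral_indic// -(meanZ mP); last exact: bmeas_indic.
rewrite -I0; apply: (mean_le mP) => //.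
  by apply: bmeasZ; exact: bmeas_indic.
move=> y; have [yb|yb] := pselect (ball x (r / 2) y).
  rewrite indicE mem_set// mulr1 /f le_max; apply/orP; right.
  by move: yb; rewrite ball_normE; lra.
by rewrite indicE memNset// mulr0.
Qed.

End limit_of_decaying_means.

Lemma infinity_ultrafilter :
  exists U : set_system nat, UltraFilter U /\
    forall P : nat -> Prop, (\forall n \near \oo, P n) -> U P.
Proof.
have [U [UU sU]] := ultraFilterLemma (@eventually_filter).
by exists U; split => // P; exact: sU.
Qed.

(** * Null sets of measures with Fourier decay *)

Section sine_bounds.
Context {R : realType}.
Implicit Types x : R.

Lemma sin_le_id x : 0 <= x -> sin x <= x.
Proof.
move=> x0; rewrite -subr_ge0; move: x0; rewrite le_eqVlt => /predU1P[<-|x0].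
  by rewrite sin0 subrr.
have [c _] := @MVT R sin cos 0 x x0 (fun y _ => is_derive_sin y)
  (continuous_subspaceT (@continuous_sin R)).
by rewrite sin0 !subr0 => ->; have := cos_le1 c; nra.
Qed.

Lemma norm_sin_le x : `|sin x| <= `|x|.
Proof.
wlog x0 : x / 0 <= x => [H|].
  have [/H//|/ltW x0] := leP 0 x.
  by rewrite -[leLHS]normrN -sinN -[leRHS]normrN; apply: H; rewrite oppr_ge0.
have [x1|x1] := leP 1 `|x|; first exact: le_trans (sin_max _) x1.
rewrite (ger0_norm x0) in x1 *; rewrite ger0_norm ?sin_le_id//.
by apply: sin_ge0_pi; rewrite x0 (le_trans (ltW x1))// (le_trans _ (@pi_ge2 R))// ler1n.
Qed.

Lemma cos_ge_half x : `|x| <= 1 -> 2^-1 <= cos x.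
Proof.
move=> x1; have -> : x = (x / 2) *+ 2 by rewrite -mulr_natr divfK.
rewrite cos_mulr2n cos2sin2.
have : `|sin (x / 2)| <= 2^-1.
  by apply: le_trans (norm_sin_le _) _; rewrite normrM (ger0_norm (_ : 0 <= 2^-1)) ?invr_ge0//; lra.
have := normr_ge0 (sin (x / 2)); rewrite -[sin _ ^+ 2]real_normK ?num_real//.
by rewrite -mulr_natr; nra.
Qed.

Lemma half_le_sin x : 0 <= x <= 1 -> x / 2 <= sin x.
Proof.
move=> /andP[]; rewrite le_eqVlt => /predU1P[<-|x0] x1.
  by rewrite sin0 mul0r.
have [c] := @MVT R sin cos 0 x x0 (fun y _ => is_derive_sin y)
  (continuous_subspaceT (@continuous_sin R)).
rewrite in_itv/= => /andP[c0 cx]; rewrite sin0 !subr0 => ->.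
have : 2^-1 <= cos c by apply: cos_ge_half; rewrite gtr0_norm// (le_trans (ltW cx)).
by nra.
Qed.

End sine_bounds.

Section energy.
Context {R : realType} {d : nat}.
Hypothesis d0 : (0 < d)%N.
Variables (E : (borel_space R d -> R) -> R).
Hypothesis mE : is_mean E.
Implicit Types (v x y z : 'rV[R]_d).

Let Ec v := E (fun x => cos (dotp v x)).
Let Es v := E (fun x => sin (dotp v x)).

Lemma bmeas_cos_dotp v : bmeas (fun x : borel_space R d => cos (dotp v x)).
Proof.
have := bmeas_wave v 0; congr bmeas; apply/funext => x.
by rewrite /wave addr0.
Qed.

Lemma bmeas_sin_dotp v : bmeas (fun x : borel_space R d => sin (dotp v x)).
Proof.
have := bmeas_wave v (- (pi / 2)); congr bmeas; apply/funext => x.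
by rewrite /wave cosBpihalf.
Qed.

Lemma mean_wave_sq v (B : R) : 0 <= B ->
  (forall t, E (wave v t) <= B) -> Ec v ^+ 2 + Es v ^+ 2 <= B ^+ 2.
Proof.
move=> B0 H; have [t tE] := polar_angle (Ec v) (Es v).
have := H t; rewrite (mean_wave _ _ mE) -/(Ec v) -/(Es v) tE => h.
rewrite -[leLHS]sqr_sqrtr; last by rewrite addr_ge0// sqr_ge0.
by rewrite ler_pXn2r// nnegrE sqrtr_ge0.
Qed.

Variable (I : finType) (freq : I -> 'rV[R]_d).

(** The squared modulus of the sum of exp (i freq a . z): it is nonnegative, and it expands into
    waves at the differences of frequencies. *)
Definition kern z : R :=
  (\sum_a cos (dotp (freq a) z)) ^+ 2 + (\sum_a sin (dotp (freq a) z)) ^+ 2.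

Lemma kern_ge0 z : 0 <= kern z.
Proof. by rewrite addr_ge0// sqr_ge0. Qed.

Lemma kern_expand z :
  kern z = \sum_a \sum_b cos (dotp (freq a - freq b) z).
Proof.
rewrite /kern !expr2 !mulr_suml -big_split/=; apply: eq_bigr => a _.
rewrite !mulr_sumr -big_split/=; apply: eq_bigr => b _.
by rewrite dotpDl dotpNl cosB.
Qed.

Lemma kern_large z : (forall a, `|dotp (freq a) z| <= 1) ->
  #|I|%:R ^+ 2 / 4 <= kern z.
Proof.
move=> H; rewrite /kern -[leLHS]addr0 lerD ?sqr_ge0//.
have h : #|I|%:R / 2 <= \sum_a cos (dotp (freq a) z).
  have -> : #|I|%:R / 2 = \sum_(a in I) (2^-1 : R).
    by rewrite sumr_const mulr_natl.
  by apply: ler_sum => a _; exact: cos_ge_half.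
have -> : #|I|%:R ^+ 2 / 4 = (#|I|%:R / 2) ^+ 2 :> R by field.
by rewrite ler_pXn2r// nnegrE ?divr_ge0//; apply: le_trans h; rewrite divr_ge0.
Qed.

Definition potential y : R := E (fun x => kern (x - y)).

Lemma bmeas_kern y : bmeas (fun x : borel_space R d => kern (x - y)).
Proof.
have -> : (fun x : borel_space R d => kern (x - y)) = (fun x : borel_space R d =>
    \sum_a \sum_b wave (freq a - freq b) (- dotp (freq a - freq b) y) x).
  apply/funext => x; rewrite kern_expand; apply: eq_bigr => a _.
  by apply: eq_bigr => b _; rewrite /wave dotpDr dotpNr.
by apply: bmeas_sum => a; apply: bmeas_sum => b; exact: bmeas_wave.
Qed.

Lemma potentialE y : potential y = \sum_a \sum_b
  (Ec (freq a - freq b) * cos (dotp (freq a - freq b) y) +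
   Es (freq a - freq b) * sin (dotp (freq a - freq b) y)).
Proof.
rewrite /potential.
have -> : (fun x : borel_space R d => kern (x - y)) = (fun x : borel_space R d =>
    \sum_a \sum_b wave (freq a - freq b) (- dotp (freq a - freq b) y) x).
  apply/funext => x; rewrite kern_expand; apply: eq_bigr => a _.
  by apply: eq_bigr => b _; rewrite /wave dotpDr dotpNr.
rewrite (mean_sum mE); last by move=> a; apply: bmeas_sum => b; exact: bmeas_wave.
apply: eq_bigr => a _; rewrite (mean_sum mE); last by move=> b; exact: bmeas_wave.
apply: eq_bigr => b _; rewrite (mean_wave _ _ mE) cosN sinN mulrN opprK.
by [].
Qed.

Lemma bmeas_potential : bmeas (potential : borel_space R d -> R).
Proof.
rewrite (funext potentialE).
apply: bmeas_sum => a; apply: bmeas_sum => b; apply: bmeasD; apply: bmeasZ.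
  exact: bmeas_cos_dotp.
exact: bmeas_sin_dotp.
Qed.

(** The energy identity: each pair of frequencies contributes the squared modulus of the transform
    at their difference, which decay controls. *)
Lemma mean_potential : E potential =
  \sum_a \sum_b (Ec (freq a - freq b) ^+ 2 + Es (freq a - freq b) ^+ 2).
Proof.
rewrite (funext potentialE).
have bb a b : bmeas (fun y : borel_space R d =>
    Ec (freq a - freq b) * cos (dotp (freq a - freq b) y) +
    Es (freq a - freq b) * sin (dotp (freq a - freq b) y)).
  by apply: bmeasD; apply: bmeasZ; [exact: bmeas_cos_dotp|exact: bmeas_sin_dotp].
rewrite (mean_sum mE); last by move=> a; apply: bmeas_sum => b.
apply: eq_bigr => a _; rewrite (mean_sum mE)//.
apply: eq_bigr => b _; rewrite (meanD mE); last 2 first.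
- by apply: bmeasZ; exact: bmeas_cos_dotp.
- by apply: bmeasZ; exact: bmeas_sin_dotp.
rewrite !(meanZ mE) ?expr2//; first exact: bmeas_sin_dotp.
exact: bmeas_cos_dotp.
Qed.

(* Sets of small mass are discarded; on the others the potential is large and
   Chebyshev's inequality applies. *)
Lemma cover_potential (A : set (borel_space R d)) (J : eqType) (l : seq J)
    (Q : J -> set (borel_space R d)) (t : R) : 0 < t -> measurable A ->
  (forall j, measurable (Q j)) ->
  (forall j (x y : 'rV[R]_d), Q j x -> Q j y ->
     forall a, `|dotp (freq a) (x - y)| <= 1) ->
  (forall x, A x -> exists2 j, j \in l & Q j x) -> (0 < #|I|)%N ->
  E (\1_A) <= (size l)%:R * t + 4 / (t * #|I|%:R ^+ 2) * E potential.
Proof.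
move=> t0 mA mQ small Al I0.
have T0 : 0 < #|I|%:R ^+ 2 :> R by rewrite exprn_gt0// ltr0n.
pose light j : R := if E (\1_(Q j)) <= t then 1 else 0.
have light01 j : 0 <= light j by rewrite /light; case: ifP.
have bQ j : bmeas (\1_(Q j) : borel_space R d -> R) by exact: bmeas_indic.
have bp := bmeas_potential.
pose k : R := 4 / (t * #|I|%:R ^+ 2).
have k0 : 0 <= k by rewrite divr_ge0// mulr_ge0// ltW.
have bs : bmeas (fun x : borel_space R d => \sum_(j <- l) light j * \1_(Q j) x : R).
  by apply: bmeas_sum => j; exact: bmeasZ.
have p0 x : 0 <= potential x.
  by apply: (mean_ge0 mE) => [|y]; [exact: bmeas_kern|exact: kern_ge0].
apply: (@le_trans _ _ (E (fun x => \sum_(j <- l) light j * \1_(Q j) x +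
   k * potential x))).
  apply: (mean_le mE) => [||x]; first exact: bmeas_indic.
    by apply: bmeasD => //; exact: bmeasZ.
  have s0 : 0 <= \sum_(j <- l) light j * \1_(Q j) x.
    by apply: sumr_ge0 => j _; rewrite mulr_ge0.
  rewrite [leLHS]indicE; have [Ax|Ax] := pselect (A x); last first.
    by rewrite memNset//; apply: addr_ge0 => //; exact: mulr_ge0.
  rewrite mem_set//=; have [j jl Qx] := Al _ Ax.
  have [lj|hj] := leP (E (\1_(Q j))) t.
    apply: (@le_trans _ _ (1 + 0)); first by rewrite addr0.
    apply: lerD; last exact: mulr_ge0.
    have -> : 1 = light j * \1_(Q j) x by rewrite /light lj indicE mem_set// mulr1.
    rewrite (big_rem j)//= lerDl.
    by apply: sumr_ge0 => i _; rewrite mulr_ge0.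
  apply: (@le_trans _ _ (0 + 1)); first by rewrite add0r.
  apply: lerD => //.
  have : #|I|%:R ^+ 2 / 4 * t <= potential x.
    apply: (@le_trans _ _ (#|I|%:R ^+ 2 / 4 * E (\1_(Q j)))).
      by rewrite ler_wpM2l ?divr_ge0// ?ltW.
    rewrite -(meanZ mE)//; apply: (mean_le mE) => [||y]; first exact: bmeasZ.
      exact: bmeas_kern.
    have [Qy|Qy] := pselect (Q j y).
      rewrite indicE mem_set// mulr1; apply: kern_large => a.
      exact: small Qy Qx a.
    by rewrite indicE memNset// mulr0 kern_ge0.
  have k1 : k * (#|I|%:R ^+ 2 / 4 * t) = 1.
    have I1 : 0 < #|I|%:R :> R by rewrite ltr0n.
    by rewrite /k; field; rewrite !lt0r_neq0.
  by move=> /(ler_wpM2l k0); rewrite k1.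
rewrite (meanD mE)//; last exact: bmeasZ.
rewrite (meanZ mE)// lerD2r (mean_sum mE); last by move=> j; exact: bmeasZ.
rewrite -sum1_size natr_sum mulr_suml; apply: ler_sum => j _.
rewrite (meanZ mE)// mul1r /light; case: ifP => [|_]; first by rewrite mul1r.
by rewrite mul0r ltW.
Qed.

End energy.

Lemma powR2_gt1 {R : realType} (x : R) : 0 < x -> 1 < 2 `^ x.
Proof.
by move=> x0; rewrite /powR pnatr_eq0/= expR_gt1 mulr_gt0// ln_gt0// ltr1n.
Qed.

Lemma geometric_sum_le {R : realType} (rho : R) n : 1 < rho ->
  \sum_(i < n.+1) rho ^+ i <= rho / (rho - 1) * rho ^+ n.
Proof.
move=> r1; have r0 : 0 < rho - 1 by rewrite subr_gt0.
rewrite mulrAC ler_pdivlMr//.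
elim: n => [|n IH]; first by rewrite big_ord_recr big_ord0/= expr0; lra.
rewrite big_ord_recr/= mulrDl [in leRHS]exprS.
have : 0 <= rho ^+ n by rewrite exprn_ge0//; lra.
move: IH; rewrite exprS; set x := rho ^+ n; set S := \sum_(_ < _) _; nra.
Qed.

Section lattice_frequencies.
Context {R : realType} {d : nat}.
Hypothesis d0 : (0 < d)%N.

Definition lattice n := {ffun 'I_d -> 'I_(2 ^ n)}.

(** The divisor 4 d makes |freq . z| <= 1 as soon as |z| <= 4 * 2^-n, in particular for differences
    of points of a ball of radius 2 * 2^-n. *)
Definition lattice_freq n (a : lattice n) : 'rV[R]_d :=
  \row_i ((a i : nat)%:R / (4 * d)%:R).

Definition close n i (a b : lattice n) : bool :=
  [forall j, (a j < b j + 2 ^ i)%N && (b j < a j + 2 ^ i)%N].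

Lemma card_close n i (b : lattice n) :
  (#|[pred a | close i a b]| <= (2 ^ i.+1) ^ d)%N.
Proof.
pose F (j : 'I_d) := [pred m : 'I_(2 ^ n) |
  (m < b j + 2 ^ i)%N && (b j < m + 2 ^ i)%N].
have -> : #|[pred a | close i a b]| = #|(family F : simpl_pred _)|.
  by apply: eq_card => a; rewrite !inE; apply/forallP/forallP.
rewrite card_family.
have FM j : (#|F j| <= 2 ^ i.+1)%N.
  rewrite cardE -(size_map (val : 'I_(2 ^ n) -> nat)).
  have -> : (2 ^ i.+1)%N = size (iota ((b j).+1 - 2 ^ i) (2 ^ i.+1)).
    by rewrite size_iota.
  apply: uniq_leq_size; first by rewrite map_inj_uniq ?enum_uniq//; exact: val_inj.
  move=> _ /mapP[m + ->]; rewrite mem_enum inE mem_iota => /andP[m1 m2].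
  rewrite -[val m]/(nat_of_ord m) expnS; move: m1 m2.
  move: (nat_of_ord m) (nat_of_ord (b j)) (2 ^ i)%N => x y z xy yx.
  by apply/andP; split; lia.
rewrite /image_mem; have -> : ((2 ^ i.+1) ^ d = (2 ^ i.+1) ^ size (enum 'I_d))%N.
  by rewrite size_enum_ord.
elim: (enum 'I_d) => //= j l IH.
by rewrite expnS; apply: leq_mul IH; exact: FM.
Qed.

Lemma card_lattice n : #|lattice n| = ((2 ^ n) ^ d)%N.
Proof. by rewrite card_ffun !card_ord. Qed.

Lemma close_max n (a b : lattice n) : close n a b.
Proof. by apply/forallP => j; rewrite !ltn_addl. Qed.

Lemma not_close_norm n i (a b : lattice n) : ~~ close i a b ->
  (2 ^ i)%:R / (4 * d)%:R <= `|lattice_freq a - lattice_freq b|.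
Proof.
rewrite negb_forall => /existsP[j]; rewrite negb_and -!leqNgt => ab.
apply: le_trans (coord_le_norm _ j); rewrite !mxE -mulrBl normrM.
have d40 : 0 <= ((4 * d)%:R)^-1 :> R by rewrite invr_ge0.
rewrite (ger0_norm d40) ler_wpM2r//.
case/orP: ab => h; last rewrite distrC.
  by rewrite ger0_norm ?subr_ge0 ?lerBrDl -?natrD ler_nat//; lia.
by rewrite ger0_norm ?subr_ge0 ?lerBrDl -?natrD ler_nat//; lia.
Qed.

Lemma norm_lattice_freq n (a : lattice n) : `|lattice_freq a| <= (2 ^ n)%:R / (4 * d)%:R.
Proof.
apply: norm_le_coord => [|i]; first by rewrite divr_ge0.
rewrite mxE ger0_norm ?divr_ge0// ler_wpM2r ?invr_ge0//.
by rewrite ler_nat ltnW.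
Qed.

Variables (E : (borel_space R d -> R) -> R) (s c : R).
Hypotheses (mE : is_mean E) (dE : decay E s c) (c0 : 0 < c) (s0 : 0 < s) (sd : s < d%:R).

Let q : R := 2 `^ (- s).
Let q0 : 0 < q. Proof. by rewrite powR_gt0. Qed.

(** Pairs of frequencies are sorted by dyadic distance. At level i the decay gives 2^(- s i) and
    each frequency has about 2^(d i) neighbours; since s < d, the geometric series is dominated by
    its last term. *)
Lemma energy_bound : exists C, 0 < C /\ forall n,
  E (potential E (@lattice_freq n)) <= C * #|lattice n|%:R ^+ 2 * q ^+ n.
Proof.
pose rho := q * (2 ^ d)%:R.
have d40 : 0 < (4 * d)%:R :> R by rewrite ltr0n muln_gt0.
have rhoE : rho = 2 `^ (d%:R - s).
  by rewrite /rho /q powRB ?pnatr_eq0 ?implybT// powR_mulrn// powRN natrX mulrC.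
have rho1 : 1 < rho.
  by rewrite rhoE powR2_gt1// subr_gt0.
(* The bound 1 serves equal frequencies (level 0). In the other, (4 d)^s undoes the scaling of the
   grid, and 2^s the shift from level i to level i + 1. *)
have [A [A1 Ac]] : exists A : R, 1 <= A /\ c ^+ 2 * (4 * d)%:R `^ s * 2 `^ s <= A.
  exists (Num.max 1 (c ^+ 2 * (4 * d)%:R `^ s * 2 `^ s)).
  by rewrite !le_max !lexx orbT.
have A0 : 0 < A by apply: lt_le_trans A1.
pose kap := rho / (rho - 1).
have kap0 : 0 < kap by rewrite divr_gt0 ?subr_gt0// (lt_trans ltr01).
have P2 : 0 < (2 ^ d)%:R :> R by rewrite ltr0n expn_gt0.
exists (A * (2 ^ d)%:R * kap); split; first by apply: mulr_gt0 => //; exact: mulr_gt0.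
move=> n; rewrite mean_potential//.
pose W (a b : lattice n) : R :=
  E (fun x => cos (dotp (lattice_freq a - lattice_freq b) x)) ^+ 2 +
  E (fun x => sin (dotp (lattice_freq a - lattice_freq b) x)) ^+ 2.
(* Only the term of the least i with [close i a b] is needed: failure of closeness at i - 1 bounds
   the distance of the frequencies from below. The other terms are nonnegative. *)
have WA a b : W a b <= \sum_(i < n.+1) A * q ^+ i * (close i a b)%:R.
  have ex : exists i, close i a b by exists n; exact: close_max.
  case: (ex_minnP ex) => i ci imin.
  have iN : (i < n.+1)%N by rewrite ltnS imin// close_max.
  apply: (@le_trans _ _ (A * q ^+ i)); last first.
    rewrite (bigD1 (Ordinal iN))//= ci mulr1 lerDl.
    by apply: sumr_ge0 => j _; rewrite !mulr_ge0 ?exprn_ge0// ltW.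
  rewrite /W; set v := lattice_freq a - lattice_freq b.
  case: i ci imin iN => [|i] ci imin iN.
    rewrite mulr1; apply: le_trans A1; rewrite -(expr1n _ 2).
    by apply: mean_wave_sq => // t; exact: mean_wave_le1.
  have nc : ~~ close i a b by apply/negP => /imin; rewrite ltnn.
  have v0 := not_close_norm nc; rewrite -/v in v0.
  have p0 : 0 < (2 ^ i)%:R / (4 * d)%:R :> R by rewrite divr_gt0// ltr0n expn_gt0.
  have vn0 : v != 0 by rewrite -normr_gt0; apply: lt_le_trans v0.
  apply: (@le_trans _ _ ((c * `|v| `^ (- (s / 2))) ^+ 2)).
    apply: mean_wave_sq => //; first by rewrite mulr_ge0 ?powR_ge0 ?ltW.
    by move=> t; exact: dE.
  have E2 : (`|v| `^ (- (s / 2))) ^+ 2 = `|v| `^ (- s).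
    by rewrite -powR_mulrn ?powR_ge0// -powRrM; congr (_ `^ _); field.
  rewrite exprMn E2.
  have h := powRN_le (ltW s0) p0 v0.
  apply: (@le_trans _ _ (c ^+ 2 * ((2 ^ i)%:R / (4 * d)%:R) `^ (- s))).
    by rewrite ler_pM2l// exprn_gt0.
  have -> : c ^+ 2 * ((2 ^ i)%:R / (4 * d)%:R) `^ (- s) =
      c ^+ 2 * (4 * d)%:R `^ s * 2 `^ s * q ^+ i.+1.
    have X1 : ((4 * d)%:R^-1) `^ (- s) = (4 * d)%:R `^ s :> R.
      by rewrite -(powR_inv1 (ltW d40)) -powRrM mulN1r opprK.
    have X2 : (2 ^ i)%:R `^ (- s) = q ^+ i.
      by rewrite natrX /q -!powR_mulrn ?powR_ge0// -!powRrM mulrC.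
    rewrite powRM ?invr_ge0// X1 X2.
    rewrite [q ^+ i.+1]exprS; have t1 : 2 `^ s * q = 1.
      by rewrite /q powRN mulfV// gt_eqF// powR_gt0.
    transitivity (c ^+ 2 * (q ^+ i * (4 * d)%:R `^ s) * (2 `^ s * q)).
      by rewrite t1 mulr1.
    by move: (q ^+ i) ((4 * d)%:R `^ s) (2 `^ s) => x y z; ring.
  by rewrite ler_pM2r ?exprn_gt0.
have S1 b : \sum_a W a b <= A * (2 ^ d)%:R * kap * rho ^+ n.
  apply: (@le_trans _ _ (\sum_(i < n.+1) A * q ^+ i * ((2 ^ i.+1) ^ d)%:R)).
    apply: (@le_trans _ _ (\sum_(i < n.+1) \sum_a A * q ^+ i * (close i a b)%:R)).
      by rewrite exchange_big; apply: ler_sum => a _; exact: WA.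
    apply: ler_sum => i _; rewrite -mulr_sumr; apply: ler_wpM2l.
      by apply: mulr_ge0; [exact: ltW|apply: exprn_ge0; exact: ltW].
    rewrite -natr_sum ler_nat; apply: leq_trans (card_close i b).
    by rewrite -sum1_card [leqRHS]big_mkcond leq_sum// => a _; rewrite inE; case: close.
  have -> : \sum_(i < n.+1) A * q ^+ i * ((2 ^ i.+1) ^ d)%:R =
      A * (2 ^ d)%:R * \sum_(i < n.+1) rho ^+ i.
    rewrite mulr_sumr; apply: eq_bigr => i _.
    have -> : ((2 ^ i.+1) ^ d = 2 ^ d * (2 ^ d) ^ i)%N.
      by rewrite -!expnM mulSn expnD [(i * d)%N]mulnC.
    rewrite /rho exprMn natrM [((2 ^ d) ^ i)%:R]natrX.
    by move: (q ^+ i) ((2 ^ d)%:R ^+ i : R) ((2 ^ d)%:R : R) => x y z; ring.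
  rewrite -[leRHS]mulrA ler_wpM2l//; first by rewrite mulr_ge0 ?ltW.
  exact: geometric_sum_le.
apply: (@le_trans _ _ (\sum_(b : lattice n) A * (2 ^ d)%:R * kap * rho ^+ n)).
  rewrite exchange_big; apply: ler_sum => b _; exact: S1.
rewrite sumr_const card_lattice -[leLHS]mulr_natl /rho exprMn le_eqVlt; apply/orP; left.
apply/eqP; have -> : ((2 ^ d)%:R ^+ n = ((2 ^ n) ^ d)%:R :> R).
  by rewrite -natrX -!expnM mulnC.
by move: (q ^+ n) (((2 ^ n) ^ d)%:R : R) => x y; ring.
Qed.

Lemma null_of_cover (A : set (borel_space R d)) (beta C1 : R) :
  0 <= beta < s -> measurable A ->
  (forall n0, exists2 n, (n0 <= n)%N & exists l : seq 'rV[R]_d,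
     (size l)%:R <= C1 * 2 `^ (n%:R * beta) /\
     forall x, A x -> exists2 p, p \in l & `|(x : 'rV[R]_d) - p| <= 2 * 2^-1 ^+ n) ->
  E (\1_A) = 0.
Proof.
move=> /andP[b0 bs] mA cov.
have [C [C0 HC]] := energy_bound.
pose eta : R := 2 `^ (- ((s - beta) / 2)).
have eta0 : 0 < eta by rewrite powR_gt0.
have eta1 : eta < 1.
  by rewrite /eta powRN invf_lt1 ?powR_gt0// powR2_gt1// divr_gt0// subr_gt0.
have C10 : 0 <= C1.
  have [n _ [l [sl _]]] := cov 0%N.
  have : 0 <= C1 * 2 `^ (n%:R * beta) by apply: le_trans sl.
  by rewrite pmulr_lge0// powR_gt0.
have bA : bmeas (\1_A : borel_space R d -> R) by exact: bmeas_indic.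
have key n0 : exists2 n, (n0 <= n)%N & E (\1_A) <= (C1 + 4 * C) * eta ^+ n.
  have [n n0n [l [sl lA]]] := cov n0; exists n => //.
  pose Q (p : 'rV[R]_d) : set (borel_space R d) :=
    [set x : 'rV[R]_d | `|x - p| <= 2 * 2^-1 ^+ n].
  have mQ p : measurable (Q p).
    apply: measurable_closed.
    have -> : Q p = (fun x : 'rV[R]_d => `|x - p|) @^-1` [set y | y <= 2 * 2^-1 ^+ n].
      by [].
    apply: closed_comp; last exact: closed_le.
    move=> x _; apply: continuous_comp; last exact: norm_continuous.
    by apply: continuousB => //; exact: cst_continuous.
  have small p (x y : 'rV[R]_d) : Q p x -> Q p y ->
      forall a : lattice n, `|dotp (lattice_freq a) (x - y)| <= 1.
    move=> Qx Qy a; apply: le_trans (dotp_norm_le _ _) _.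
    have xy : `|x - y| <= 4 * 2^-1 ^+ n.
      apply: le_trans (ler_distD p _ _) _; rewrite [X in _ + X]distrC.
      by move: Qx Qy; rewrite /Q/=; lra.
    apply: (@le_trans _ _ (d%:R * ((2 ^ n)%:R / (4 * d)%:R * (4 * 2^-1 ^+ n)))).
      by rewrite ler_wpM2l// ler_pM// norm_lattice_freq.
    rewrite natrX natrM exprVn le_eqVlt; apply/orP; left; apply/eqP; field.
    by rewrite pnatr_eq0 -lt0n d0 expf_neq0.
  (* This threshold balances the two terms of [cover_potential]: up to constants, light cells and
     the Chebyshev term both contribute eta^n. *)
  pose t : R := 2 `^ (- (n%:R * ((s + beta) / 2))).
  have t0 : 0 < t by rewrite powR_gt0.
  have I0 : (0 < #|lattice n|)%N by rewrite card_lattice !expn_gt0.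
  have := cover_potential mE t0 mA mQ small lA I0.
  move=> /le_trans; apply; rewrite (mulrDl C1).
  have etaE : eta ^+ n = 2 `^ (- (n%:R * ((s - beta) / 2))).
    by rewrite -powR_mulrn ?powR_ge0// -powRrM mulNr [_ * n%:R]mulrC.
  apply: lerD.
    apply: (@le_trans _ _ (C1 * 2 `^ (n%:R * beta) * t)); first by rewrite ler_wpM2r// ltW.
    rewrite -mulrA /t -powRD ?pnatr_eq0 ?implybT// etaE ler_wpM2l// le_eqVlt.
    by apply/orP; left; apply/eqP; congr (_ `^ _); field.
  apply: (@le_trans _ _ (4 / (t * #|lattice n|%:R ^+ 2) * (C * #|lattice n|%:R ^+ 2 * q ^+ n))).
    by rewrite ler_wpM2l// divr_ge0// mulr_ge0// ?ltW// exprn_ge0.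
  have qE : q ^+ n = eta ^+ n * t.
    rewrite etaE /t -powRD ?pnatr_eq0 ?implybT// /q -powR_mulrn ?powR_ge0// -powRrM.
    by congr (_ `^ _); field.
  rewrite qE le_eqVlt; apply/orP; left; apply/eqP.
  have Ir : 0 < #|lattice n|%:R :> R by rewrite ltr0n.
  by field; rewrite !lt0r_neq0.
apply/eqP; rewrite eq_le (mean_ge0 mE)// andbT leNgt; apply/negP => h.
have : (fun n => (C1 + 4 * C) * eta ^+ n) @ \oo --> (0 : R).
  rewrite -[X in _ --> X](mulr0 (C1 + 4 * C)); apply: cvgM; first exact: cvg_cst.
  by apply: cvg_expr; rewrite ger0_norm// ltW.
move=> /cvgrPdist_lt/(_ _ h)[N _ HN]; have [n Nn En] := key N.
have P : 0 <= (C1 + 4 * C) * eta ^+ n.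
  apply: mulr_ge0; last by rewrite exprn_ge0// ltW.
  by rewrite addr_ge0// mulr_ge0// ltW.
have := HN n Nn; rewrite /= sub0r normrN ger0_norm//.
by rewrite ltNge En.
Qed.

End lattice_frequencies.

(** * Compact sets with prescribed decay and small coverings *)

Section average_sums.
Context {R : realType} {d : nat}.
Implicit Types (L D : seq 'rV[R]_d) (xi a : 'rV[R]_d).

(** Multiplicities are kept, so that averaging over [sumset L D] is integrating against the
    convolution of two uniform measures. *)
Definition sumset L D := [seq x + y | x <- L, y <- D].

Lemma size_sumset L D : size (sumset L D) = (size L * size D)%N.
Proof. exact: size_allpairs. Qed.

Lemma avg_sumset L D (f : 'rV[R]_d -> R) :
  avg (sumset L D) f = avg L (fun x => avg D (fun y => f (x + y))).
Proof.
rewrite /avg size_sumset big_allpairs_dep/= natrM invfM mulrA mulrAC.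
by rewrite mulr_suml -mulr_suml.
Qed.

Definition wave_le L xi (B : R) := forall t, avg L (wave xi t) <= B.

Lemma avg_le_cst (T : Type) (l : seq T) (f : T -> R) B : (0 < size l)%N ->
  (forall x, f x <= B) -> avg l f <= B.
Proof. by move=> l0 fB; rewrite -(avg_cst B l0); exact: avg_le. Qed.

Lemma wave_le_sumsetr L D xi B : (0 < size L)%N -> wave_le D xi B ->
  wave_le (sumset L D) xi B.
Proof.
move=> L0 DB t; rewrite avg_sumset; apply: avg_le_cst => // x.
under eq_fun do rewrite addrC wave_shift; exact: DB.
Qed.

Lemma avg_exchange (T U : Type) (l : seq T) (l' : seq U) (f : T -> U -> R) :
  avg l (fun x => avg l' (f x)) = avg l' (fun y => avg l (f ^~ y)).
Proof.
by rewrite /avg -!mulr_suml exchange_big/= mulrAC.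
Qed.

Lemma wave_le_sumsetl L D xi B : (0 < size D)%N -> wave_le L xi B ->
  wave_le (sumset L D) xi B.
Proof.
move=> D0 LB t; rewrite avg_sumset avg_exchange; apply: avg_le_cst => // y.
by under eq_fun do rewrite wave_shift; exact: LB.
Qed.

Fixpoint sign_sums (l : seq 'rV[R]_d) : seq 'rV[R]_d :=
  if l is a :: l' then sumset [:: a; - a] (sign_sums l') else [:: 0].

Lemma size_sign_sums l : (0 < size (sign_sums l))%N.
Proof. by elim: l => //= a l IH; rewrite size_cat size_map addn_gt0 IH. Qed.

(** The characteristic function of a sum of independent random signs is a product of cosines. *)
Lemma avg_sign_sums l xi t : avg (sign_sums l) (wave xi t) =
  cos t * \prod_(a <- l) cos (dotp xi a).
Proof.
have dotp0 : dotp xi 0 = 0 :> R by rewrite /dotp big1// => i _; rewrite mxE mulr0.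
elim: l t => [|a l IH] t.
  by rewrite big_nil mulr1 /avg big_seq1 divr1 /wave dotp0 add0r.
rewrite /sign_sums -/sign_sums avg_sumset {1}/avg !big_cons !big_nil addr0.
under eq_fun do rewrite addrC wave_shift.
rewrite IH; under [X in _ + avg _ X]eq_fun do rewrite addrC wave_shift.
by rewrite IH dotpNr !cosD cosN sinN /=; field.
Qed.

Lemma norm_sign_sums l x : x \in sign_sums l -> `|x| <= \sum_(a <- l) `|a|.
Proof.
elim: l x => [|a l IH] x.
  by rewrite inE => /eqP->; rewrite normr0 big_nil.
move=> /allpairsP[[y z] /= [ya zl ->]]; rewrite big_cons.
apply: le_trans (ler_normD _ _) _; apply: lerD; last exact: IH.
by move: ya; rewrite !inE => /orP[]/eqP->; rewrite ?normrN.
Qed.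

Definition cos_prod (m : nat) (t : R) := \prod_(j < m) cos (t / 2 ^+ j.+1).

(** Viete's product for sin t / t before passage to the limit, by iterating sin (2 u) = 2 sin u cos
    u. *)
Lemma cos_prodE m t : cos_prod m t * (2 ^+ m * sin (t / 2 ^+ m)) = sin t.
Proof.
elim: m => [|m IH]; first by rewrite /cos_prod big_ord0 expr0 divr1 !mul1r.
rewrite -IH /cos_prod big_ord_recr/= -mulrA; congr (_ * _).
set u := t / 2 ^+ m.+1; have -> : t / 2 ^+ m = u *+ 2.
  by rewrite /u exprS -mulr_natr invfM; field; rewrite expf_neq0.
by rewrite sin_mulr2n exprS -mulr_natr; ring.
Qed.

(** The condition keeps |t| / 2^m in [0, 1], where sin u >= u / 2, so the cofactor in [cos_prodE] is
    at least |t| / 2. *)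
Lemma cos_prod_le m t : 0 < `|t| <= 2 ^+ m -> `|cos_prod m t| <= 2 / `|t|.
Proof.
move=> /andP[t0 tm]; rewrite ler_pdivlMr//.
have m0 : 0 < 2 ^+ m :> R by rewrite exprn_gt0.
have h : `|t| / 2 <= `|2 ^+ m * sin (t / 2 ^+ m)|.
  rewrite normrM (gtr0_norm m0) -ler_pdivrMl//.
  have -> : (2 ^+ m)^-1 * (`|t| / 2) = `|t| / 2 ^+ m / 2 by ring.
  apply: (@le_trans _ _ (sin (`|t| / 2 ^+ m))).
    apply: half_le_sin; apply/andP; split; first by rewrite divr_ge0// ltW.
    by rewrite ler_pdivrMr// mul1r.
  have [tp|tn] := leP 0 t; first by rewrite (ger0_norm tp) ler_norm.
  by rewrite (ltr0_norm tn) mulNr sinN -normrN ler_norm.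
have := cos_prodE m t; move=> /(congr1 (fun x => `|x|)); rewrite normrM => e.
have := sin_max t; rewrite -e => e1.
have : `|cos_prod m t| * (`|t| / 2) <= 1.
  by apply: le_trans e1; rewrite ler_wpM2l.
by lra.
Qed.

Lemma cos_prod_le1 m t : `|cos_prod m t| <= 1.
Proof.
rewrite /cos_prod normr_prod; apply: prodr_ile1 => j _.
by rewrite normr_ge0 cos_max.
Qed.

(** A finite substitute for the k-fold convolution of the uniform law on a small cube, whose
    transform decays like |xi|^-k. Only the frequencies up to M are controlled. *)
Lemma smooth_list (r : R) (k : nat) (M : R) : (0 < d)%N -> 0 < r -> (0 < k)%N ->
  exists G : seq 'rV[R]_d, [/\ (0 < size G)%N, forall x, x \in G -> `|x| <= r &
    forall xi, xi != 0 -> `|xi| <= M -> forall t,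
      `|avg G (wave xi t)| <= (2 * (k * d)%:R / (r * `|xi|)) ^+ k].
Proof.
move=> d0 r0 k0.
have kd0 : 0 < (k * d)%:R :> R by rewrite ltr0n muln_gt0 k0.
(* The steps in one direction have total length at most r', and each of the d directions is used k
   times. *)
pose r' : R := r / (k * d)%:R.
have r'0 : 0 < r' by rewrite divr_gt0.
have [m Mm] : exists m, M * r' <= 2 ^+ m.
  have e0 : 0 < (Num.max 1 (M * r'))^-1 by rewrite invr_gt0 lt_max ltr01.
  have [m hm] := half_expn_small e0; exists m; move: hm.
  rewrite exprVn ltf_pV2 ?posrE ?exprn_gt0 ?lt_max ?ltr01//.
  by rewrite gt_max => /andP[_ /ltW].
pose step (i : 'I_d) (j : nat) : 'rV[R]_d := (r' / 2 ^+ j.+1) *: delta_mx 0 i.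
have stepE xi i j : dotp xi (step i j) = xi 0 i * r' / 2 ^+ j.+1.
  rewrite /dotp (bigD1 i)//= big1 ?addr0 => [|i' i'i].
    by rewrite !mxE !eqxx mulr1 mulrA.
  by rewrite !mxE (negbTE i'i) andbF !mulr0.
have step_norm i j : `|step i j| <= r' / 2 ^+ j.+1.
  have p0 : 0 <= r' / 2 ^+ j.+1 by rewrite divr_ge0// ?exprn_ge0// ltW.
  apply: norm_le_coord => // i'; rewrite !mxE eqxx /=.
  by case: eqP => _; rewrite ?mulr1 ?mulr0 ?normr0// ger0_norm.
pose js := flatten (nseq k (iota 0 m)).
pose l := [seq step i j | i <- enum 'I_d, j <- js].
have prod_js (t : R) : \prod_(j <- js) cos (t / 2 ^+ j.+1) = cos_prod m t ^+ k.
  rewrite /js /cos_prod; elim: (k) => [|k' IH] /=; first by rewrite big_nil expr0.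
  by rewrite big_cat/= IH exprS -(big_mkord xpredT (fun j => cos (t / 2 ^+ j.+1))) /index_iota subn0.
have sum_js : \sum_(j <- js) r' / 2 ^+ j.+1 <= k%:R * r'.
  have S : \sum_(j <- iota 0 m) r' / 2 ^+ j.+1 <= r'.
    have -> : \sum_(j <- iota 0 m) r' / 2 ^+ j.+1 = r' - r' / 2 ^+ m.
      elim: (m) => [|m' IH]; first by rewrite big_nil expr0; lra.
      rewrite -addn1 iotaD big_cat/= IH big_seq1 add0n addn1 !exprS.
      by field; rewrite expf_neq0.
    by rewrite gerBl divr_ge0// ?exprn_ge0// ltW.
  rewrite /js; elim: (k) => [|k' IH] /=; first by rewrite big_nil mul0r.
  by rewrite big_cat/= -[k'.+1%:R]natr1 mulrDl mul1r addrC lerD.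
exists (sign_sums l); split; first exact: size_sign_sums.
  move=> x /norm_sign_sums /le_trans; apply.
  rewrite /l big_allpairs_dep/= big_enum/=.
  apply: (@le_trans _ _ (\sum_(i < d) k%:R * r')).
    apply: ler_sum => i _; apply: le_trans sum_js.
    by apply: ler_sum => j _; exact: step_norm.
  rewrite sumr_const card_ord -mulr_natl /r' natrM.
  have d0' : 0 < d%:R :> R by rewrite ltr0n.
  have k0' : 0 < k%:R :> R by rewrite ltr0n.
  by rewrite le_eqVlt; apply/orP; left; apply/eqP; field; rewrite !lt0r_neq0.
move=> xi xi0 xiM t; rewrite avg_sign_sums normrM.
have xi0' : 0 < `|xi| by rewrite normr_gt0.
apply: (@le_trans _ _ (1 * `|\prod_(a <- l) cos (dotp xi a)|)).
  by rewrite ler_wpM2r// cos_max.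
rewrite mul1r /l big_allpairs_dep/= big_enum/=.
have -> : \prod_(i < d) \prod_(j <- js) cos (dotp xi (step i j)) =
    \prod_(i < d) cos_prod m (xi 0 i * r') ^+ k.
  apply: eq_bigr => i _; rewrite -prod_js; apply: eq_bigr => j _.
  by rewrite stepE.
(* Only the largest coordinate of xi provides decay; the other factors are bounded by 1. *)
have [i xii] := norm_eq_coord xi d0.
rewrite (bigD1 i)//= normrM -[leRHS]mulr1 ler_pM//; last first.
  rewrite normr_prod; apply: prodr_ile1 => i' _.
  by rewrite normr_ge0 normrX exprn_ile1// cos_prod_le1.
have nn : 0 <= 2 * (k * d)%:R / (r * `|xi|).
  by apply: divr_ge0; apply: mulr_ge0 => //; exact: ltW.
rewrite normrX ler_pXn2r ?nnegrE//.
have -> : 2 * (k * d)%:R / (r * `|xi|) = 2 / `|xi 0 i * r'|.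
  rewrite normrM xii (gtr0_norm r'0) /r'.
  by move: ((k * d)%:R : R) kd0 => K K0; field; rewrite !lt0r_neq0.
apply: cos_prod_le; rewrite normrM xii (gtr0_norm r'0) mulr_gt0//=.
by apply: le_trans Mm; rewrite ler_wpM2r// ltW.
Qed.

End average_sums.

(** * Derandomized sampling *)

Section greedy_sampling.
Context {R : realType}.

Lemma expR_le_quadratic (u : R) : `|u| <= 2^-1 -> expR u <= 1 + u + 2 * u ^+ 2.
Proof.
rewrite ler_norml => /andP[u1 u2].
have h : 0 < 1 - u by lra.
have e1 : expR u <= (1 - u)^-1.
  rewrite -[u]opprK expRN opprK lef_pV2 ?posrE ?expR_gt0//.
  exact: expR_ge1Dx.
apply: le_trans e1 _; rewrite -[leLHS]mul1r ler_pdivrMr//.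
by have := sqr_ge0 u; nra.
Qed.

Lemma exists_le_avg (T : eqType) (G : seq T) (f : T -> R) : (0 < size G)%N ->
  exists2 x, x \in G & f x <= avg G f.
Proof.
move=> G0; apply: contrapT => H.
have {}H x : x \in G -> avg G f < f x.
  by move=> xG; rewrite ltNge; apply/negP => h; apply: H; exists x.
have : \sum_(x <- G) avg G f < \sum_(x <- G) f x.
  rewrite !big_seq; apply: ltr_sum => //.
  by case: G G0 H => // y G _ H; rewrite /= mem_head.
rewrite big_const_seq count_predT iter_addr_0 -[_ *+ _]mulr_natr /avg divfK ?ltxx//.
by rewrite pnatr_eq0 -lt0n.
Qed.

(** Method of conditional expectations for Chernoff's bound: each new point is chosen so that the
    sum of exponential moments does not exceed its average over G. *)
Lemma greedy_sample (T : eqType) (I : finType) (G : seq T) (Y : I -> T -> R)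
    (lam : R) N : (0 < size G)%N -> 0 <= lam <= 1 / 4 ->
  (forall i, avg G (Y i) = 0) -> (forall i x, `|Y i x| <= 2) ->
  exists D : seq T, [/\ size D = N, {subset D <= G} &
    \sum_i expR (lam * \sum_(x <- D) Y i x) <= #|I|%:R * expR (8 * lam ^+ 2 * N%:R)].
Proof.
move=> G0 /andP[l0 l4] Y0 Y2; elim: N => [|N [D [sD DG HD]]].
  exists [::]; split => //; rewrite mulr0 expR0 mulr1.
  under eq_bigr do rewrite big_nil mulr0 expR0.
  by rewrite sumr_const.
pose S i := \sum_(x <- D) Y i x.
pose F x := \sum_i expR (lam * S i) * expR (lam * Y i x).
have [x xG Fx] := exists_le_avg F G0.
exists (x :: D); split => [|y|]; first by rewrite /= sD.
  by rewrite inE => /predU1P[->//|/DG].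
have -> : \sum_i expR (lam * \sum_(y <- x :: D) Y i y) = F x.
  by apply: eq_bigr => i _; rewrite big_cons mulrDr expRD mulrC.
apply: le_trans Fx _.
have -> : avg G F = \sum_i expR (lam * S i) * avg G (fun x => expR (lam * Y i x)).
  rewrite /avg /F exchange_big/= mulr_suml; apply: eq_bigr => i _.
  by rewrite -mulr_sumr mulrA.
(* As lam <= 1 / 4, the exponent is at most 1 / 2 in absolute value and the quadratic bound on exp
   applies. The linear term averages to 0, and 2 (2 lam)^2 = 8 lam^2. *)
have H i : avg G (fun x => expR (lam * Y i x)) <= expR (8 * lam ^+ 2).
  apply: (@le_trans _ _ (1 + 8 * lam ^+ 2)); last exact: expR_ge1Dx.
  apply: (@le_trans _ _ (avg G (fun x => (1 + 8 * lam ^+ 2) + lam * Y i x))).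
    apply: avg_le => y; have yl : `|lam * Y i y| <= 2 * lam.
      by rewrite normrM (ger0_norm l0) mulrC ler_wpM2r.
    apply: le_trans (expR_le_quadratic _) _; first by apply: le_trans yl _; lra.
    have : (lam * Y i y) ^+ 2 <= (2 * lam) ^+ 2.
      by rewrite -real_normK ?num_real// ler_pXn2r// ?nnegrE// mulr_ge0.
    by rewrite exprMn; lra.
  by rewrite avgD avgZ Y0 mulr0 addr0 avg_cst.
apply: (@le_trans _ _ (\sum_i expR (lam * S i) * expR (8 * lam ^+ 2))).
  by apply: ler_sum => i _; rewrite ler_wpM2l// expR_ge0.
rewrite -mulr_suml; apply: (@le_trans _ _ (#|I|%:R * expR (8 * lam ^+ 2 * N%:R) * expR (8 * lam ^+ 2))).
  by rewrite ler_wpM2r// expR_ge0.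
by rewrite -mulrA -expRD -[N.+1%:R]natr1 mulrDr mulr1.
Qed.

Lemma greedy_sample_bound (T : eqType) (I : finType) (G : seq T) (Y : I -> T -> R)
    N : (0 < size G)%N -> (0 < N)%N -> (0 < #|I|)%N ->
  (forall i, avg G (Y i) = 0) -> (forall i x, `|Y i x| <= 2) ->
  exists D : seq T, [/\ size D = N, {subset D <= G} &
    forall i, avg D (Y i) <= 4 * (ln #|I|%:R + 1) / Num.sqrt N%:R].
Proof.
move=> G0 N0 I0 Y0 Y2; set q := Num.sqrt N%:R.
have Nr : 1 <= N%:R :> R by rewrite ler1n.
have q1 : 1 <= q by rewrite -sqrtr1 ler_sqrt// (le_trans ler01).
have q0 : 0 < q by apply: lt_le_trans q1.
have qq : q ^+ 2 = N%:R by rewrite sqr_sqrtr.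
(* Then 8 lam^2 N = 1 / 2, so the exponential moments stay bounded by a constant times the number of
   tests. *)
pose lam : R := (4 * q)^-1.
have lam0 : 0 < lam by rewrite invr_gt0 mulr_gt0.
have lam4 : 0 <= lam <= 1 / 4.
  rewrite ltW//= mul1r lef_pV2 ?posrE ?mulr_gt0//; lra.
have [D [sD DG HD]] := greedy_sample N G0 lam4 Y0 Y2.
exists D; split => // i.
have I0r : 0 < #|I|%:R :> R by rewrite ltr0n.
have e1 : expR (lam * \sum_(x <- D) Y i x) <= #|I|%:R * expR 1.
  apply: (@le_trans _ _ (\sum_i expR (lam * \sum_(x <- D) Y i x))).
    by rewrite (bigD1 i)//= lerDl sumr_ge0// => j _; exact: expR_ge0.
  apply: le_trans HD _; rewrite ler_pM2l// ler_expR.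
  have -> : 8 * lam ^+ 2 * N%:R = 2^-1 by rewrite -qq /lam; field; rewrite lt0r_neq0.
  by rewrite invf_le1 ?ler1n.
have e2 : lam * \sum_(x <- D) Y i x <= ln #|I|%:R + 1.
  by rewrite -ler_expR expRD lnK// posrE.
rewrite /avg sD -qq; set S := \sum_(x <- D) Y i x in e2 *.
rewrite ler_pdivlMr// expr2 invfM mulrA divfK ?gt_eqF// ler_pdivrMr//.
move: e2; rewrite /lam mulrC ler_pdivrMr ?mulr_gt0//.
by rewrite mulrA [_ * 4]mulrC.
Qed.

End greedy_sampling.

Section stage.
Context {R : realType} {d : nat}.
Hypothesis d0 : (0 < d)%N.
Implicit Types (xi x : 'rV[R]_d).

Lemma avg_le_in (T : eqType) (l : seq T) (f g : T -> R) :
  (forall y, y \in l -> f y <= g y) -> avg l f <= avg l g.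
Proof.
move=> fg; rewrite /avg ler_wpM2r ?invr_ge0// !big_seq.
by apply: ler_sum => x /fg.
Qed.

Lemma cos_lipschitz (a b : R) : `|cos a - cos b| <= `|a - b|.
Proof.
set u := (a + b) / 2; set v := (a - b) / 2.
have -> : a = u + v by rewrite /u /v; lra.
have -> : b = u - v by rewrite /u /v; lra.
have -> : cos (u + v) - cos (u - v) = - (2 * sin u * sin v).
  by rewrite cosD cosB; ring.
rewrite normrN !normrM.
have -> : u + v - (u - v) = 2 * v by lra.
have : `|sin u| * `|sin v| <= 1 * `|v| by rewrite ler_pM ?sin_max ?norm_sin_le.
by rewrite mul1r [`|2 * v|]normrM -mulrA ler_pM2l ?normr_gt0 ?pnatr_eq0.
Qed.

Lemma wave_lipschitz xi xi' t x : `|x| <= 1 ->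
  wave xi t x <= wave xi' t x + d%:R * `|xi - xi'|.
Proof.
move=> x1; rewrite -lerBlDl; apply: le_trans (ler_norm _) _.
apply: le_trans (cos_lipschitz _ _) _.
rewrite opprD addrACA subrr addr0 -dotpNl -dotpDl.
apply: le_trans (dotp_norm_le _ _) _; rewrite ler_wpM2l//.
by rewrite ler_piMr.
Qed.

Lemma wave_decomp xi t x :
  wave xi t x = cos t * wave xi 0 x + sin t * wave xi (pi / 2) x :> R.
Proof. by rewrite /wave addr0 cosDpihalf cosD; ring. Qed.

(** Sampling controls finitely many waves, on a grid of mesh 1 / N. The others follow by the
    Lipschitz bound, used once for D and once for G; the points have norm at most r <= 1. *)
Lemma net_sample (r : R) (k N Q : nat) : 0 < r <= 1 -> (0 < k)%N -> (0 < N)%N ->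
  exists D : seq 'rV[R]_d, [/\ size D = N, forall x, x \in D -> `|x| <= r &
    forall xi, xi != 0 -> `|xi| <= Q%:R / N%:R -> forall t,
      avg D (wave xi t) <= (2 * (k * d)%:R / (r * `|xi|)) ^+ k +
        2 * d%:R / N%:R +
        8 * (ln (4 * (2 * Q + 1) ^ d)%:R + 1) / Num.sqrt N%:R].
Proof.
move=> /andP[r0 r1] k0 N0.
have N0r : 0 < N%:R :> R by rewrite ltr0n.
have [G [G0 Gr Gxi]] := smooth_list (Q%:R / N%:R) d0 r0 k0.
pose I := ({ffun 'I_d -> 'I_(2 * Q + 1)} * (bool * bool))%type.
pose frq (a : {ffun 'I_d -> 'I_(2 * Q + 1)}) : 'rV[R]_d :=
  \row_i (((a i : nat)%:R - Q%:R) / N%:R).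
(* The phases 0 and pi / 2 determine all others by linearity. Adding pi changes the sign, which
   turns the one-sided greedy bound into a two-sided one. *)
pose th (b : bool * bool) : R := (if b.1 then pi / 2 else 0) + (if b.2 then pi else 0).
pose w (i : I) := wave (frq i.1) (th i.2).
pose Y (i : I) (x : 'rV[R]_d) : R := w i x - avg G (w i).
have Y0 i : avg G (Y i) = 0.
  by rewrite /Y (avgD G (w i) (fun=> _)) avg_cst// subrr.
have wG i : `|avg G (w i)| <= 1.
  rewrite ler_norml; apply/andP; split.
    by rewrite -(avg_cst (-1) G0); apply: avg_le => x; exact: cos_geN1.
  by rewrite -(avg_cst 1 G0); apply: avg_le => x; exact: cos_le1.
have Y2 i x : `|Y i x| <= 2.
  apply: le_trans (ler_normB _ _) _; have := wG i.
  by have : `|w i x| <= 1 by [exact: cos_max]; lra.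
have cI : #|{: I}| = (4 * (2 * Q + 1) ^ d)%N.
  by rewrite !card_prod card_ffun !card_ord !card_bool mulnC.
have I0 : (0 < #|{: I}|)%N by rewrite cI muln_gt0 expn_gt0 addn1.
have [D [sD DG HD]] := greedy_sample_bound G0 N0 I0 Y0 Y2.
set tau := 4 * _ / _ in HD.
have D0 : (0 < size D)%N by rewrite sD.
exists D; split => // [x /DG /Gr//|xi xi0 xiQ t].
have Dr x : x \in D -> `|x| <= 1 by move=> /DG/Gr/le_trans; apply.
have Gr1 x : x \in G -> `|x| <= 1 by move=> /Gr/le_trans; apply.
(* Round each coordinate of N xi + Q down; |xi| <= Q / N keeps the result between 0 and 2 Q. *)
have [a xia] : exists a, `|xi - frq a| <= N%:R^-1.
  have bnd i : 0 <= xi 0 i * N%:R + Q%:R <= (2 * Q)%:R.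
    have : `|xi 0 i| <= Q%:R / N%:R by apply: le_trans xiQ; exact: coord_le_norm.
    rewrite ler_pdivlMr// -[X in _ * X](gtr0_norm N0r) -normrM ler_norml natrM.
    by move=> /andP[h1 h2]; apply/andP; split; lra.
  have lt (i : 'I_d) : (Num.truncn (xi 0%R i * N%:R + Q%:R)%R < 2 * Q + 1)%N.
    have /andP[h1 h2] := bnd i.
    have /andP[t1 _] := truncn_itv h1.
    by have := le_trans t1 h2; rewrite ler_nat; lia.
  exists [ffun i => Ordinal (lt i)]; apply: norm_le_coord => [|i].
    by rewrite invr_ge0.
  rewrite !mxE ffunE /=; have /andP[h1 h2] := bnd i.
  have /andP[t1 t2] := truncn_itv h1; set z := Num.truncn _ in t1 t2 *.
  have -> : xi 0 i - (z%:R - Q%:R) / N%:R = (xi 0 i * N%:R + Q%:R - z%:R) / N%:R.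
    by field; rewrite lt0r_neq0.
  rewrite normrM (ger0_norm (_ : 0 <= N%:R^-1)) ?invr_ge0//.
  rewrite ler_piMl ?invr_ge0// ger0_norm ?subr_ge0//.
  by move: t2; rewrite -natr1; lra.
have dN : d%:R * `|xi - frq a| <= d%:R / N%:R by rewrite ler_wpM2l.
have HDa b : avg D (wave (frq a) (th b)) - avg G (wave (frq a) (th b)) <= tau.
  have := HD (a, b); rewrite /Y (avgD D (w (a, b)) (fun=> _)) avg_cst//.
have neg (l : seq 'rV[R]_d) b : avg l (wave (frq a) (th (b, true))) =
    - avg l (wave (frq a) (th (b, false))).
  rewrite -[RHS]mulN1r -avgZ; congr avg; apply/funext => x.
  by rewrite /wave /th/= addr0 addrA cosDpi mulN1r.
have tauD b : `|avg D (wave (frq a) (th (b, false))) -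
    avg G (wave (frq a) (th (b, false)))| <= tau.
  rewrite ler_norml HDa andbT; have := HDa (b, true); rewrite !neg; lra.
have dec (l : seq 'rV[R]_d) : avg l (wave (frq a) t) =
    cos t * avg l (wave (frq a) (th (false, false))) +
    sin t * avg l (wave (frq a) (th (true, false))).
  rewrite -!avgZ -avgD; congr avg; apply/funext => x.
  by rewrite wave_decomp /th/= !addr0.
have step1 : avg D (wave xi t) <= avg D (wave (frq a) t) + d%:R / N%:R.
  rewrite -[X in _ + X](avg_cst _ D0) -avgD; apply: avg_le_in => x /Dr x1.
  by apply: le_trans (wave_lipschitz xi (frq a) t x1) _; rewrite lerD2l.
have step2 : avg G (wave (frq a) t) <= avg G (wave xi t) + d%:R / N%:R.
  rewrite -[X in _ + X](avg_cst _ G0) -avgD; apply: avg_le_in => x /Gr1 x1.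
  by apply: le_trans (wave_lipschitz (frq a) xi t x1) _; rewrite lerD2l distrC.
have step3 : avg D (wave (frq a) t) <= avg G (wave (frq a) t) + 2 * tau.
  rewrite !dec.
  have h1 := tauD false; have h2 := tauD true.
  have := cos_max t; have := sin_max t.
  move: h1 h2; move: (avg D _) (avg G _) (avg D _) (avg G _) => p' q' p q.
  move=> h1 h2 s1 c1.
  have : cos t * (p - q) <= tau.
    apply: le_trans (ler_norm _) _; rewrite normrM.
    by apply: le_trans h1; rewrite ler_piMl.
  have : sin t * (p' - q') <= tau.
    apply: le_trans (ler_norm _) _; rewrite normrM.
    by apply: le_trans h2; rewrite ler_piMl.
  lra.
have step4 : avg G (wave xi t) <= (2 * (k * d)%:R / (r * `|xi|)) ^+ k.
  exact: le_trans (ler_norm _) (Gxi _ xi0 xiQ t).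
have -> : 8 * (ln (4 * (2 * Q + 1) ^ d)%:R + 1) / Num.sqrt N%:R = 2 * tau.
  by rewrite /tau cI; lra.
have -> : 2 * d%:R / N%:R = d%:R / N%:R + d%:R / N%:R :> R by lra.
lra.
Qed.

End stage.

Section stage_parameters.
Context {R : realType} {d : nat}.
Hypothesis d0 : (0 < d)%N.

(** Absorbs the logarithm of the number of tests, linear in the scale, into an arbitrarily small
    exponent. *)
Lemma linear_le_powR2 (A B e : R) n : 0 <= A -> 0 <= B -> 0 < e ->
  A + B * n%:R <= (A + B / (e * ln 2)) * 2 `^ (n%:R * e).
Proof.
move=> A0 B0 e0; have l2 : 0 < ln 2 :> R by rewrite ln_gt0// ltr1n.
have el0 : 0 < e * ln 2 by rewrite mulr_gt0.
have pE : 2 `^ (n%:R * e) = expR (n%:R * (e * ln 2)) :> R.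
  by rewrite /powR pnatr_eq0/= mulrA.
have h : 1 + n%:R * (e * ln 2) <= 2 `^ (n%:R * e) by rewrite pE expR_ge1Dx.
have p1 : 1 <= 2 `^ (n%:R * e) :> R.
  by apply: le_trans h; rewrite lerDl mulr_ge0// ltW.
have p2 : n%:R <= 2 `^ (n%:R * e) / (e * ln 2) :> R.
  by rewrite ler_pdivlMr//; lra.
rewrite mulrDl lerD//; first by rewrite ler_peMr.
by rewrite mulrAC -mulrA ler_wpM2l.
Qed.

(** In this range 2^n <= u^(1 / gam), so the left side is at most a constant times u^(- k (1 - 1 /
    gam)), and k is large enough. *)
Lemma smooth_decay (s gam : R) (k n : nat) (u : R) : 0 < s -> 1 < gam ->
  s / 2 <= k%:R * (1 - gam^-1) -> 2 `^ (gam * n%:R) <= u ->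
  (2 * (k * d)%:R / (2^-1 ^+ n * u)) ^+ k <= (2 * (k * d)%:R) ^+ k * u `^ (- (s / 2)).
Proof.
move=> s0 g1 sk nu; have g0 : 0 < gam by apply: lt_trans g1.
have p1 : 1 <= 2 `^ (gam * n%:R) :> R.
  rewrite -[leLHS](powRr0 2) ler_powR ?ler1n//.
  by rewrite mulr_ge0// ltW.
have u1 : 1 <= u by apply: le_trans nu.
have u0 : 0 < u by apply: lt_le_trans u1.
have n2 : 2 ^+ n <= u `^ (gam^-1).
  have -> : 2 ^+ n = (2 `^ (gam * n%:R)) `^ (gam^-1) :> R.
    by rewrite -powRrM mulrAC mulfV ?gt_eqF// mul1r powR_mulrn.
  by rewrite ge0_ler_powR ?invr_ge0 ?nnegrE ?powR_ge0// ?ltW.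
have -> : 2 * (k * d)%:R / (2^-1 ^+ n * u) = 2 * (k * d)%:R * (2 ^+ n / u).
  by rewrite exprVn invfM invrK mulrA.
rewrite exprMn ler_wpM2l ?exprn_ge0 ?mulr_ge0//.
apply: (@le_trans _ _ ((u `^ (gam^-1 - 1)) ^+ k)).
  have [->|kn] := posnP k; first by rewrite !expr0.
  rewrite ler_pXn2r ?nnegrE ?powR_ge0 ?divr_ge0 ?exprn_ge0 ?(ltW u0)//.
  rewrite powRB; last by rewrite (gt_eqF u0) implybT.
  by rewrite powRr1 ?(ltW u0)// ler_pM2r ?invr_gt0.
rewrite -powR_mulrn ?powR_ge0// -powRrM ler_powR//; lra.
Qed.

(** The smooth term of [net_sample] is small from the bottom of the window on because gam > 1; the
    sampling error is small up to its top because gam s < beta. As C depends on neither n nor n',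
    stages can be iterated. *)
Lemma stage (s beta gam : R) : 0 < s -> 1 < gam -> gam * s < beta ->
  exists2 C : R, 0 < C & forall n n' : nat, exists D : seq 'rV[R]_d,
    [/\ (0 < size D)%N, (size D)%:R <= 2 `^ (n'%:R * beta),
      forall x, x \in D -> `|x| <= 2^-1 ^+ n &
      forall xi, 2 `^ (gam * n%:R) <= `|xi| <= 2 `^ (gam * n'%:R) ->
        forall t, avg D (wave xi t) <= C * `|xi| `^ (- (s / 2))].
Proof.
move=> s0 g1 gsb; have g0 : 0 < gam by apply: lt_trans g1.
have b0 : 0 < beta by apply: lt_trans gsb; rewrite mulr_gt0.
have [k k0 sk] : exists2 k, (0 < k)%N & s / 2 <= k%:R * (1 - gam^-1).
  have h : 0 < 1 - gam^-1 by rewrite subr_gt0 invf_lt1.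
  exists (Num.truncn (s / 2 / (1 - gam^-1))).+1 => //.
  by rewrite -ler_pdivrMr// ltW// truncnS_gt.
(* The sampling error is about n' 2^(- n' beta / 2), and at the top of the window the allowed value
   is 2^(- n' gam s / 2). The ratio 2^(n' e) of the two powers absorbs n'. *)
pose e := (beta - gam * s) / 2.
have e0 : 0 < e by rewrite divr_gt0// subr_gt0.
(* A + B n' bounds 2 d + 8 (ln (4 (2 Q + 1)^d) + 1), using ln 4 <= 3 and ln (2 Q + 1) <= 4 + n' (gam
   + beta). *)
pose A : R := 32 + 34 * d%:R.
pose B : R := 8 * d%:R * (gam + beta).
have A0 : 0 <= A by rewrite /A addr_ge0// mulr_ge0.
have B0 : 0 <= B by rewrite /B !mulr_ge0// addr_ge0// ltW.
pose K : R := 2 * (A + B / (e * ln 2)).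
have l2 : 0 < ln 2 :> R by rewrite ln_gt0// ltr1n.
have K0 : 0 <= K by rewrite mulr_ge0// addr_ge0// divr_ge0// mulr_ge0 ?ltW.
have kd0 : 0 < (2 * (k * d)%:R) ^+ k :> R.
  by rewrite exprn_gt0// mulr_gt0// ltr0n muln_gt0 k0.
exists ((2 * (k * d)%:R) ^+ k + K); first by rewrite ltr_wpDr.
move=> n n'.
have P1 : 1 <= 2 `^ (n'%:R * beta) :> R.
  by rewrite -[leLHS](powRr0 2) ler_powR ?ler1n// mulr_ge0// ltW.
pose N := Num.truncn (2 `^ (n'%:R * beta) : R).
have /andP[N1 N2] : (N%:R : R) <= 2 `^ (n'%:R * beta) < N.+1%:R.
  by apply: truncn_itv; rewrite powR_ge0.
have N0 : (0 < N)%N.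
  by rewrite -(ltr_nat R) -(ltrD2r 1) add0r natr1; apply: le_lt_trans N2.
have Nr : 1 <= N%:R :> R by rewrite ler1n.
pose M := 2 `^ (gam * n'%:R) : R.
have M1 : 1 <= M.
  by rewrite -[leLHS](powRr0 2) ler_powR ?ler1n// mulr_ge0// ltW.
pose Q := (Num.truncn (M * N%:R)).+1.
have MN0 : 0 <= M * N%:R by rewrite mulr_ge0// (le_trans ler01).
have /andP[Q1 Q2] := truncn_itv MN0.
have r01 : 0 < (2^-1 ^+ n : R) <= 1.
  by rewrite exprn_gt0 ?invr_gt0//= exprn_ile1 ?invr_ge0// invf_le1 ?ler1n.
have [D [sD Dr Dxi]] := net_sample d0 Q r01 k0 N0.
exists D; split => //; [by rewrite sD|by rewrite sD|].
move=> xi /andP[xi1 xi2] t.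
have u1 : 1 <= `|xi|.
  apply: le_trans xi1.
  by rewrite -[leLHS](powRr0 2) ler_powR ?ler1n// mulr_ge0// ltW.
have u0 : 0 < `|xi| by apply: lt_le_trans u1.
have xi0 : xi != 0 by rewrite -normr_gt0.
have xiQ : `|xi| <= Q%:R / N%:R.
  by apply: le_trans xi2 _; rewrite ler_pdivlMr ?ltr0n// ltW.
apply: le_trans (Dxi _ xi0 xiQ t) _; rewrite -addrA (mulrDl ((2 * (k * d)%:R) ^+ k)) lerD//.
  exact: (@smooth_decay s gam).
set q := Num.sqrt N%:R.
have q1 : 1 <= q by rewrite -sqrtr1 ler_sqrt// (le_trans ler01).
have q0 : 0 < q by apply: lt_le_trans q1.
have qq : q ^+ 2 = N%:R by rewrite sqr_sqrtr.
have Q5 : (2 * Q + 1)%:R <= 5 * 2 `^ (n'%:R * (gam + beta)) :> R.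
  rewrite mulrDr powRD ?pnatr_eq0 ?implybT// [n'%:R * gam]mulrC -/M.
  rewrite natrD natrM /Q -natr1.
  have : M * N%:R <= M * 2 `^ (n'%:R * beta) by rewrite ler_wpM2l// (le_trans ler01).
  have : 1 <= M * 2 `^ (n'%:R * beta) by rewrite -[leLHS]mulr1 ler_pM.
  move: Q1; lra.
have Qp : 0 < (2 * Q + 1)%:R :> R by rewrite ltr0n addn1.
have lnQ : ln (2 * Q + 1)%:R <= 4 + n'%:R * (gam + beta).
  have p0 : 0 < 2 `^ (n'%:R * (gam + beta)) :> R by rewrite powR_gt0.
  apply: (@le_trans _ _ (ln (5 * 2 `^ (n'%:R * (gam + beta))))).
    by rewrite ler_ln ?posrE// mulr_gt0.
  rewrite lnM ?posrE// ln_powR lerD//.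
    by have := @le_ln1Dx R 4 _; rewrite (_ : 1 + 4 = 5) ?[1 + 4]addrC; [apply; lra|lra].
  rewrite ler_piMr//; first by rewrite mulr_ge0// addr_ge0// ltW.
  by have := @le_ln1Dx R 1 _; rewrite (_ : 1 + 1 = 2); [apply; lra|lra].
have ln4 : ln 4 <= 3 :> R.
  by have := @le_ln1Dx R 3 _; rewrite (_ : 1 + 3 = 4); [apply; lra|lra].
have lnI : ln (4 * (2 * Q + 1) ^ d)%:R <= 3 + d%:R * (4 + n'%:R * (gam + beta)).
  rewrite natrM natrX lnM ?posrE ?exprn_gt0// lerD// lnXn//.
  by rewrite -[_ *+ d]mulr_natl ler_wpM2l.
apply: (@le_trans _ _ ((A + B * n'%:R) / q)).
  have h : 2 * d%:R / N%:R <= 2 * d%:R / q.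
    rewrite ler_wpM2l ?mulr_ge0// lef_pV2 ?posrE//; last by rewrite (lt_le_trans ltr01).
    by rewrite -qq expr2 ler_peMr// ltW.
  apply: (@le_trans _ _ (2 * d%:R / q + 8 * (3 + d%:R * (4 + n'%:R * (gam + beta)) + 1) / q)).
    by rewrite lerD// ler_wpM2r ?invr_ge0 ?(ltW q0)// ler_wpM2l// lerD2r.
  rewrite -mulrDl ler_wpM2r ?invr_ge0 ?(ltW q0)//.
  by rewrite /A /B; lra.
apply: (@le_trans _ _ ((A + B / (e * ln 2)) * 2 `^ (n'%:R * e) / q)).
  by rewrite ler_wpM2r ?invr_ge0 ?(ltW q0)// linear_le_powR2.
(* Rounding down to N >= 1 costs at most a factor 4 in N, hence 2 in its square root. *)
have q2 : q^-1 <= 2 * 2 `^ (- (n'%:R * beta / 2)).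
  have P : 2 `^ (n'%:R * beta) = (2 `^ (n'%:R * beta / 2)) ^+ 2 :> R.
    by rewrite -powR_mulrn ?powR_ge0// -powRrM; congr (_ `^ _); field.
  have p0 : 0 < 2 `^ (n'%:R * beta / 2) :> R by rewrite powR_gt0.
  rewrite powRN -[leRHS]invrK lef_pV2 ?posrE// ?invr_gt0 ?mulr_gt0 ?invr_gt0//.
  rewrite invfM invrK -ler_sqr ?nnegrE ?mulr_ge0 ?invr_ge0 ?(ltW p0) ?(ltW q0)//.
  rewrite exprMn -P qq; move: N2; rewrite -natr1 exprVn.
  have -> : (2 ^+ 2 : R)^-1 = 1 / 4 by field.
  move: Nr P1; lra.
have M2 : 2 `^ (- (n'%:R * gam * s / 2)) <= `|xi| `^ (- (s / 2)).
  have -> : 2 `^ (- (n'%:R * gam * s / 2)) = M `^ (- (s / 2)).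
    by rewrite /M -powRrM; congr (_ `^ _); field.
  by apply: powRN_le => //; rewrite divr_ge0// ltW.
apply: (@le_trans _ _ (K * 2 `^ (- (n'%:R * gam * s / 2)))); last by rewrite ler_wpM2l.
have -> : 2 `^ (- (n'%:R * gam * s / 2)) = 2 `^ (n'%:R * e) * 2 `^ (- (n'%:R * beta / 2)) :> R.
  by rewrite -powRD ?pnatr_eq0 ?implybT//; congr (_ `^ _); rewrite /e; field.
have L0 : 0 <= A + B / (e * ln 2) by rewrite addr_ge0// divr_ge0// mulr_ge0 ?ltW.
rewrite /K; move: (A + B / (e * ln 2)) L0 => L L0.
move: q2 (powR_ge0 (2 : R) (n'%:R * e)).
move: (2 `^ (n'%:R * e)) (2 `^ (- (n'%:R * beta / 2))) (q^-1) => x y z zy x0.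
have -> : 2 * L * (x * y) = L * x * (2 * y) by ring.
by rewrite ler_wpM2l// mulr_ge0.
Qed.

End stage_parameters.

Section salem_sets.
Context {R : realType} {d : nat}.
Hypothesis d0 : (0 < d)%N.
Implicit Types (L D : seq 'rV[R]_d) (x v : 'rV[R]_d).

Definition thickening L (r : R) : set 'rV[R]_d :=
  [set x | exists2 p, p \in L & `|x - p| <= r].

Lemma closed_thickening L r : closed (thickening L r).
Proof.
have -> : thickening L r = \big[setU/set0]_(p <- L) [set x | `|x - p| <= r].
  apply/seteqP; split => [x [p pL xp]|x].
    by rewrite -bigcup_seq; exists p.
  by rewrite -bigcup_seq => -[p pL xp]; exists p.
apply: closed_bigsetU => p _.
have -> : [set x : 'rV[R]_d | `|x - p| <= r] =
    (fun x : 'rV[R]_d => `|x - p|) @^-1` [set y | y <= r] by [].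
apply: closed_comp; last exact: closed_le.
move=> x _; apply: continuous_comp; last exact: norm_continuous.
by apply: continuousB => //; exact: cst_continuous.
Qed.

Lemma avg_indic0 L (A : set 'rV[R]_d) : (forall x, x \in L -> ~ A x) ->
  avg L (\1_A : borel_space R d -> R) = 0.
Proof.
move=> LA; rewrite /avg big_seq big1 ?mul0r// => x xL.
by rewrite indicE memNset//; exact: LA.
Qed.

(** Arbitrarily small scales suffice, not all of them: the construction controls the covering number
    only at the scales of its stages. *)
Definition covered_by (A : set 'rV[R]_d) (beta : R) :=
  forall n0, exists2 n, (n0 <= n)%N & exists l : seq 'rV[R]_d,
     (size l)%:R <= 2 `^ (n%:R * beta) /\
     forall x, A x -> exists2 p, p \in l & `|x - p| <= 2 * 2^-1 ^+ n.

Lemma powR2_unbounded (e B : R) : 0 < e ->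
  exists N, forall n, (N <= n)%N -> B <= 2 `^ (e * n%:R).
Proof.
move=> e0; have l2 : 0 < ln 2 :> R by rewrite ln_gt0// ltr1n.
have el0 : 0 < e * ln 2 by rewrite mulr_gt0.
exists (Num.truncn (B / (e * ln 2))).+1 => n Nn.
have h : B <= n%:R * (e * ln 2).
  rewrite -ler_pdivrMr//; apply: le_trans (ltW (truncnS_gt _)) _.
  by rewrite ler_nat.
apply: le_trans h _; apply: (@le_trans _ _ (1 + n%:R * (e * ln 2))).
  by rewrite lerDr.
have -> : 2 `^ (e * n%:R) = expR (n%:R * (e * ln 2)) :> R.
  by rewrite /powR pnatr_eq0/=; congr expR; ring.
exact: expR_ge1Dx.
Qed.

(** The gap between beta' and beta pays for the previous points: the next scale n' is so fine that
    their number is at most 2^(n' (beta - beta')), and the sumset still has at most 2^(n' beta)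
    points. *)
Lemma salem_set (s beta : R) v : 0 < s < beta -> exists T : set 'rV[R]_d,
  [/\ compact T, forall x, T x -> `|x - v| <= 2,
      exists mu, decay_measure T s mu & covered_by T beta].
Proof.
move=> /andP[s0 sb].
pose beta' := (s + beta) / 2.
have sb' : s < beta' by rewrite /beta'; lra.
have bb' : beta' < beta by rewrite /beta'; lra.
(* The midpoint of 1 and beta' / s, so that 1 < gam and gam s < beta'. *)
pose gam := (1 + beta' / s) / 2.
have h1 : 1 < beta' / s by rewrite ltr_pdivlMr// mul1r.
have g1 : 1 < gam by rewrite /gam; lra.
have g0 : 0 < gam by apply: lt_trans g1.
have gs : gam * s < beta'.
  by rewrite /gam mulrAC mulrDl mul1r divfK ?gt_eqF//; lra.
have [C C0 stg] := @stage R d d0 s beta' gam s0 g1 gs.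
pose good (st st' : seq 'rV[R]_d * nat) := (0 < size st.1)%N ->
  [/\ (st.2 < st'.2)%N /\ (0 < size st'.1)%N, (size st'.1)%:R <= 2 `^ (st'.2%:R * beta),
      forall x, x \in st'.1 -> exists2 p, p \in st.1 & `|x - p| <= 2^-1 ^+ st.2,
      forall xi, 2 `^ (gam * st.2%:R) <= `|xi| <= 2 `^ (gam * st'.2%:R) ->
        wave_le st'.1 xi (C * `|xi| `^ (- (s / 2))) &
      forall xi B, wave_le st.1 xi B -> wave_le st'.1 xi B].
have next st : exists st', good st st'.
  (* An empty list never occurs; [good] demands nothing then, and the successor is arbitrary. *)
  case: st => L n; have [L0|L0] := posnP (size L).
    by exists ([::], 0%N) => /=; rewrite /good /= L0.
  have [n' nn' Ln'] : exists2 n', (n < n')%N & (size L)%:R <= 2 `^ (n'%:R * (beta - beta')) :> R.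
    have bb0 : 0 < beta - beta' by rewrite subr_gt0.
    have [N HN] := powR2_unbounded (size L)%:R bb0.
    exists (maxn N n.+1); first exact: leq_maxr.
    by rewrite mulrC; apply: HN; exact: leq_maxl.
  have [D [D0 Ds Dn Dxi]] := stg n n'.
  exists (sumset L D, n') => _ /=; split => //.
  - by rewrite size_sumset muln_gt0 L0.
  - rewrite size_sumset natrM.
    apply: le_trans (ler_pM _ _ Ln' Ds) _ => //.
    rewrite -powRD ?pnatr_eq0 ?implybT// le_eqVlt; apply/orP; left; apply/eqP.
    by congr (_ `^ _); lra.
  - move=> x /allpairsP[[p y] /= [pL yD ->]]; exists p => //.
    by rewrite addrC addKr; exact: Dn.
  - by move=> xi xin; apply: wave_le_sumsetr => // t; exact: Dxi.
  - by move=> xi B; exact: wave_le_sumsetl.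
have [st [st_0 st_S]] : exists st : nat -> seq 'rV[R]_d * nat,
    st 0%N = ([:: v], 0%N) /\ forall j, good (st j) (st j.+1).
  exists (fun j => iter j (fun st => sval (cid (next st))) ([:: v], 0%N)).
  by split => // j /=; case: cid.
have st0 j : (0 < size (st j).1)%N.
  by elim: j => [|j IH]; [rewrite st_0|have [[]] := st_S j IH].
have stP j := st_S j (st0 j).
have n_ge j : (j <= (st j).2)%N.
  by elim: j => // j IH; have [[h _] _ _ _ _] := stP j; exact: leq_ltn_trans IH h.
(* Twice the size of the next displacement: since scales increase strictly, 2 * 2^-n' + 2^-n <= 2 *
   2^-n and the thickenings are nested. *)
pose T_ j := thickening (st j).1 (2 * 2^-1 ^+ (st j).2).
have h0 k : 0 <= 2^-1 ^+ k :> R by rewrite exprn_ge0// invr_ge0.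
have T_S j : T_ j.+1 `<=` T_ j.
  move=> x [p' p'L xp']; have [[h _] _ /(_ _ p'L) [p pL pp'] _ _] := stP j.
  exists p => //; apply: le_trans (ler_distD p' _ _) _.
  have : 2^-1 ^+ (st j.+1).2 <= 2^-1 ^+ (st j).2.+1 :> R.
    by rewrite ler_wiXn2l ?invr_ge0// invf_le1 ?ler1n.
  by move: xp' pp'; rewrite [2^-1 ^+ (st j).2.+1]exprS; lra.
have T_le j k : (j <= k)%N -> T_ k `<=` T_ j.
  by move=> /subnK <-; elim: (k - j)%N => // i IH; exact: subset_trans (T_S _) IH.
have L_T j : forall x, x \in (st j).1 -> T_ j x.
  by move=> x xL; exists x => //; rewrite subrr normr0 mulr_ge0.
have T0v x : T_ 0%N x -> `|x - v| <= 2.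
  by rewrite /T_ st_0 => -[p]; rewrite inE => /eqP->; rewrite expr0 mulr1.
pose T := \bigcap_j T_ j.
exists T.
have cT : closed T by apply: closed_bigI => j _; exact: closed_thickening.
have Tv x : T x -> `|x - v| <= 2 by move=> Tx; apply: T0v; exact: Tx.
split => //.
- apply: bounded_closed_compact => //; exists (`|v| + 2); split; first exact: num_real.
  move=> M vM x Tx; apply: ltW; apply: le_lt_trans vM.
  rewrite -[x](subrK v); apply: le_trans (ler_normD _ _) _.
  by have := Tv x Tx; lra.
- have [U [UU sU]] := infinity_ultrafilter.
  pose E j : (borel_space R d -> R) -> R := avg (st j).1.
  have mE j : is_mean (E j) by exact: avg_mean.
  apply: (@limit_decay _ _ d0 E U UU mE _ T s (Num.max C 1)).
  + move=> e e0; exists (`|v| + 3); first by rewrite ltr_wpDl.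
    apply: sU; exists 0%N => // j _ /=; rewrite /E avg_indic0 ?ltW// => x xL.
    have := T0v x (T_le 0%N j (leq0n _) x (L_T _ _ xL)).
    move=> xv; apply/negP; rewrite -leNgt -[x](subrK v).
    by apply: le_trans (ler_normD _ _) _; lra.
  + by rewrite lt_max ltr01 orbT.
  + move=> x; rewrite -[~ T x]/((~` T) x) setC_bigcap => -[j _ Tjx].
    have /nbhs_ballP[r /= r0 rT] : nbhs x (~` T_ j).
      apply: open_nbhs_nbhs; split => //; apply: closed_openC.
      exact: closed_thickening.
    exists r => //; apply: sU; exists j => // k /= jk.
    apply: avg_indic0 => y yL /rT; apply; apply: T_le jk _ _; exact: L_T.
  + move=> xi t xi0; apply: sU.
    have xi0' : 0 < `|xi| by rewrite normr_gt0.
    (* The frequency windows start at 1; below it the trivial bound is enough, whence the constant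
       [Num.max C 1]. *)
    have [x1|x1] := ltP `|xi| 1.
      exists 0%N => // j _ /=; apply: le_trans (mean_wave_le1 _ _ (mE j)) _.
      have P1 : 1 <= `|xi| `^ (- (s / 2)).
        have {1}<- : (1 : R) `^ (- (s / 2)) = 1 by rewrite powR1.
        by rewrite powRN_le ?divr_ge0 ?ltW.
      by apply: le_trans P1 _; rewrite ler_peMl ?powR_ge0// le_max lexx orbT.
    (* The first window that reaches |xi| contains it, and later sumsets keep its bound. Earlier
       stages may violate it, but U ignores them. *)
    have ex : exists j, `|xi| <= 2 `^ (gam * (st j.+1).2%:R).
      have [N HN] := powR2_unbounded `|xi| g0; exists N; apply: HN.
      exact: leq_trans (n_ge N.+1).
    case: (ex_minnP ex) => j xj jmin.
    have xj' : 2 `^ (gam * (st j).2%:R) <= `|xi|.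
      case: j jmin xj => [|j] jmin xj; first by rewrite st_0 /= mulr0 powRr0.
      by rewrite leNgt; apply/negP => /ltW/jmin; rewrite ltnn.
    have W : wave_le (st j.+1).1 xi (C * `|xi| `^ (- (s / 2))).
      by have [_ _ _ H _] := stP j; apply: H; rewrite xj' xj.
    exists j.+1 => // k /= /subnK <-; apply: (@le_trans _ _ (C * `|xi| `^ (- (s / 2)))).
      move: t; rewrite -/(wave_le _ _ _); elim: (k - j.+1)%N => // i IH.
      by have [_ _ _ _ H] := stP (i + j.+1)%N; rewrite addSn; exact: H.
    by rewrite ler_wpM2r ?powR_ge0// le_max lexx.
- move=> n0; exists (st n0.+1).2; first exact: leq_trans (n_ge n0.+1).
  exists (st n0.+1).1; split; first by have [_ h _ _ _] := stP n0.
  by move=> x Tx; exact: (Tx n0.+1).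
Qed.

End salem_sets.

(** * Closure under the upper Fell topology and the upper bounds *)

Section trigonometric_weights.
Context {R : realType} {d : nat}.
Implicit Types (a xi x : 'rV[R]_d).

Definition trig_weight (l : seq 'rV[R]_d) : borel_space R d -> R :=
  fun x => \prod_(a <- l) cos (dotp a x).

Lemma bmeas_trig_weight l : bmeas (trig_weight l).
Proof. by apply: bmeas_prod => a; exact: bmeas_cos_dotp. Qed.

Lemma norm_trig_weight_le1 l x : `|trig_weight l x| <= 1.
Proof.
rewrite normr_prod; apply: prodr_ile1 => a _.
by rewrite normr_ge0 cos_max.
Qed.

(** By the product formula, multiplying by cos (a . x) averages the waves at xi + a and xi - a. *)
Lemma mean_trig_weight (E : (borel_space R d -> R) -> R) l xi (B : R) :
  is_mean E ->
  (forall xi', `|xi' - xi| <= \sum_(a <- l) `|a| -> forall t, E (wave xi' t) <= B) ->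
  forall t, E (fun x => trig_weight l x * wave xi t x) <= B.
Proof.
move=> mE; elim: l xi => [|a l IH] xi H t.
  rewrite (_ : (fun _ => _) = wave xi t); first by apply: H; rewrite subrr normr0 big_nil.
  by apply/funext => x; rewrite /trig_weight big_nil mul1r.
have b (e : 'rV[R]_d) : bmeas (fun x : borel_space R d => trig_weight l x * wave (xi + e) t x).
  by apply: bmeasM; [exact: bmeas_trig_weight|exact: bmeas_wave].
rewrite (_ : (fun _ => _) = (fun x : borel_space R d => 2^-1 * (trig_weight l x * wave (xi + a) t x +
    trig_weight l x * wave (xi - a) t x))); last first.
  apply/funext => x; rewrite /trig_weight big_cons /wave !dotpDl dotpNl !cosD !sinD cosN sinN.
  by set P := \prod_(_ <- _) _; field.
rewrite (meanZ mE); last exact: bmeasD.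
rewrite (meanD mE)//.
have h (e : 'rV[R]_d) : `|e| = `|a| -> E (fun x : borel_space R d => trig_weight l x * wave (xi + e) t x) <= B.
  move=> ea; apply: IH => xi' xx; apply: H; rewrite big_cons -ea.
  have -> : xi' - xi = e + (xi' - (xi + e)) by rewrite opprD addrCA [e + _]addrC subrK.
  by apply: le_trans (ler_normD _ _) _; rewrite lerD2l.
have := h a erefl; have := h (- a) (normrN _); lra.
Qed.

(** The resulting weight approximates the product over i of sin (h x_i) / (h x_i), while the
    frequencies have total length at most d h however large n is. *)
Definition weight_steps (h : R) n : seq 'rV[R]_d :=
  [seq (h / 2 ^+ j.+1) *: delta_mx 0 i | i <- enum 'I_d, j <- iota 0 n].

Lemma trig_weight_steps h n x :
  trig_weight (weight_steps h n) x = \prod_(i < d) cos_prod n (h * x 0 i).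
Proof.
rewrite /trig_weight /weight_steps big_allpairs_dep/= big_enum/=.
apply: eq_bigr => i _.
rewrite /cos_prod -(big_mkord xpredT (fun j => cos (h * x 0 i / 2 ^+ j.+1))) /index_iota subn0.
apply: eq_bigr => j _; congr cos; rewrite /dotp (bigD1 i)//= big1 ?addr0 => [|i' i'i].
  by rewrite !mxE !eqxx mulr1 mulrAC.
by rewrite !mxE (negbTE i'i) andbF mulr0 mul0r.
Qed.

Lemma sum_weight_steps h n : 0 <= h -> \sum_(a <- weight_steps h n) `|a| <= d%:R * h.
Proof.
move=> h0; rewrite /weight_steps big_allpairs_dep/= big_enum/=.
apply: (@le_trans _ _ (\sum_(i < d) h)); last by rewrite sumr_const card_ord mulr_natl.
apply: ler_sum => i _.
apply: (@le_trans _ _ (\sum_(j <- iota 0 n) h / 2 ^+ j.+1)).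
  apply: ler_sum => j _; have p0 : 0 <= h / 2 ^+ j.+1 by rewrite divr_ge0// exprn_ge0.
  apply: norm_le_coord => // i'; rewrite !mxE eqxx /=.
  by case: eqP => _; rewrite ?mulr1 ?mulr0 ?normr0// ger0_norm.
have -> : \sum_(j <- iota 0 n) h / 2 ^+ j.+1 = h - h / 2 ^+ n.
  elim: n => [|n' IH]; first by rewrite big_nil expr0; lra.
  rewrite -addn1 iotaD big_cat/= IH big_seq1 add0n addn1 !exprS.
  by field; rewrite expf_neq0.
by rewrite gerBl divr_ge0// exprn_ge0.
Qed.

Lemma cos_prodN n (t : R) : cos_prod n (- t) = cos_prod n t.
Proof. by apply: eq_bigr => j _; rewrite mulNr cosN. Qed.

(** By [cos_prodE] the product is sin t / (2^n sin (t / 2^n)), with numerator at least t / 2 and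
    denominator at most t. *)
Lemma cos_prod_ge_half n (t : R) : `|t| <= 1 -> 2^-1 <= cos_prod n t.
Proof.
wlog t0 : t / 0 <= t => [H|].
  have [/H//|/ltW t0] := leP 0 t.
  by rewrite -normrN -cos_prodN; apply: H; rewrite oppr_ge0.
rewrite (ger0_norm t0) => t1; move: t0; rewrite le_eqVlt => /predU1P[<-|t0].
  rewrite /cos_prod big1 ?invf_le1 ?ler1n// => j _.
  by rewrite mul0r cos0.
have n0 : 0 < 2 ^+ n :> R by rewrite exprn_gt0.
have n1 : 1 <= 2 ^+ n :> R by rewrite exprn_ege1// ler1n.
have u0 : 0 < t / 2 ^+ n by rewrite divr_gt0.
have u1 : t / 2 ^+ n <= 1 by rewrite ler_pdivrMr// mul1r (le_trans t1).
have s0 : 0 < sin (t / 2 ^+ n).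
  have : t / 2 ^+ n / 2 <= sin (t / 2 ^+ n) by apply: half_le_sin; rewrite (ltW u0) u1.
  lra.
have s1 : 2 ^+ n * sin (t / 2 ^+ n) <= t.
  by have := sin_le_id (ltW u0); rewrite ler_pdivlMr// [_ * 2 ^+ n]mulrC.
have s2 : t / 2 <= sin t by apply: half_le_sin; rewrite (ltW t0) t1.
have E := cos_prodE n t.
have m0 : 0 < 2 ^+ n * sin (t / 2 ^+ n) by rewrite mulr_gt0.
rewrite -(ler_pM2r m0) E; lra.
Qed.

Lemma weight_lower h n x : 0 < h -> h * `|x| <= 1 ->
  2^-1 ^+ d <= trig_weight (weight_steps h n) x.
Proof.
move=> h0 hx; rewrite trig_weight_steps.
have -> : 2^-1 ^+ d = \prod_(i < d) (2^-1 : R) by rewrite prodr_const card_ord.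
apply: ler_prod => i _; rewrite invr_ge0/=; apply/andP; split => //.
apply: cos_prod_ge_half; rewrite normrM (gtr0_norm h0).
by apply: le_trans hx; rewrite ler_pM2l// coord_le_norm.
Qed.

Lemma weight_upper h n x : (0 < d)%N -> 0 < h -> 0 < `|x| -> h * `|x| <= 2 ^+ n ->
  `|trig_weight (weight_steps h n) x| <= 2 / (h * `|x|).
Proof.
move=> d0 h0 x0 hx; have [i xi] := norm_eq_coord x d0.
rewrite trig_weight_steps (bigD1 i)//= normrM -[leRHS]mulr1 ler_pM//; last first.
  by rewrite normr_prod; apply: prodr_ile1 => j _; rewrite normr_ge0 cos_prod_le1.
have -> : h * `|x| = `|h * x 0 i| by rewrite normrM xi gtr0_norm.
by apply: cos_prod_le; rewrite normrM xi (gtr0_norm h0) mulr_gt0.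
Qed.

End trigonometric_weights.

Section closure_of_decay.
Context {R : realType} {d : nat}.
Hypothesis d0 : (0 < d)%N.

Lemma prob_tail (mu : probability (borel_space R d) R) (e : R) : 0 < e ->
  exists n, \int[mu]_x (\1_[set x : 'rV[R]_d | 2 ^+ n < `|x|] x : R) <= e.
Proof.
move=> e0; pose F n : set (borel_space R d) := [set x : 'rV[R]_d | 2 ^+ n < `|x|].
have mF n : measurable (F n) by exact: measurable_norm_gt.
have : mu (F n) @[n --> \oo] --> mu (\bigcap_n F n).
  apply: nonincreasing_cvg_mu => //.
  - by rewrite (le_lt_trans (probability_le1 _ _))// ltry.
  - exact: bigcapT_measurable.
  - move=> n m nm; apply/subsetPset => x /=; apply: le_lt_trans.
    by rewrite ler_eXn2l// ltr1n.
have -> : \bigcap_n F n = set0.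
  apply/seteqP; split => // x Fx.
  have [n xn] := powR2_unbounded `|(x : 'rV[R]_d)| (ltr01 : 0 < (1 : R)).
  have := xn n (leqnn n); rewrite mul1r powR_mulrn// leNgt => /negP; apply.
  exact: (Fx n).
rewrite measure0 => /fine_cvgP[_ /cvgrPdist_le/(_ e e0)[N _ /(_ N (leqnn N))/=]].
rewrite sub0r normrN => h; exists N; rewrite Rintegral_indic; last exact: mF.
exact: le_trans (ler_norm _) h.
Qed.

(** The reweighted means are tight, while the total weight stays above [kap] thanks to the ball of
    radius N. Zero mass of a ball is clearly kept, and decay is kept up to a constant. *)
Lemma closure_decay (mu : nat -> probability (borel_space R d) R) (A : set 'rV[R]_d)
    (s c : R) (N : nat) : 0 <= s -> 0 < c ->
  (forall k, decay (fun f => \int[mu k]_x f x) s c) ->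
  (forall k, 2^-1 <= \int[mu k]_x (\1_[set x : 'rV[R]_d | `|x| <= N%:R] x : R)) ->
  (forall x, ~ A x -> exists2 r : R, 0 < r &
     \forall k \near \oo, mu k (ball x r) = 0%E) ->
  exists nu, decay_measure A s nu.
Proof.
move=> s0 c0 dmu muN muA.
have [U [UU sU]] := infinity_ultrafilter.
(* So that h |x| <= 1 on the ball of radius N, where [weight_lower] applies. *)
pose h : R := N.+1%:R^-1.
have h0 : 0 < h by rewrite invr_gt0.
have h1 : h <= 1 by rewrite invf_le1// ler1n.
(* A finite product of cosines is small only up to radius about 2^n / h and comes back to size 1
   farther out. Hence n depends on k, so that almost no mass lies beyond 2^n. *)
have tl k : exists n, \int[mu k]_x (\1_[set x : 'rV[R]_d | 2 ^+ n < `|x|] x : R) <= k.+1%:R^-1.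
  by apply: prob_tail; rewrite invr_gt0.
pose n_ k := sval (cid (tl k)).
have nP k : \int[mu k]_x (\1_[set x : 'rV[R]_d | 2 ^+ (n_ k) < `|x|] x : R) <= k.+1%:R^-1.
  by rewrite /n_; case: cid.
(* Repeating the list squares the weight, which makes it nonnegative. *)
pose l k : seq 'rV[R]_d := weight_steps h (n_ k) ++ weight_steps h (n_ k).
pose W k := trig_weight (l k).
have WE k x : W k x = trig_weight (weight_steps h (n_ k)) x ^+ 2.
  by rewrite /W /l /trig_weight big_cat.
have W0 k x : 0 <= W k x by rewrite WE sqr_ge0.
have W1 k x : W k x <= 1.
  by rewrite -[leLHS]ger0_norm// norm_trig_weight_le1.
have bW k : bmeas (W k) by exact: bmeas_trig_weight.
have mP k := prob_mean (mu k).
pose kap : R := 4^-1 ^+ d / 2.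
have kap0 : 0 < kap by rewrite divr_gt0// exprn_gt0// invr_gt0.
pose w k := \int[mu k]_x W k x.
have mN : measurable ([set x : 'rV[R]_d | `|x| <= N%:R] : set (borel_space R d)).
  have -> : [set x : 'rV[R]_d | `|x| <= N%:R] = ~` [set x | N%:R < `|x|].
    by apply/seteqP; split => x /=; rewrite leNgt => /negP.
  by apply: borel_setC; exact: measurable_norm_gt.
have wk k : kap <= w k.
  apply: (@le_trans _ _ (4^-1 ^+ d * \int[mu k]_x (\1_[set x : 'rV[R]_d | `|x| <= N%:R] x : R))).
    by rewrite /kap ler_wpM2l// exprn_ge0// invr_ge0.
  rewrite -(meanZ (mP k)); last exact: bmeas_indic.
  apply: (mean_le (mP k)) => // [|x]; first by apply: bmeasZ; exact: bmeas_indic.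
  have [xN|xN] := leP `|(x : 'rV[R]_d)| N%:R; last first.
    by rewrite indicE memNset ?mulr0//= leNgt xN.
  rewrite indicE mem_set// mulr1 WE.
  have -> : 4^-1 ^+ d = (2^-1 ^+ d) ^+ 2 :> R.
    by rewrite -exprM mulnC exprM; congr (_ ^+ _); field.
  have low : 2^-1 ^+ d <= trig_weight (weight_steps h (n_ k)) x.
    apply: weight_lower => //; rewrite /h ler_pdivrMl// mulr1.
    by apply: le_trans xN _; rewrite ler_nat.
  have p0 : 0 <= 2^-1 ^+ d :> R by rewrite exprn_ge0// invr_ge0.
  by rewrite ler_pXn2r// nnegrE// (le_trans p0).
have w0 k : 0 < w k := lt_le_trans kap0 (wk k).
pose E k : (borel_space R d -> R) -> R := fun f => (w k)^-1 * \int[mu k]_x (W k x * f x).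
have mE k : is_mean (E k).
  split => [f g bf bg|a f bf|f g bf bg fg|].
  - rewrite /E -mulrDr; congr (_ * _); rewrite -(meanD (mP k)); last 2 first.
    + exact: bmeasM.
    + exact: bmeasM.
    by congr Rintegral; apply/funext => x; rewrite mulrDr.
  - rewrite /E mulrCA; congr (_ * _); rewrite -(meanZ (mP k)); last exact: bmeasM.
    by congr Rintegral; apply/funext => x; rewrite mulrCA.
  - rewrite /E ler_wpM2l ?invr_ge0 ?(ltW (w0 k))//.
    by apply: (mean_le (mP k)) => [||x]; [exact: bmeasM|exact: bmeasM|rewrite ler_wpM2l].
  - rewrite /E (_ : (fun x => W k x * 1) = W k) ?mulVf ?gt_eqF//.
    by apply/funext => x; rewrite mulr1.
have EB k f B : 0 <= B -> \int[mu k]_x (W k x * f x) <= B -> E k f <= kap^-1 * B.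
  move=> B0 H; apply: (@le_trans _ _ ((w k)^-1 * B)).
    by rewrite ler_wpM2l// invr_ge0 ltW.
  by rewrite ler_wpM2r// lef_pV2 ?posrE.
have d0r : 0 < d%:R :> R by rewrite ltr0n.
(* The shifts add up to at most 2 d, so for |xi| > 4 d the frequencies involved have norm at least
   |xi| / 2. The second term makes the bound trivial for |xi| <= 4 d. *)
pose C := kap^-1 * (c * 2 `^ (s / 2)) + (4 * d%:R) `^ (s / 2).
have c20 : 0 <= c * 2 `^ (s / 2) by rewrite mulr_ge0 ?powR_ge0 ?ltW.
apply: (@limit_decay _ _ d0 E U UU mE _ A s C).
(* Between [rho] and 2^(n_ k) the weight W is at most m^2 <= kap e / 2; the mass beyond is at most
   kap e / 2 for large k. Capping m at 1 gives m^2 <= m. *)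
- move=> e e0; pose m := Num.min 1 (kap * e / 2).
  have ke0 : 0 < kap * e / 2 by rewrite divr_gt0// mulr_gt0.
  have m0 : 0 < m by rewrite lt_min ltr01.
  have m1 : m <= 1 by rewrite ge_min lexx.
  have mke : m ^+ 2 <= kap * e / 2.
    apply: (@le_trans _ _ m); first by rewrite expr2 ler_piMl// ltW.
    by rewrite ge_min lexx orbT.
  pose rho := 2 / (h * m); have rho0 : 0 < rho by rewrite divr_gt0// mulr_gt0.
  exists rho => //.
  have near_small : \forall k \near \oo, k.+1%:R^-1 < kap * e / 2.
    exact: (near_infty_natSinv_lt (PosNum ke0)).
  apply: sU; apply: filterS near_small => k /= ksmall.
  have -> : e = kap^-1 * (kap * e) by rewrite mulrA mulVf ?mul1r// gt_eqF.
  apply: EB; first by rewrite mulr_ge0 ?ltW.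
  have mT r : measurable ([set x : 'rV[R]_d | r < `|x|] : set (borel_space R d)).
    exact: measurable_norm_gt.
  have bT r : bmeas (\1_[set x : 'rV[R]_d | r < `|x|] : borel_space R d -> R).
    exact: bmeas_indic.
  apply: (@le_trans _ _ (\int[mu k]_x (m ^+ 2 + \1_[set x : 'rV[R]_d | 2 ^+ (n_ k) < `|x|] x : R))).
    apply: (mean_le (mP k)) => [||x]; first exact: bmeasM.
      by apply: bmeasD => //; exact: bmeas_cst.
    have m20 : 0 <= m ^+ 2 by rewrite sqr_ge0.
    have [xr|xr] := leP `|(x : 'rV[R]_d)| rho.
      by rewrite [\1_[set y : 'rV[R]_d | rho < `|y|] x]indicE memNset ?mulr0 ?addr_ge0//= ltNge xr.
    rewrite [\1_[set y : 'rV[R]_d | rho < `|y|] x]indicE mem_set// mulr1.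
    have [xn|xn] := leP `|(x : 'rV[R]_d)| (2 ^+ n_ k); last first.
      by rewrite indicE mem_set// (le_trans (W1 k x))// lerDr.
    rewrite indicE memNset ?addr0; last by rewrite /= ltNge xn.
    have x0 : 0 < `|(x : 'rV[R]_d)| by apply: lt_trans xr.
    have hx : h * `|(x : 'rV[R]_d)| <= 2 ^+ n_ k.
      by apply: le_trans xn; rewrite ler_piMl.
    rewrite WE -real_normK ?num_real// ler_pXn2r ?nnegrE ?(ltW m0)//.
    apply: le_trans (weight_upper d0 h0 x0 hx) _.
    have hx0 : 0 < h * `|(x : 'rV[R]_d)| by rewrite mulr_gt0.
    rewrite ler_pdivrMr//; move: xr; rewrite /rho ltr_pdivrMr ?mulr_gt0//.
    have -> : m * (h * `|(x : 'rV[R]_d)|) = `|(x : 'rV[R]_d)| * (h * m) by ring.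
    by move/ltW.
  rewrite (meanD (mP k))//; last exact: bmeas_cst.
  rewrite (mean_cst (mP k)).
  apply: le_trans (lerD mke (le_trans (nP k) (ltW ksmall))) _.
  by lra.
- by rewrite /C ltr_wpDl ?mulr_ge0 ?invr_ge0 ?powR_gt0 ?mulr_gt0// ltW.
- move=> x /muA[r r0 [K _ HK]]; exists r => //; apply: sU; exists K => // k Kk /=.
  have mb := @measurable_ball R d x r.
  have bb := bmeas_indic mb : bmeas (\1_(ball x r) : borel_space R d -> R).
  apply/eqP; rewrite eq_le (mean_ge0 (mE k))// andbT.
  rewrite -[leRHS](mulr0 kap^-1); apply: EB => //.
  have <- : \int[mu k]_y (\1_(ball x r) y : R) = 0 by rewrite Rintegral_indic// HK.
  apply: (mean_le (mP k)) => // [|y]; first exact: bmeasM.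
  by rewrite ler_piMl.
- move=> xi t xi0; apply: (@filterE _ U) => k /=.
  have xi0' : 0 < `|xi| by rewrite normr_gt0.
  have [x1|x1] := leP `|xi| (4 * d%:R).
    apply: le_trans (mean_wave_le1 _ _ (mE k)) _.
    rewrite /C mulrDl; apply: (@le_trans _ _ (0 + (4 * d%:R) `^ (s / 2) * `|xi| `^ (- (s / 2)))); last first.
      apply: lerD => //; apply: mulr_ge0; last exact: powR_ge0.
      by apply: mulr_ge0 => //; rewrite invr_ge0 ltW.
    rewrite add0r.
    rewrite powRN ler_pdivlMr ?powR_gt0// mul1r.
    by rewrite ge0_ler_powR ?nnegrE ?divr_ge0 ?mulr_ge0// ltW.
  rewrite /C mulrDl; apply: (@le_trans _ _ (kap^-1 * (c * 2 `^ (s / 2)) * `|xi| `^ (- (s / 2)))); last first.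
    by rewrite lerDl mulr_ge0 ?powR_ge0.
  rewrite -mulrA; apply: EB; first by rewrite mulr_ge0 ?powR_ge0.
  apply: (mean_trig_weight (mP k)) => xi' xx t'.
  have x2 : `|xi| / 2 <= `|xi'|.
    have : \sum_(a <- l k) `|a| <= 2 * d%:R.
      rewrite /l big_cat/=; have := @sum_weight_steps R d h (n_ k) (ltW h0).
      have : d%:R * h <= d%:R by rewrite ler_piMr.
      lra.
    have := ler_distD xi' xi 0; rewrite !subr0 distrC; lra.
  have x20 : 0 < `|xi| / 2 by rewrite divr_gt0.
  have xi'0 : xi' != 0 by rewrite -normr_gt0; apply: lt_le_trans x2.
  apply: le_trans (dmu k xi' t' xi'0) _.
  rewrite -mulrA ler_wpM2l ?(ltW c0)//.
  apply: le_trans (powRN_le _ x20 x2) _; first by rewrite divr_ge0.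
  rewrite powRM ?invr_ge0 ?(ltW xi0')// mulrC ler_wpM2r ?powR_ge0//.
  have E2 : (2^-1 : R) `^ (- (s / 2)) = 2 `^ (s / 2).
    by rewrite -(powR_inv1 (ler0n R 2)) -powRrM mulN1r opprK.
  by rewrite E2.
Qed.

End closure_of_decay.

Lemma open_preimage_finI {X : topologicalType} {Y : Type} (f : X -> Y)
    (D : set (set Y)) (A : set Y) :
  (forall B, D B -> open (f @^-1` B)) -> finI_from D id A -> open (f @^-1` A).
Proof.
move=> fD [E ED <-]; rewrite preimage_bigcap openE => x fx.
apply: (@filter_bigI _ _ _ _ (nbhs x) (nbhs_filter x)) => B BE.
by apply: open_nbhs_nbhs; split; [apply: fD; exact/set_mem/ED|exact: fx].
Qed.

Section fell_topologies.
Context {R : realType} {d : nat}.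

Lemma fell_continuous (X : topologicalType) (f : X -> fell R d) :
  (forall K, compact K -> open (f @^-1` miss K)) ->
  (forall U, open U -> open (f @^-1` hit U)) -> continuous f.
Proof.
move=> fK fU; apply/continuousP => _ [D' D'D <-].
rewrite preimage_bigcup; apply: bigcup_open => A /D'D.
by apply: open_preimage_finI => _ [] [K hK <-]; [exact: fK|exact: fU].
Qed.

Lemma upper_fell_continuous (X : topologicalType) (f : X -> upper_fell R d) :
  (forall K, compact K -> open (f @^-1` miss K)) -> continuous f.
Proof.
move=> fK; apply/continuousP => _ [D' D'D <-].
rewrite preimage_bigcup; apply: bigcup_open => A /D'D.
by apply: open_preimage_finI => _ [K hK <-]; exact: fK.
Qed.

Lemma open_miss_fell (K : set 'rV[R]_d) : compact K -> open (miss K : set (fell R d)).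
Proof.
move=> cK; exists [set miss K]; last by rewrite bigcup_set1.
by move=> _ ->; apply: (@finI_from1 _ _ (@fell_subbase R d) id); left; exists K.
Qed.

Lemma open_miss_upper (K : set 'rV[R]_d) : compact K -> open (miss K : set (upper_fell R d)).
Proof.
move=> cK; exists [set miss K]; last by rewrite bigcup_set1.
by move=> _ ->; apply: (@finI_from1 _ _ (@upper_fell_subbase R d) id); exists K.
Qed.

Definition fell_to_upper (F : fell R d) : upper_fell R d := F.

Lemma fell_to_upper_continuous : continuous fell_to_upper.
Proof. by apply: upper_fell_continuous => K; exact: open_miss_fell. Qed.

End fell_topologies.

Section dimension_levels.
Context {R : realType} {d : nat}.
Hypothesis d0 : (0 < d)%N.

(** With q rational the parameters are countable. The case q <= 0 is separate because a set without
    any measure, such as the empty one, still has dimension 0. *)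
Definition dim_witness (q : R) (c N : nat) : set (upper_fell R d) :=
  [set A | q <= 0 \/ q <= d%:R /\
    exists mu : probability (borel_space R d) R,
      [/\ msupport mu `<=` A,
          decay (fun f => \int[mu]_x f x) q c.+1%:R &
          2^-1 <= \int[mu]_x (\1_[set x : borel_space R d |
                                 `|x : 'rV[R]_d| <= N%:R] x : R)]].

(** Compact pieces of the complement of a closed A: every point outside A has a neighbourhood
    contained in all but finitely many of them. *)
Definition far_part (A : set 'rV[R]_d) (k : nat) : set 'rV[R]_d :=
  [set x | `|x| <= k%:R] `\` \bigcup_(a in A) ball a k.+1%:R^-1.

Lemma closed_far_part A k : closed (far_part A k).
Proof.
rewrite /far_part setDE; apply: closedI; last first.
  by apply: open_closedC; apply: bigcup_open => a _; exact: ball_open.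
have -> : [set x : 'rV[R]_d | `|x| <= k%:R] =
    (fun x : 'rV[R]_d => `|x|) @^-1` [set y | y <= k%:R] by [].
apply: closed_comp; last exact: closed_le.
by move=> x _; exact: norm_continuous.
Qed.

Lemma compact_far_part A k : compact (far_part A k).
Proof.
apply: bounded_closed_compact; last exact: closed_far_part.
exists k%:R; split; first exact: num_real.
by move=> M kM x [/= xk _]; exact: le_trans xk (ltW kM).
Qed.

Lemma measurable_far_part A k : measurable (far_part A k : set (borel_space R d)).
Proof. by apply: measurable_closed; exact: closed_far_part. Qed.

(** The witness sets themselves are not shown to be closed; it suffices that their closures stay
    inside the dimension level. The neighbourhoods [miss (far_part A k)] of A supply the sequence of
    measures. *)
Lemma closure_dim_witness q c N (A : upper_fell R d) :
  closure (dim_witness q c N) A -> q <= fourier_dim A.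
Proof.
move=> clA.
have [q0|q0] := leP q 0; first exact: le_trans (fourier_dim_ge0 _).
have W k : exists B : upper_fell R d, dim_witness q c N B /\ B `&` far_part A k = set0.
  apply: (clA (miss (far_part A k))).
  apply: (@open_nbhs_nbhs (upper_fell R d)); split.
    by apply: open_miss_upper; exact: compact_far_part.
  rewrite /miss /= -subset0 => x [Ax [_]]; apply; exists x => //.
  exact: ballxx.
have qd : q <= d%:R.
  by have [B [[/le_lt_trans/(_ q0)|[]//]]] := W 0; rewrite ltxx.
have {}W k : exists mu : probability (borel_space R d) R,
    [/\ decay (fun f => \int[mu]_x f x) q c.+1%:R,
        2^-1 <= \int[mu]_x (\1_[set x : borel_space R d |
                                 `|x : 'rV[R]_d| <= N%:R] x : R) &
        mu (far_part A k) = 0%E].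
  have [B [[q1|[_ [mu [sB dm mN]]]] AB]] := W k.
    by move: (le_lt_trans q1 q0); rewrite ltxx.
  exists mu; split=> //; apply/eqP; rewrite eq_le measure_ge0 andbT.
  have cB : closed (B : set 'rV[R]_d) by exact: closed_carrier.
  rewrite -(msupport_sub cB sB); apply: le_measure; rewrite ?inE.
  - exact: measurable_far_part.
  - by apply: measurable_open; apply: closed_openC.
  - by move=> x Lx Bx; have : (B `&` far_part A k) x by []; rewrite AB.
have [mu Hmu] := choice W.
have [||k|k|x Ax|nu nuA] := @closure_decay _ _ d0 mu A q c.+1%:R N.
- exact: ltW.
- by [].
- by have [] := Hmu k.
- by have [] := Hmu k.
- have : nbhs x (~` (A : set 'rV[R]_d)).
    apply: open_nbhs_nbhs; split=> //; apply: closed_openC; exact: closed_carrier.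
  move=> /nbhs_ballP Ax'.
  have {Ax'}[r [r0 rA]] : exists r : R, 0 < r /\ ball x r `<=` ~` (A : set 'rV[R]_d).
    by have [r r0 rA] := Ax'; exists r; split.
  have r2 : r / 2 <= r by rewrite ler_pdivrMr// ler_peMr// ?ler1n// ltW.
  (* A point within r / 2 of x is at distance at least r / 2 from A, so it lies in [far_part A k]
     once k >= |x| + r and 1 / (k + 1) <= r / 2. *)
  exists (r / 2); first by rewrite divr_gt0.
  near=> k.
  have [_ _ mk] := Hmu k.
  apply/eqP; rewrite eq_le measure_ge0 andbT -mk; apply: le_measure; rewrite ?inE.
  + exact: measurable_ball.
  + exact: measurable_far_part.
  + move=> y0; move: (y0 : 'rV[R]_d) => {y0}y; rewrite ball_normE => xy.
    clear mk W; split=> /=.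
      have kx : `|x| + r <= k%:R by near: k; exact: nbhs_infty_ger.
      have xyx := ler_normB x (x - y); rewrite subKr in xyx.
      apply: (le_trans xyx); apply: le_trans kx; rewrite lerD2l.
      exact: le_trans (ltW xy) r2.
    move=> [a Aa]; rewrite ball_normE => ay.
    apply: (rA a) => //; rewrite ball_normE.
    have kr : (r / 2)^-1 <= k%:R by near: k; exact: nbhs_infty_ger.
    have kr2 : k.+1%:R^-1 <= r / 2.
      rewrite -[leRHS]invrK lef_pV2 ?posrE ?invr_gt0 ?divr_gt0 //.
      by apply: (le_trans kr); rewrite ler_nat.
    apply: le_lt_trans (ler_distD y x a) _; rewrite (distrC y a) [ltRHS]splitr.
    by apply: ltrD => //; exact: lt_le_trans ay kr2.
apply: (fourier_dim_ge _ nuA); by rewrite (ltW q0).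
Unshelve. all: by end_near.
Qed.

Lemma dim_gt_witness (A : upper_fell R d) (b : R) : b < fourier_dim A ->
  exists q c N, [/\ b < ratr q & dim_witness (ratr q) c N A].
Proof.
move=> bA; have [b0|b0] := ltP b 0.
  by exists 0, 0%N, 0%N; split; [rewrite rmorph0|left; rewrite rmorph0].
have [s [mu [/andP[bs sd] [sA [c [c0 dm]]]]]] := fourier_dim_gt b0 bA.
have [q /andP[bq qs]] := rat_in_itvoo bs.
have [n mun] := prob_tail mu (ltac:(by rewrite invr_gt0 ltr0n) : 0 < 2^-1 :> R).
(* As [dim_witness] takes the successor, the constant exceeds the [Num.max c 1] of [decay_weaken] in
   spite of rounding down. *)
exists q, (Num.truncn (Num.max c 1)), (2 ^ n)%N; split=> //; right; split.
  exact: le_trans (ltW qs) sd.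
have mE := prob_mean mu.
have q0 : 0 <= (ratr q : R) <= s by apply/andP; split; [exact: le_trans b0 (ltW bq)|exact: ltW].
exists mu; split=> //.
  move=> xi t xi0; apply: le_trans (decay_weaken mE q0 dm t xi0) _.
  by rewrite ler_wpM2r ?powR_ge0// ltW// truncnS_gt.
pose B : set (borel_space R d) := [set x | 2 ^+ n < `|x : 'rV[R]_d|].
have mB : measurable B by exact: measurable_norm_gt.
have -> : [set x : borel_space R d | `|x : 'rV[R]_d| <= (2 ^ n)%:R] = ~` B.
  by apply/seteqP; split=> x /=; rewrite natrX leNgt => /negP.
have := mun; rewrite -[X in X <= _]/(\int[mu]_x (\1_B x : R)).
rewrite !Rintegral_indic//; last exact: measurableC.
rewrite probability_setC// fineB//; last exact: fin_num_measure.
rewrite /=; lra.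
Qed.

Section pullbacks.
Context {Y : topologicalType} {F : Y -> upper_fell R d} {g : Y -> R}.
Hypotheses (cF : continuous F) (cg : continuous g).

(** Stated for continuous F and g on any space, so as to serve both the product space and a fixed
    threshold on the Fell space. Replacing g y < q by g y <= q - 1 / (k + 1) makes the pieces
    closed. *)
Lemma sigma2_dim_gt : Sigma0 2 [set y | g y < fourier_dim (F y)].
Proof.
pose Z (w : rat * nat * nat * nat) : set Y := let: (q, k, c, N) := w in
  [set y | g y <= ratr q - k.+1%:R^-1] `&` F @^-1` closure (dim_witness (ratr q) c N).
pose G n : set Y := if unpickle n is Some w then Z w else set0.
have GZ w : G (pickle w) = Z w by rewrite /G pickleK.
have -> : [set y | g y < fourier_dim (F y)] = \bigcup_n G n.
  apply/seteqP; split=> y /=.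
    move=> /dim_gt_witness[q [c [N [gq W]]]].
    have [k] := ltr_add_invr gq; rewrite -ltrBrDr => kq.
    have : Z (q, k, c, N) y by split; [exact: ltW|exact: subset_closure].
    by rewrite -(GZ (q, k, c, N)); move: (pickle _) => n Gy; exists n.
  move=> [n _]; rewrite /G; case: unpickle => // -[[[q k] c] N] /= [gq Fq].
  apply: lt_le_trans (closure_dim_witness Fq); apply: (le_lt_trans gq).
  by rewrite ltrBlDr ltrDl invr_gt0.
apply: (@Sigma0_bigcup _ _ (fun=> 1%N)) => // n; apply: Sigma0_open => //.
apply: closed_openC; rewrite /G; case: unpickle => [[[[q k] c] N]|]; last exact: closed0.
apply: closedI.
  have -> : [set y | g y <= ratr q - k.+1%:R^-1] = g @^-1` [set z | z <= ratr q - k.+1%:R^-1] by [].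
  by apply: closed_comp; [move=> x _; exact: cg|exact: closed_le].
by apply: closed_comp; [move=> x _; exact: cF|exact: closed_closure].
Qed.

End pullbacks.

Lemma pi3_dim_ge {Y : topologicalType} {F : Y -> upper_fell R d} {g : Y -> R} :
  continuous F -> continuous g -> Pi0 3 [set y | g y <= fourier_dim (F y)].
Proof.
move=> cF cg; rewrite /Pi0.
pose G k := [set y | fourier_dim (F y) <= g y - k.+1%:R^-1].
have -> : ~` [set y | g y <= fourier_dim (F y)] = \bigcup_k G k.
  apply/seteqP; split=> y /=.
    move=> /negP; rewrite -ltNge => /ltr_add_invr[k]; rewrite -ltrBrDr => /ltW.
    by exists k.
  move=> [k _ /= yk]; apply/negP; rewrite -ltNge; apply: (le_lt_trans yk).
  by rewrite ltrBlDr ltrDl invr_gt0.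
apply: (@Sigma0_bigcup _ _ (fun=> 2%N)) => // k.
have -> : ~` G k = [set y | g y - k.+1%:R^-1 < fourier_dim (F y)].
  by apply/seteqP; split=> y /=; rewrite ltNge => /negP.
apply: sigma2_dim_gt => // y; apply: cvgB; [exact: cg|exact: cvg_cst].
Qed.

End dimension_levels.

(** * Hardness *)

Lemma Sigma0_open_inv (X : topologicalType) (A : set X) : Sigma0 1 A -> open A.
Proof. by move=> S; inversion S. Qed.

Lemma Sigma0_0 (X : topologicalType) (A : set X) : ~ Sigma0 0 A.
Proof. by move=> S; inversion S. Qed.

Lemma near_all_ltn {T : Type} (G : set_system T) {FG : Filter G}
    (Q : nat -> T -> Prop) n :
  (forall i, (i < n)%N -> \forall y \near G, Q i y) ->
  \forall y \near G, forall i, (i < n)%N -> Q i y.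
Proof.
elim: n => [_|n IHn GQ]; first by near=> y.
have G1 := GQ n (ltnSn n); have G2 := IHn (fun i lin => GQ i (ltnW lin)).
near=> y => i; rewrite ltnS leq_eqVlt => /orP[/eqP->|]; first by near: y.
by move: i; near: y.
Unshelve. all: by end_near.
Qed.

Section zero_dimensional.
Context {R : realType} {X : topologicalType}.
Hypotheses (pX : polish R X) (bX : has_clopen_basis X).

(** A Lindelof argument: for every dense point and radius 1 / (k + 1), keep one clopen subset of U
    containing that ball, if there is any. *)
Lemma open_bigcup_clopen (U : set X) : open U ->
  exists2 V : nat -> set X, (forall n, clopen (V n)) & U = \bigcup_n V n.
Proof.
move=> oU; have [[dist mdist] [D cD dD]] := pX; have [B Bclopen [_ Bbasis]] := bX.
have /countable_injP[f finj] := cD.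
pose good n k V := [/\ clopen V, V `<=` U & exists2 z, D z & f z = n /\
  [set y | dist z y < k.+1%:R^-1] `<=` V].
have W (i : nat * nat) : exists V, [/\ clopen V, V `<=` U &
    forall V', good i.1 i.2 V' -> good i.1 i.2 V].
  have [[V gV]|nV] := pselect (exists V, good i.1 i.2 V).
    by exists V; split=> //; case: gV.
  exists set0; split=> //; first by split; [exact: open0|exact: closed0].
  by move=> V' gV'; case: nV; exists V'.
have [V HV] := choice W.
pose G n := if unpickle n is Some i then V i else set0.
exists G.
  move=> n; rewrite /G; case: unpickle => [i|]; first by have [] := HV i.
  by split; [exact: open0|exact: closed0].
apply/seteqP; split=> x; last first.
  by move=> [n _]; rewrite /G; case: unpickle => // i Vx; have [_ VU _] := HV i; exact: VU.
move=> Ux; have [C [BC Cx] CU] := Bbasis x U (open_nbhs_nbhs (conj oU Ux)).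
have /(dist_nbhs mdist) [e e0 eC] : nbhs x C.
  by apply: open_nbhs_nbhs; split => //; have [] := Bclopen C BC.
have [k ke] : exists k : nat, k.+1%:R^-1 < e / 2.
  have : 0 < e / 2 by rewrite divr_gt0.
  by move=> /ltr_add_invr[k]; rewrite add0r; exists k.
have [z [xz Dz]] : [set y | dist x y < k.+1%:R^-1]^° `&` D !=set0.
  apply: dD; last exact: open_interior.
  by exists x; apply/(dist_nbhs mdist); exists k.+1%:R^-1.
have {}xz : dist x z < k.+1%:R^-1 by exact: (interior_subset xz).
have gC : good (f z) k C.
  split; [exact: Bclopen|exact: CU|exists z => //; split=> //].
  move=> y zy; apply: eC => /=; apply: le_lt_trans (dist_triangle mdist z x y) _.
  by rewrite [ltRHS]splitr; apply: ltrD; apply: lt_trans ke.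
have [_ _ /(_ C gC)[_ _ [z' Dz' [ff zW]]]] := HV (f z, k).
have zz : z' = z by apply: finj; rewrite ?inE.
have : V (f z, k) x by apply: zW; rewrite /= zz (dist_sym mdist).
have -> : V (f z, k) = G (pickle (f z, k)) by rewrite /G pickleK.
by move: (pickle _) => n Gn; exists n.
Qed.

Lemma sigma2_bigcup_closed (A : set X) : Sigma0 2 A ->
  exists2 F : nat -> set X, (forall n, closed (F n)) & A = \bigcup_n F n.
Proof.
move=> S; inversion S as [A' n1|m F _ m2 SF AE]; first by [].
exists F => // n; move: (m2 n) (SF n); case: (m n) => [|[|//]] _ SFn.
  by case: (Sigma0_0 SFn).
by rewrite -openC; exact: Sigma0_open_inv.
Qed.

(** The countable union defining a level 3 set may contain pieces of level 1, which have to be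
    raised to level 2. *)
Lemma open_sigma2 (U : set X) : open U -> Sigma0 2 U.
Proof.
move=> /open_bigcup_clopen[V cV ->]; apply: (@Sigma0_bigcup _ _ (fun=> 1%N)) => // n.
by apply: Sigma0_open => //; apply: closed_openC; have [] := cV n.
Qed.

Lemma pi3_bigcap_bigcup (A : set X) : Pi0 3 A ->
  exists2 F : nat -> nat -> set X, (forall n m, closed (F n m)) &
    A = \bigcap_n \bigcup_m F n m.
Proof.
rewrite /Pi0 => S; inversion S as [A' n1|m G _ m3 SG AE]; first by [].
have W n : exists F : nat -> set X, (forall k, closed (F k)) /\ ~` G n = \bigcup_k F k.
  have : Sigma0 2 (~` G n).
    move: (m3 n) (SG n); case: (m n) => [|[|[|//]]] _ SGn //.
      by case: (Sigma0_0 SGn).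
    exact/open_sigma2/Sigma0_open_inv.
  by move=> /sigma2_bigcup_closed[F cF FE]; exists F.
have [F HF] := choice W.
exists F; first by move=> n k; have [cF _] := HF n.
rewrite -[A]setCK -AE setC_bigcup; apply: eq_bigcapr => n _.
by have [_] := HF n.
Qed.

(* Fix a covering of [~` F] by a sequence of clopen sets: off [F], [h] is the
   first index of a member containing the point. *)
Lemma closed_depth (F : set X) : closed F -> exists h : X -> nat,
  (forall x, ~ F x -> \forall y \near x, ~ F y /\ h y = h x) /\
  (forall x, F x -> forall n, \forall y \near x, ~ F y -> (n <= h y)%N).
Proof.
move=> cF; have [V cV FV] := open_bigcup_clopen (closed_openC cF).
have W x : exists n, ~ F x -> V n x /\ forall j, (j < n)%N -> ~ V j x.
  have [Fx|nFx] := pselect (F x); first by exists 0%N.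
  have exV : exists n, `[< V n x >].
    have : (~` F) x by []. by rewrite FV => -[n _ Vx]; exists n; apply/asboolP.
  exists (ex_minn exV) => _; case: ex_minnP => n /asboolP Vn nmin; split=> // j jn Vj.
  by have := nmin j (asboolT Vj); rewrite leqNgt jn.
have [h Hh] := choice W; exists h.
have nearV n x : V n x -> \forall y \near x, V n y.
  by move=> Vx; apply: open_nbhs_nbhs; split=> //; have [] := cV n.
have nearnV n x : (forall j, (j < n)%N -> ~ V j x) ->
    \forall y \near x, forall j, (j < n)%N -> ~ V j y.
  move=> nV; apply: near_all_ltn => j jn; apply: open_nbhs_nbhs; split; last exact: nV.
  by apply: closed_openC; have [] := cV j.
split=> [x nFx|x Fx n].
  have [Vx nVx] := Hh x nFx.
  have N1 := nearV _ _ Vx; have N2 := nearnV _ _ nVx.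
  have N3 : \forall y \near x, ~ F y.
    by apply: open_nbhs_nbhs; split => //; exact: closed_openC.
  apply: filterS3 N1 N2 N3 => y Vxy nVxy nFy; split=> //.
  have [Vy nVy] := Hh y nFy.
  apply/eqP; rewrite eqn_leq; apply/andP; split; rewrite leqNgt; apply/negP.
    exact: (fun lt => nVy _ lt Vxy).
  exact: (fun lt => nVxy _ lt Vy).
have N2 : \forall y \near x, forall j, (j < n)%N -> ~ V j y.
  apply: nearnV => j _ Vx; have : (\bigcup_n V n) x by exists j.
  by rewrite -FV.
apply: filterS N2 => y nVy nFy; have [Vy _] := Hh y nFy.
by rewrite leqNgt; apply/negP; exact: (fun lt => nVy _ lt Vy).
Qed.

End zero_dimensional.

Lemma hausdorff_rV {R : realType} {d : nat} : hausdorff_space 'rV[R]_d.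
Proof. exact: norm_hausdorff. Qed.

Lemma dense_sequence {R : realType} {d : nat} (T : set 'rV[R]_d) : T !=set0 ->
  exists e : nat -> 'rV[R]_d, (forall n, T (e n)) /\
    forall U, open U -> T `&` U !=set0 -> exists n, U (e n).
Proof.
move=> [t Tt].
have W n : exists x, T x /\ (T `&` rat_ball n !=set0 -> rat_ball n x).
  have [[x [Tx bx]]|nb] := pselect (T `&` @rat_ball R d n !=set0).
    by exists x.
  by exists t; split.
have [e He] := choice W; exists e; split; first by move=> n; have [] := He n.
move=> U oU [x [Tx Ux]]; have [i [ix iU]] := rat_ball_basis oU Ux.
by exists i; apply: iU; have [_] := He i; apply; exists x.
Qed.

Section blocks.
Context {R : realType} {d : nat} {X : topologicalType}.
Hypotheses (pX : polish R X) (bX : has_clopen_basis X).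
Context {T : nat -> set 'rV[R]_d} {F : nat -> set X}.
Hypotheses (cT : forall i, compact (T i)) (T0 : forall i, T i !=set0).
Hypothesis T_far : forall M : R, exists n, forall i z, (n <= i)%N -> T i z -> M < `|z|.
Hypothesis cF : forall i, closed (F i).

(** Off [F i] the block is locally constant. Near a point of [F i] it stays inside [T i], so a
    missed compact set remains missed, and it contains any prescribed [e i j], so an open set that
    is hit remains hit. Only finitely many blocks meet a bounded set. *)
Lemma fell_reduction : exists (Phi : X -> fell R d) (e : nat -> nat -> 'rV[R]_d),
  [/\ continuous Phi, forall i x, F i x -> T i `<=` Phi x &
      forall x z, fell_set (Phi x) z -> (exists2 i, F i x & T i z) \/ exists i j, z = e i j].
Proof.
have [e He] := choice (fun i => dense_sequence (T0 i)).
have [h Hh] := choice (fun i => closed_depth pX bX (@cF i)).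
pose P i x : set 'rV[R]_d := [set z | (F i x /\ T i z) \/
  exists2 j, (j <= h i x)%N & ~ F i x /\ z = e i j].
have PT i x : P i x `<=` T i.
  by move=> z [[]//|[j _ [_ ->]]]; have [] := He i.
have PF i x : F i x -> P i x = T i.
  move=> Fx; apply/seteqP; split; first exact: PT.
  by move=> z Tz; left.
have Pnear i x : ~ F i x -> \forall y \near x, P i y = P i x.
  move=> nFx; have [H _] := Hh i; apply: filterS (H x nFx) => y [nFy hy].
  by apply/seteqP; split=> z [[]//|[j jh [_ ze]]]; right; exists j => //;
    rewrite -?hy// hy.
have Pclosed i x : closed (P i x).
  have [Fx|nFx] := pselect (F i x).
    rewrite PF//; apply: compact_closed; [exact: hausdorff_rV|exact: cT].
  have -> : P i x = \bigcup_(j in `I_(h i x).+1) [set e i j].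
    apply/seteqP; split=> z; first by move=> [[]//|[j jh [_ ->]]]; exists j.
    by move=> [j jh ->]; right; exists j.
  rewrite bigcup_mkord; apply: closed_bigsetU => j _.
  exact: (accessible_closed_set1 (hausdorff_accessible (@hausdorff_rV R d))).
pose Q x := \bigcup_i P i x.
have Qclosed x : closed (Q x).
  rewrite -openC openE => z nQz.
  (* Blocks from n on avoid the unit ball around z, so near z the union is finite. *)
  have [n nfar] := T_far (`|z| + 1).
  have N1 : \forall y \near z, forall i, (i < n)%N -> ~ P i x y.
    apply: (@near_all_ltn _ (nbhs z) (nbhs_filter z)) => i _; apply: open_nbhs_nbhs; split.
      by apply: closed_openC; exact: Pclosed.
    by move=> Pz; apply: nQz; exists i.
  have N2 : \forall y \near z, ball z 1 y by apply: nbhsx_ballx.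
  apply: filterS2 N1 N2 => y nPy zy [i _ Py].
  have [lin|nli] := ltnP i n; first exact: nPy lin Py.
  have := nfar i y nli (PT _ _ _ Py); rewrite ltNge => /negP; apply.
  move: zy; rewrite ball_normE distrC => /ltW zy.
  rewrite -[y](subrK z) addrC; apply: le_trans (ler_normD _ _) _.
  by rewrite lerD2l.
pose Phi x : fell R d := ClosedSet (Qclosed x).
exists Phi, e; split.
- apply: fell_continuous => [K cK|U oU].
    rewrite openE => x Kx.
    have [M KM] : exists M, forall z, K z -> `|z| <= M.
      have [M [_ KM]] := compact_bounded cK.
      by exists (M + 1) => z Kz; apply: KM => //; rewrite ltrDl.
    have [n nfar] := T_far M.
    have PK i : P i x `&` K = set0.
      rewrite -subset0 => z [Pz Kz]; have : (Phi x `&` K) z by split=> //; exists i.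
      by rewrite Kx.
    have N1 : \forall y \near x, forall i, (i < n)%N -> P i y `&` K = set0.
      apply: (@near_all_ltn _ (nbhs x) (nbhs_filter x)) => i _; have [Fx|nFx] := pselect (F i x).
        near=> y; rewrite -subset0 => z [Pz Kz].
        by rewrite -(PK i) PF//; split => //; exact: PT Pz.
      by apply: filterS (Pnear i x nFx) => y ->.
    apply: filterS N1 => y nP; rewrite /miss /= -subset0 => z [[i _ Pz] Kz].
    have [lin|nli] := ltnP i n; first by rewrite -(nP i lin).
    have := nfar i z nli (PT _ _ _ Pz); rewrite ltNge => /negP; apply; exact: KM.
  rewrite openE => x [z [[i _ Pz] Uz]].
  have [Fx|nFx] := pselect (F i x).
    have [eT] := He i; move=> /(_ U oU); case; first by exists z; rewrite -(PF i x).
    move=> j Uj; have [_ /(_ x Fx j) N] := Hh i.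
    apply: filterS N => y jy; exists (e i j); split=> //; exists i => //.
    by have [Fy|nFy] := pselect (F i y); [left|right; exists j => //; exact: jy].
  apply: filterS (Pnear i x nFx) => y Py; exists z; split=> //.
  by exists i => //; rewrite Py.
- by move=> i x Fx z Tz; exists i => //; left.
- move=> x z [i _ [[Fx Tz]|[j _ [_ ->]]]]; first by left; exists i.
  by right; exists i, j.
Unshelve. all: by end_near.
Qed.

End blocks.

Section dimension_bounds.
Context {R : realType} {d : nat}.
Hypothesis d0 : (0 < d)%N.

Lemma covered_by_weaken (A : set 'rV[R]_d) b b' :
  b <= b' -> covered_by A b -> covered_by A b'.
Proof.
move=> bb cA n0; have [n n0n [l [ln lA]]] := cA n0; exists n => //; exists l; split=> //.
apply: (le_trans ln); rewrite ler_powR// ?ler1n//.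
by rewrite ler_wpM2l.
Qed.

Lemma covered_by_set0 b : covered_by (set0 : set 'rV[R]_d) b.
Proof.
by move=> n0; exists n0 => //; exists [::]; split=> //=; exact: powR_ge0.
Qed.

Lemma covered_by_set1 (p : 'rV[R]_d) b : 0 <= b -> covered_by [set p] b.
Proof.
move=> b0 n0; exists n0 => //; exists [:: p]; split=> /=.
  by rewrite -[leLHS](powRr0 2) ler_powR ?ler1n// mulr_ge0.
by move=> x ->; exists p; rewrite ?mem_head// subrr normr0 mulr_ge0// exprn_ge0.
Qed.

Lemma fourier_dim_le_cover (A : set 'rV[R]_d) (S : nat -> set 'rV[R]_d) b :
  closed A -> 0 <= b -> (forall i, closed (S i)) ->
  (forall i, covered_by (S i) b) -> A `<=` \bigcup_i S i -> fourier_dim A <= b.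
Proof.
move=> cA b0 cS Sb AS; apply: fourier_dim_le => // s mu /andP[bs sd] [sA [c [c0 dm]]].
have mE := prob_mean mu.
(* [null_of_cover] needs an exponent strictly below d, whereas s may equal d. *)
pose s' := (b + s) / 2.
have bs' : b < s' by rewrite /s'; lra.
have ss' : s' < s by rewrite /s'; lra.
have s0 : 0 < s' by exact: le_lt_trans b0 bs'.
have dm' : decay (fun f => \int[mu]_x f x) s' (Num.max c 1).
  apply: decay_weaken dm => //; apply/andP; split; exact: ltW.
have mS i : measurable (S i : set (borel_space R d)) by exact: measurable_closed.
have S0 i : mu (S i) = 0%E.
  have : \int[mu]_x (\1_(S i : set (borel_space R d)) x : R) = 0.
    apply: (null_of_cover d0 mE dm' _ s0 (lt_le_trans ss' sd) (beta := b) (C1 := 1)) => //.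
    - by rewrite lt_max c0.
    - by apply/andP; split.
    - move=> n0; have [n n0n [l [ln lA]]] := Sb i n0; exists n => //; exists l.
      by rewrite mul1r.
  rewrite Rintegral_indic// => f0; rewrite -(fineK (fin_num_measure mu _ (mS i))) f0//.
have nA := msupport_sub cA sA.
have mA : measurable (A : set (borel_space R d)) by exact: measurable_closed.
have A0 : mu A = 0%E.
  apply: measure_negligible => //.
  apply: (@negligibleS _ _ _ mu (\bigcup_i S i)) => //.
  by apply: negligible_bigcup => i; exists (S i); split; [exact: mS|exact: S0|].
have := probability_setC mu mA; rewrite A0 sube0 nA => /esym/eqP.
by rewrite onee_eq0.
Qed.

Lemma fourier_dim_ge_sub (A T : set 'rV[R]_d) s mu : 0 <= s <= d%:R ->
  T `<=` A -> decay_measure T s mu -> s <= fourier_dim A.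
Proof.
move=> sd TA [sT dT]; apply: (fourier_dim_ge sd (mu := mu)); split=> //.
exact: subset_trans sT TA.
Qed.

Lemma decay_measure_neq0 (T : set 'rV[R]_d) s mu : closed T -> decay_measure T s mu -> T !=set0.
Proof.
move=> cT [sT _]; apply/set0P; apply/eqP => T0.
have := msupport_sub cT sT; rewrite T0 setC0 probability_setT => /eqP.
by rewrite onee_eq0.
Qed.

End dimension_bounds.

Section hardness.
Context {R : realType} {d : nat}.
Hypothesis d0 : (0 < d)%N.

(** The i-th compact set is placed near (i, ..., i), which makes the blocks escape to infinity. Its
    decay exponent [s i] and covering exponent [b i] give the lower and the upper bound. *)
Lemma salem_reduction {X : topologicalType} (s b : nat -> R) (F : nat -> set X) :
  polish R X -> has_clopen_basis X -> (forall i, closed (F i)) ->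
  (forall i, 0 < s i < b i) -> (forall i, s i <= d%:R) ->
  exists Phi : X -> fell R d,
    [/\ continuous Phi, forall i x, F i x -> s i <= fourier_dim (Phi x) &
        forall x q, 0 <= q -> (forall i, F i x -> b i <= q) ->
          fourier_dim (Phi x) <= q].
Proof.
move=> pX bX cF sb sd.
have [T HT] := choice (fun i => salem_set d0 (const_mx i%:R : 'rV[R]_d) (sb i)).
have cT i : compact (T i) by have [] := HT i.
have clT i : closed (T i) by apply: compact_closed; [exact: hausdorff_rV|exact: cT].
have T0 i : T i !=set0.
  by have [_ _ [mu dmu] _] := HT i; exact: decay_measure_neq0 dmu.
have T_far (M : R) : exists n, forall i z, (n <= i)%N -> T i z -> M < `|z|.
  exists (Num.truncn (M + 2)).+1 => i z ni Tz.
  have [_ /(_ z Tz) zi _ _] := HT i.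
  have Mi : M + 2 < i%:R by apply: lt_le_trans (truncnS_gt _) _; rewrite ler_nat.
  have iz : i%:R <= `|z| + 2.
    have := coord_le_norm (const_mx i%:R : 'rV[R]_d) (Ordinal d0).
    rewrite mxE ger0_norm// => /le_trans; apply.
    rewrite -[const_mx i%:R](subrK z) addrC; apply: le_trans (ler_normD _ _) _.
    by rewrite lerD2l distrC.
  by rewrite -(ltrD2r 2); exact: lt_le_trans iz.
have [Phi [e [cPhi TPhi PhiT]]] := fell_reduction pX bX cT T0 T_far cF.
have clPhi x : closed (fell_set (Phi x)) by exact: closed_carrier.
exists Phi; split=> // [i x Fx|x q q0 Fq].
  have [_ _ [mu dmu] _] := HT i; have /andP[s0 _] := sb i.
  by apply: (fourier_dim_ge_sub _ (TPhi i x Fx) dmu); rewrite (ltW s0) sd.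
(* Covers the union by the active compact sets and by all points of the dense sequences, as
   singletons. *)
pose S n : set 'rV[R]_d := match unpickle n with
  | Some (inl i) => if `[< F i x >] then T i else set0
  | Some (inr (i, j)) => [set e i j]
  | None => set0
  end.
have SE1 i : F i x -> T i = S (pickle (inl i : nat + nat * nat)).
  by move=> Fx; rewrite /S pickleK asboolT.
have SE2 i j : [set e i j] = S (pickle (inr (i, j) : nat + nat * nat)).
  by rewrite /S pickleK.
apply: (fourier_dim_le_cover d0 (S := S)) => //.
- move=> n; rewrite /S; case: unpickle => [[i|[i j]]|]; last exact: closed0.
    by case: ifP => _; [exact: clT|exact: closed0].
  exact: (accessible_closed_set1 (hausdorff_accessible (@hausdorff_rV R d))).
- move=> n; rewrite /S; case: unpickle => [[i|[i j]]|].
  + case: asboolP => [Fx|_]; last exact: covered_by_set0.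
    by have [_ _ _] := HT i; apply: covered_by_weaken; exact: Fq.
  + exact: covered_by_set1.
  + exact: covered_by_set0.
- move=> z /PhiT[[i Fx Tz]|[i [j ze]]].
    by move: Tz; rewrite (SE1 i Fx); move: (pickle _) => n Sn; exists n.
  have : [set e i j] z by [].
  by rewrite SE2; move: (pickle _) => n Sn; exists n.
Qed.

Lemma hard_dim_gt (p : R) : 0 <= p < d%:R ->
  hard R (Sigma0 2) [set A : fell R d | p < fourier_dim A].
Proof.
move=> /andP[p0 pd] X pX bX A /sigma2_bigcup_closed[F cF ->].
(* All blocks have the same exponents: a single active one raises the dimension above p, and without
   any the set is countable. *)
pose s := (p + d%:R) / 2; have ps : p < s by rewrite /s; lra.
have sd : s < d%:R by rewrite /s; lra.
have sd' : 0 < s < d%:R by rewrite sd (le_lt_trans p0 ps).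
have [Phi [cPhi geP leP]] := salem_reduction pX bX cF (fun=> sd') (fun=> ltW sd).
exists Phi => // x; split=> [[i _ Fx]|/= pPhi].
  exact: lt_le_trans ps (geP i x Fx).
apply: contrapT => nF; have : fourier_dim (Phi x) <= p.
  by apply: leP => // i Fx; case: nF; exists i.
by rewrite leNgt pPhi.
Qed.

(** Blocks are indexed by finite words, a word w being active when x lies in [F i] of the i-th
    letter for every i below its length. Longer words carry dimensions closer to q but never
    reaching it, so dimension q requires active words of every length, which means membership in the
    intersection. *)
Lemma hard_dim_ge (q : R) : 0 < q <= d%:R ->
  hard R (Pi0 3) [set A : fell R d | q <= fourier_dim A].
Proof.
move=> /andP[q0 qd] X pX bX A /(pi3_bigcap_bigcup pX bX)[F cF ->].
(* Indices coding no word stand for the empty word, which is always active and whose block has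
   dimension below q. *)
pose w k : seq nat := odflt [::] (unpickle k).
(* Increases strictly to q from b 0 = 0. Lengths are shifted by one because [salem_reduction] needs
   positive exponents. *)
pose b n := q - q * n.+1%:R^-1.
have bq n : b n < q by rewrite /b ltrBlDr ltrDl mulr_gt0.
have bS m n : (m <= n)%N -> b m <= b n.
  by move=> mn; rewrite /b lerD2l lerN2 ler_pM2l// lef_pV2 ?posrE// ler_nat.
have bS' m n : (m < n)%N -> b m < b n.
  by move=> mn; rewrite /b ltrD2l ltrN2 ltr_pM2l// ltf_pV2 ?posrE// ltr_nat.
have b0 n : (0 < n)%N -> 0 < b n.
  by move=> /bS'; apply: le_lt_trans; rewrite /b invr1 mulr1 subrr.
pose G k : set X := \bigcap_(i in `I_(size (w k))) F i (nth 0%N (w k) i).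
have cG k : closed (G k) by apply: closed_bigI => i _; exact: cF.
have sb k : 0 < b (size (w k)).+1 < b (size (w k)).+2 by rewrite b0// bS'.
have sd k : b (size (w k)).+1 <= d%:R by exact: le_trans (ltW (bq _)) qd.
have [Phi [cPhi geP leP]] := salem_reduction pX bX cG sb sd.
exists Phi => // x; split=> [Ax|/= qPhi].
  have [|f Hf] := @choice _ _ (fun n m => F n m x).
    by move=> n; have [m _ Fm] := Ax n I; exists m.
  have bPhi n : b n.+1 <= fourier_dim (Phi x).
    have Ew : w (pickle (mkseq f n)) = mkseq f n by rewrite /w pickleK.
    move: (pickle _) Ew => k wk; have := geP k x; rewrite wk size_mkseq; apply.
    by move=> i /=; rewrite wk size_mkseq => lin; rewrite nth_mkseq.
  rewrite /= leNgt; apply/negP => /ltr_add_invr[k kq].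
  have [n qn] : exists n, q * n.+2%:R^-1 < k.+1%:R^-1.
    exists (Num.truncn (q * k.+1%:R)); rewrite ltr_pdivrMr//.
    rewrite mulrC ltr_pdivlMr//.
    by apply: lt_le_trans (truncnS_gt _) _; rewrite ler_nat.
  move: (bPhi n) kq qn; rewrite /b; move: (q * n.+2%:R^-1) (k.+1%:R^-1) (fourier_dim _).
  by move=> u v D; lra.
apply: contrapT => nA.
have [n nF] : exists n, forall m, ~ F n m x.
  apply: contrapT => H; apply: nA => n _; apply: contrapT => H2; apply: H.
  by exists n => m Fm; apply: H2; exists m.
have : fourier_dim (Phi x) <= b n.+2.
  apply: leP => [|k Gk]; first exact/ltW/b0.
  (* An active word longer than n would provide some m with x in [F n m]. *)
  apply: bS; rewrite !ltnS leqNgt; apply/negP => nk.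
  exact: nF (Gk n nk).
by rewrite leNgt (lt_le_trans (bq _) qPhi).
Qed.

End hardness.

Theorem theorem5p5 (R : realType) (d : nat) (hd : (1 <= d)%N) :
  [/\ Sigma0 2 [set Ap : (upper_fell R d * set_type (dim_range R d))%type |
        fourier_dim Ap.1 > \val Ap.2],
      Pi0 3 [set Ap : (upper_fell R d * set_type (dim_range R d))%type |
        fourier_dim Ap.1 >= \val Ap.2],
      forall p : R, 0 <= p < d%:R ->
        complete_for R (Sigma0 2) [set A : fell R d | fourier_dim A > p] &
      forall q : R, 0 < q <= d%:R ->
        complete_for R (Pi0 3) [set A : fell R d | fourier_dim A >= q]].
Proof.
pose Y : topologicalType := (upper_fell R d * set_type (dim_range R d))%type.
have cfst : continuous (fun y : Y => y.1 : upper_fell R d) by move=> y; exact: cvg_fst.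
have cval : continuous (fun y : Y => \val y.2 : R).
  move=> y; apply: (@continuous_comp _ _ _ (@snd _ _) (\val : set_type (dim_range R d) -> R)).
    exact: cvg_snd.
  exact: initial_continuous.
have cF : continuous (@fell_to_upper R d) by exact: fell_to_upper_continuous.
have ccst (p : R) : continuous ((fun=> p) : fell R d -> R) by exact: cst_continuous.
split.
- exact: (@sigma2_dim_gt _ _ hd Y _ _ cfst cval).
- exact: (@pi3_dim_ge _ _ hd Y _ _ cfst cval).
- move=> p hp; split; first exact: hard_dim_gt.
  exact: (@sigma2_dim_gt _ _ hd _ _ _ cF (ccst p)).
- move=> q hq; split; first exact: hard_dim_ge.
  exact: (@pi3_dim_ge _ _ hd _ _ _ cF (ccst q)).
Qed.
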